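(* Let $d,M\in\mathbb{N}$ and $\mathcal{D}=[-1,1]^d$ with boundary $\partial\mathcal{D}$. Assume that the vector field $g^0:\mathcal{D}\to\mathbb{R}^d$ is of class $\mathcal{C}^2$ on $\mathcal{D}$, that the vector fields $g^m:\mathcal{D}\to\mathbb{R}^d$, $m\in\{1,\ldots,M\}$, are of class $\mathcal{C}^3$ on $\mathcal{D}$, and that $g^m(x)=0$ for all $x\in\partial\mathcal{D}$ and all $m\in\{0,1,\ldots,M\}$. Let $x_0\in\mathcal{D}$ and let $(X(t))_{t\ge 0}$ be the solution of the Stratonovich stochastic differential equation $\mathrm{d}X(t)=g^0(X(t))\,\mathrm{d}t+\sum_{m=1}^M g^m(X(t))\circ\mathrm{d}B^m(t)$, $X(0)=x_0$. Assume that $\Phi:\mathbb{R}^+\times\mathbb{R}\times[-1,1]\to\mathbb{R}$, $(s,\gamma,y)\mapsto\Phi(s,\gamma,y)$, is such that $\Phi(s,\gamma,y)\in[-1,1]$ for all $s\ge 0$, $\gamma\in\mathbb{R}$, $y\in[-1,1]$; that for all $y\in[-1,1]$ one has $\Phi(0,0,y)=y$, $\partial_\gamma\Phi(0,0,y)=\sigma(y)$ and $\partial_s\Phi(0,0,y)+\frac12\partial_\gamma^2\Phi(0,0,y)=0$; and that $\Phi$ is of class $\mathcal{C}^3$ with $\|\Phi\|_{3,\beta}<\infty$ for some $\beta\in(0,\infty)$. Given $T\in(0,\infty)$ and $\tau=T/N$ with $N\in\mathbb{N}$, let $(X_n)_{n=0,\ldots,N}$ be defined by $X_0=x_0$ and,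 for $n\in\{0,\ldots,N-1\}$, $k\in\{1,\ldots,d\}$, $$X_{n+1,k}=\Phi\left(\|f_k(X_n)\|^2\tau,\ f_k(X_n)\cdot\delta B_n+\overline{f}_k^0(X_n)\tau,\ X_{n,k}\right).$$ Then for all $T\in(0,\infty)$ there exists $C(T)\in(0,\infty)$ such that for all $\tau=T/N$ with $N\in\mathbb{N}$ one has $$\sup_{0\le n\le N}\left(\mathbb{E}\left[\|X_n-X(t_n)\|^2\right]\right)^{\frac12}\le C(T)\,\tau^{\frac12}.$$
   Context: $B=(B^1,\ldots,B^M)$ is a standard $\mathbb{R}^M$-valued Brownian motion; $t_n=n\tau$ and $\delta B_n=B(t_{n+1})-B(t_n)\in\mathbb{R}^M$. Components of vectors in $\mathbb{R}^d$ are indexed by $k$. The Stratonovich equation is understood through its equivalent Itô formulation $\mathrm{d}X(t)=\overline{g}^0(X(t))\,\mathrm{d}t+\sum_{m=1}^M g^m(X(t))\,\mathrm{d}B^m(t)$ with $\overline{g}_k^0(x)=g_k^0(x)+\frac12\sum_{m=1}^M\sum_{\ell=1}^d\partial_{x_\ell}g_k^m(x)g_\ell^m(x)$; it has a unique solution, and almost surely $X(t)\in\mathcal{D}$ for all $t\ge 0$. $\sigma(y)=(y-1)(y+1)$ for $y\in[-1,1]$. For $m\in\{0,\ldots,M\}$ and $k,\ell\in\{1,\ldots,d\}$, $f_{k,\ell}^m:\mathcal{D}\to\mathbb{R}$ is the (unique) continuous function such that $g_\ell^m(x)=\sigma(x_k)f_{k,\ell}^m(x)$ for all $x\in\mathcal{D}$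 (it exists since $g_\ell^m$ is $\mathcal{C}^2$ and vanishes on $\partial\mathcal{D}$), and $f_k^m=f_{k,k}^m$, so that $g_k^m(x)=\sigma(x_k)f_k^m(x)$. Set $f_k=(f_k^1,\ldots,f_k^M)\in\mathbb{R}^M$ with Euclidean inner product $\cdot$ and norm $\|\cdot\|$, and $$\overline{f}_k^0(x)=f_k^0(x)+\frac12\sum_{m=1}^M\sum_{\ell=1}^d\partial_{x_\ell}g_k^m(x)f_{k,\ell}^m(x),$$ so that $\overline{g}_k^0(x)=\sigma(x_k)\overline{f}_k^0(x)$. For $p\in\mathbb{N}$, $\beta\in(0,\infty)$ and $\Phi$ of class $\mathcal{C}^p$, $$\|\Phi\|_{p,\beta}=\sum_{|\alpha|\le p}\ \sup_{s\ge 0,\gamma\in\mathbb{R},y\in[-1,1]}e^{-\beta(s+|\gamma|)}\left|\partial_s^{\alpha_s}\partial_\gamma^{\alpha_\gamma}\partial_y^{\alpha_y}\Phi(s,\gamma,y)\right|\in[0,\infty],$$ where $\alpha=(\alpha_s,\alpha_\gamma,\alpha_y)\in\mathbb{N}_0^3$, $|\alpha|=\alpha_s+\alpha_\gamma+\alpha_y$. The constant $C(T)$ does not depend on $N$. *)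

(* Defs.v *)
From HB Require Import structures.
From mathcomp Require Import all_boot all_order all_algebra.
From mathcomp Require Import all_classical all_reals all_analysis.

Set Implicit Arguments.
Unset Strict Implicit.
Unset Printing Implicit Defensive.

Import Order.TTheory GRing.Theory Num.Theory.
Import numFieldNormedType.Exports.

Local Open Scope classical_set_scope.
Local Open Scope ring_scope.

(* The library norm on row vectors is the sup norm, hence [enorm]. *)
Definition dotp (R : realType) (n : nat) (u v : 'rV[R]_n) : R :=
  \sum_(i < n) u 0 i * v 0 i.

Definition enorm (R : realType) (n : nat) (u : 'rV[R]_n) : R :=
  Num.sqrt (dotp u u).

(* Partial derivatives of a function that is only meaningful on D: the limit
   is taken along increments that stay in D, so it is one-sided where D ends.
   Used only for D a product of nondegenerate intervals.  At points of D the
   result does not depend on the values of f outside D. *)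
Definition pquot (R : realType) (n : nat) (f : 'rV[R]_n -> R) (i : 'I_n)
    (x : 'rV[R]_n) (h : R) : R :=
  h^-1 * (f (x + h *: 'e_i) - f x).

Definition pdom (R : realType) (n : nat) (D : set 'rV[R]_n) (i : 'I_n)
    (x : 'rV[R]_n) : set R :=
  [set h | D (x + h *: 'e_i)].

Definition pderivable (R : realType) (n : nat) (D : set 'rV[R]_n)
    (f : 'rV[R]_n -> R) (i : 'I_n) (x : 'rV[R]_n) : Prop :=
  cvg (pquot f i x @ within (pdom D i x) 0^').

Definition pderive (R : realType) (n : nat) (D : set 'rV[R]_n) (i : 'I_n)
    (f : 'rV[R]_n -> R) (x : 'rV[R]_n) : R :=
  lim (pquot f i x @ within (pdom D i x) 0^').

Fixpoint classC (R : realType) (n : nat) (D : set 'rV[R]_n) (p : nat)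
    (f : 'rV[R]_n -> R) : Prop :=
  {within D, continuous f} /\
  if p is q.+1 then
    forall i : 'I_n, (forall x, D x -> pderivable D f i x) /\
                     classC D q (pderive D i f)
  else True.

Definition classC_field (R : realType) (n : nat) (D : set 'rV[R]_n) (p : nat)
    (v : 'rV[R]_n -> 'rV[R]_n) : Prop :=
  forall k : 'I_n, classC D p (fun x => v x 0 k).

Definition cube (R : realType) (d : nat) : set 'rV[R]_d :=
  [set x | forall k, -1 <= x 0 k <= 1].
Arguments cube : clear implicits.

Definition boundary (T : topologicalType) (A : set T) : set T :=
  closure A `\` A°.

Definition sigma (R : realType) (y : R) : R := (y - 1) * (y + 1).

Definition is_factor (R : realType) (d : nat) (v : 'rV[R]_d -> 'rV[R]_d)
    (k l : 'I_d) (phi : 'rV[R]_d -> R) : Prop :=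
  {within cube R d, continuous phi} /\
  forall x, cube R d x -> v x 0 l = sigma (x 0 k) * phi x.

(* Ito drift of the Stratonovich equation with fields g0, g. *)
Definition gbar0 (R : realType) (d M : nat) (g0 : 'rV[R]_d -> 'rV[R]_d)
    (g : 'I_M -> 'rV[R]_d -> 'rV[R]_d) (k : 'I_d) (x : 'rV[R]_d) : R :=
  g0 x 0 k + 2^-1 * \sum_(m < M) \sum_(l < d)
    pderive (cube R d) l (fun y => g m y 0 k) x * g m x 0 l.

Definition fbar0 (R : realType) (d M : nat)
    (g : 'I_M -> 'rV[R]_d -> 'rV[R]_d) (f0 : 'I_d -> 'I_d -> 'rV[R]_d -> R)
    (f : 'I_M -> 'I_d -> 'I_d -> 'rV[R]_d -> R) (k : 'I_d) (x : 'rV[R]_d) : R :=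
  f0 k k x + 2^-1 * \sum_(m < M) \sum_(l < d)
    pderive (cube R d) l (fun y => g m y 0 k) x * f m k l x.

Definition fvec (R : realType) (d M : nat)
    (f : 'I_M -> 'I_d -> 'I_d -> 'rV[R]_d -> R) (k : 'I_d) (x : 'rV[R]_d)
    : 'rV[R]_M :=
  \row_m f m k k x.

(** Stochastic processes.  Time is a real number; only times t >= 0 matter. *)

Definition filtration (d : measure_display) (Omega : measurableType d)
    (R : realType) (F : R -> set (set Omega)) : Prop :=
  [/\ forall t, 0 <= t -> sigma_algebra setT (F t),
      forall t, 0 <= t -> F t `<=` measurable &
      forall s t, 0 <= s -> s <= t -> F s `<=` F t].

Definition measurable_wrt (R : realType) (Omega : Type) (G : set (set Omega))
    (Y : Omega -> R) : Prop :=
  forall A : set R, measurable A -> G (Y @^-1` A).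

Definition adapted (R : realType) (Omega : Type) (n : nat)
    (F : R -> set (set Omega)) (X : R -> Omega -> 'rV[R]_n) : Prop :=
  forall t, 0 <= t -> forall k, measurable_wrt (F t) (fun w => X t w 0 k).

Definition as_continuous (d : measure_display) (Omega : measurableType d)
    (R : realType) (P : probability Omega R) (n : nat)
    (X : R -> Omega -> 'rV[R]_n) : Prop :=
  {ae P, forall w, {within `[0, +oo[, continuous (fun t => X t w)}}.

(* The third condition says at once that B t - B s is independent of F s, that
   its components are mutually independent, and that each of them is
   N(0, t - s); [normal_prob] takes the standard deviation. *)
Definition brownian_motion (d : measure_display) (Omega : measurableType d)
    (R : realType) (P : probability Omega R) (M : nat)
    (F : R -> set (set Omega)) (B : R -> Omega -> 'rV[R]_M) : Prop :=
  [/\ {ae P, forall w, B 0 w = 0},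
      adapted F B,
      forall s t, 0 <= s -> s < t ->
        forall (A : set Omega) (C : 'I_M -> set R),
          F s A -> (forall m, measurable (C m)) ->
          P (A `&` [set w | forall m, C m ((B t w - B s w) 0 m)]) =
          (P A * \prod_(m < M) normal_prob 0 (Num.sqrt (t - s)) (C m))%E &
      as_continuous P B].

(* The process with value el_coef i on ]el_time i, el_time i.+1] for
   i < el_size, and 0 elsewhere. *)
Record elementary_process (R : realType) (Omega : Type)
    (F : R -> set (set Omega)) := ElementaryProcess {
  el_size : nat;
  el_time : nat -> R;
  el_coef : nat -> Omega -> R;
  el_time_ge0 : 0 <= el_time 0%N;
  el_time_homo : {homo el_time : i j / (i <= j)%N >-> i <= j};
  el_coef_meas : forall i, measurable_wrt (F (el_time i)) (el_coef i);
  el_coef_bounded : forall i, exists K : R, forall w, `|el_coef i w| <= K }.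

Definition el_val (R : realType) (Omega : Type) (F : R -> set (set Omega))
    (E : elementary_process F) (s : R) (w : Omega) : R :=
  \sum_(i < el_size E)
    el_coef E i w * \1_(`]el_time E i, el_time E i.+1]) s.

Definition el_integral (R : realType) (Omega : Type) (F : R -> set (set Omega))
    (E : elementary_process F) (b : R -> Omega -> R) (t : R) (w : Omega) : R :=
  \sum_(i < el_size E) el_coef E i w *
    (b (Num.min (el_time E i.+1) t) w - b (Num.min (el_time E i) t) w).

(* I is (a version of) the Ito integral of H on [0, t] against the scalar
   Brownian motion b: the isometric extension of [el_integral], i.e. the
   L^2(P) limit of the integrals of elementary processes that converge to H
   in L^2(dt x P). *)
Definition is_ito_integral (d : measure_display) (Omega : measurableType d)
    (R : realType) (P : probability Omega R) (F : R -> set (set Omega))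
    (b H : R -> Omega -> R) (t : R) (I : Omega -> R) : Prop :=
  measurable_fun setT I /\
  exists E : nat -> elementary_process F,
    ((fun n => \int[lebesgue_measure]_(s in `[0%R, t])
                 'E_P[fun w => ((el_val (E n) s w - H s w) ^+ 2)%R])%E
       @ \oo --> 0%E) /\
    ((fun n => 'E_P[fun w => ((el_integral (E n) b t w - I w) ^+ 2)%R])%E
       @ \oo --> 0%E).

(* D-valued solution of dX = a(X) dt + sum_m b^m(X) dB^m, X(0) = x0.  The
   coefficients are functions on D; the value 0 given to them outside D is
   immaterial since X stays in D almost surely. *)
Definition ito_solution (d : measure_display) (Omega : measurableType d)
    (R : realType) (P : probability Omega R) (n M : nat)
    (F : R -> set (set Omega)) (B : R -> Omega -> 'rV[R]_M) (D : set 'rV[R]_n)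
    (a : 'I_n -> 'rV[R]_n -> R) (b : 'I_M -> 'I_n -> 'rV[R]_n -> R)
    (x0 : 'rV[R]_n) (X : R -> Omega -> 'rV[R]_n) : Prop :=
  [/\ adapted F X,
      as_continuous P X,
      {ae P, forall w, forall t, 0 <= t -> D (X t w)} &
      forall t, 0 <= t -> forall k : 'I_n,
        exists I : 'I_M -> Omega -> R,
          (forall m, is_ito_integral P F (fun s w => B s w 0 m)
             (fun s w => patch (fun=> 0) D (b m k) (X s w)) t (I m)) /\
          {ae P, forall w, X t w 0 k = x0 0 k
             + \int[lebesgue_measure]_(s in `[0, t])
                 patch (fun=> 0) D (a k) (X s w)
             + \sum_(m < M) I m w}].

Definition stratonovich_solution (d : measure_display)
    (Omega : measurableType d) (R : realType) (P : probability Omega R)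
    (n M : nat) (F : R -> set (set Omega)) (B : R -> Omega -> 'rV[R]_M)
    (g0 : 'rV[R]_n -> 'rV[R]_n) (g : 'I_M -> 'rV[R]_n -> 'rV[R]_n)
    (x0 : 'rV[R]_n) (X : R -> Omega -> 'rV[R]_n) : Prop :=
  ito_solution P F B (cube R n) (gbar0 g0 g) (fun m k x => g m x 0 k) x0 X.

(** The map Phi(s, gamma, y), with coordinates 0, 1, 2 of 'rV_3. *)

Definition ix_s : 'I_3 := @Ordinal 3 0 isT.
Definition ix_gamma : 'I_3 := @Ordinal 3 1 isT.
Definition ix_y : 'I_3 := @Ordinal 3 2 isT.

Definition pt3 (R : realType) (s gamma y : R) : 'rV[R]_3 :=
  \row_i nth 0 [:: s; gamma; y] i.

Definition unc3 (R : realType) (Phi : R -> R -> R -> R) (v : 'rV[R]_3) : R :=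
  Phi (v 0 ix_s) (v 0 ix_gamma) (v 0 ix_y).

Definition domPhi (R : realType) : set 'rV[R]_3 :=
  [set v | 0 <= v 0 ix_s /\ -1 <= v 0 ix_y <= 1].
Arguments domPhi : clear implicits.

(* Partial derivative of order a, b, c in s, gamma, y respectively. *)
Definition dPhi (R : realType) (Phi : R -> R -> R -> R) (a b c : nat)
    (s gamma y : R) : R :=
  iter a (pderive (domPhi R) ix_s)
    (iter b (pderive (domPhi R) ix_gamma)
      (iter c (pderive (domPhi R) ix_y) (unc3 Phi))) (pt3 s gamma y).

Definition norm_pbeta (R : realType) (p : nat) (beta : R)
    (Phi : R -> R -> R -> R) : \bar R :=
  (\sum_(al : 'I_p.+1 * 'I_p.+1 * 'I_p.+1 |
         (al.1.1 + al.1.2 + al.2 <= p)%N)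
     ereal_sup [set e | exists s gamma y : R,
       [/\ (0 <= s)%R, (-1 <= y <= 1)%R &
           e = (expR (- beta * (s + `|gamma|)) *
                `|dPhi Phi al.1.1 al.1.2 al.2 s gamma y|)%:E]])%E.

Fixpoint scheme (R : realType) (d M : nat) (Omega : Type)
    (Phi : R -> R -> R -> R) (g : 'I_M -> 'rV[R]_d -> 'rV[R]_d)
    (f0 : 'I_d -> 'I_d -> 'rV[R]_d -> R)
    (f : 'I_M -> 'I_d -> 'I_d -> 'rV[R]_d -> R)
    (B : R -> Omega -> 'rV[R]_M) (x0 : 'rV[R]_d) (tau : R) (n : nat)
    (w : Omega) : 'rV[R]_d :=
  if n is q.+1 then
    let x := scheme Phi g f0 f B x0 tau q w in
    let dB := B (q.+1%:R * tau) w - B (q%:R * tau) w in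
    \row_k Phi (enorm (fvec f k x) ^+ 2 * tau)
               (dotp (fvec f k x) dB + fbar0 g f0 f k x * tau)
               (x 0 k)
  else x0.

(* Main.v *)
Require Import Defs.
From HB Require Import structures.
From mathcomp Require Import all_boot all_order all_algebra.
From mathcomp Require Import ring lra.
From mathcomp Require Import all_classical all_reals all_analysis measurable_realfun.
Import Order.TTheory GRing.Theory Num.Theory.
Import numFieldNormedType.Exports.
Set Implicit Arguments.
Unset Strict Implicit.
Unset Printing Implicit Defensive.
Local Open Scope classical_set_scope.
Local Open Scope ring_scope.

(* Both the scheme and the solution move over one step [u, v] by
     a(X_n) tau + sum_m b^m(X_n) (B^m(v) - B^m(u))
   plus a remainder of mean square O(tau^3), and a remainder of mean square
   O(tau^2) that is orthogonal to every bounded F_u-measurable variable; for the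
   solution there is in addition an O(tau) multiple of the current mean square
   error.  For the scheme this is the third order Taylor expansion of Phi at
   (0, 0, y): the hypotheses on its derivatives and sigma f = g turn the terms
   of order 0 and 1 into the Euler step, and the surviving second order term
     (1/2) Phi_gamma_gamma(0, 0, y) ((f . dB)^2 - |f|^2 tau)
   is centred.  For the solution it follows from the Ito isometry and the
   Lipschitz continuity of the coefficients on the cube.  As the error at time u
   is F_u-measurable and bounded, the orthogonal remainders do not interact with
   it, so the mean square error e_n satisfies
   e_(n+1) <= (1 + a tau) e_n + b tau^2, and Gronwall's lemma gives
   e_n = O(tau). *)

(** * Expectation, Gaussian moments, independence *)

(** Much of the work lies between the definitions and these estimates. The Ito integral is defined
    separately at each time, along approximating sequences that may differ from one time to another;
    before an increment can be estimated, the isometry has to show that one elementary process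
    approximates the integrals at u and at v simultaneously. The solution is continuous and
    cube-valued only almost surely, and the filtration is not assumed complete, so two versions of
    it are used: [clip], which is adapted, and a jointly measurable one for Fubini. They agree
    almost surely. Both expansions are taken at the scheme value, not each at its own point: the
    Euler terms then cancel exactly in the difference, and the distance between the two points is
    charged to the remainders of the solution. Without orthogonality the T/tau remainders of L^2
    norm O(tau) would add up to O(1). *)

Section expectation_toolkit.
Context {d} {T : measurableType d} {R : realType} (P : probability T R).
Implicit Types f g h : T -> R.

(** A real number, so that [ring] and [lra] apply; [meanE] identifies it with ['E_P] on integrable
    functions. It is 0 when the integral is infinite, hence the integrability conditions carried
    throughout. *)
Definition mean f : R := Rintegral P setT f.

Definition intg f : Prop := P.-integrable setT (EFin \o f).

Definition sqint f : Prop := measurable_fun setT f /\ intg (fun w => f w ^+ 2).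

Lemma intg_meas f : intg f -> measurable_fun setT f.
Proof. by move=> /measurable_int/measurable_EFinP. Qed.

Lemma le_intg f g : measurable_fun setT f -> (forall w, `|f w| <= g w) ->
  intg g -> intg f.
Proof.
move=> mf fg; apply: le_integrable => //; first exact/measurable_EFinP.
by move=> w _ /=; rewrite lee_fin; apply: (le_trans (fg w)); exact: ler_norm.
Qed.

Lemma intg_cst c : intg (cst c).
Proof. exact: finite_measure_integrable_cst. Qed.

Lemma intg_bounded f K : measurable_fun setT f -> (forall w, `|f w| <= K) ->
  intg f.
Proof. by move=> mf fK; apply: (le_intg (g := cst K)) => //; exact: intg_cst. Qed.

Lemma intgD f g : intg f -> intg g -> intg (fun w => f w + g w).
Proof. by move=> fi gi; exact: (integrableD _ fi gi). Qed.

Lemma intgB f g : intg f -> intg g -> intg (fun w => f w - g w).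
Proof. by move=> fi gi; exact: (integrableB _ fi gi). Qed.

Lemma intgZ c f : intg f -> intg (fun w => c * f w).
Proof. by move=> fi; exact: (integrableZl _ c fi). Qed.

Lemma intg_sum (I : Type) (s : seq I) (h : I -> T -> R) :
  (forall i, intg (h i)) -> intg (fun w => \sum_(i <- s) h i w).
Proof.
move=> hi; elim: s => [|i s ih].
  by under eq_fun do rewrite big_nil; exact: intg_cst.
by under eq_fun do rewrite big_cons; exact: intgD.
Qed.

Lemma intg_normr f : intg f -> intg (fun w => `|f w|).
Proof. by move=> fi; exact: integrable_norm. Qed.

Lemma meanE f : intg f -> ('E_P[f] = (mean f)%:E)%E.
Proof. by move=> fi; rewrite unlock fineK//; exact: integrable_fin_num. Qed.

Lemma meanD f g : intg f -> intg g -> mean (fun w => f w + g w) = mean f + mean g.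
Proof. by move=> fi gi; rewrite /mean RintegralD. Qed.

Lemma meanB f g : intg f -> intg g -> mean (fun w => f w - g w) = mean f - mean g.
Proof. by move=> fi gi; rewrite /mean RintegralB. Qed.

Lemma meanZ c f : intg f -> mean (fun w => c * f w) = c * mean f.
Proof. by move=> fi; rewrite /mean RintegralZl. Qed.

Lemma mean_cst c : mean (cst c) = c.
Proof.
rewrite /mean /cst Rintegral_cst// -[RHS]mulr1; congr (_ * _).
exact: (congr1 fine (probability_setT P)).
Qed.

Lemma mean_sum (I : Type) (s : seq I) (h : I -> T -> R) :
  (forall i, intg (h i)) ->
  mean (fun w => \sum_(i <- s) h i w) = \sum_(i <- s) mean (h i).
Proof.
move=> hi; elim: s => [|i s ih].
  by under eq_fun do rewrite big_nil; rewrite big_nil mean_cst.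
under eq_fun do rewrite big_cons.
by rewrite big_cons meanD ?ih//; exact: intg_sum.
Qed.

Lemma mean_ge0 f : (forall w, 0 <= f w) -> 0 <= mean f.
Proof. by move=> f0; exact: Rintegral_ge0. Qed.

Lemma mean_le f g : intg f -> intg g -> (forall w, f w <= g w) -> mean f <= mean g.
Proof. by move=> fi gi fg; exact: le_Rintegral. Qed.

Lemma mean_normr f : intg f -> `|mean f| <= mean (fun w => `|f w|).
Proof. by move=> fi; exact: le_normr_Rintegral. Qed.

Lemma mean_ae f g : measurable_fun setT f -> measurable_fun setT g ->
  {ae P, forall w, f w = g w} -> mean f = mean g.
Proof.
move=> mf mg [N [mN N0 fgN]]; congr fine.
apply: ae_eq_integral => //; try exact/measurable_EFinP.
exists N; split=> // w /= fg; apply: fgN => /= fgw; apply: fg => _.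
by rewrite fgw.
Qed.

Lemma sqintM f g : sqint f -> sqint g -> intg (fun w => f w * g w).
Proof.
move=> [mf fi] [mg gi].
apply: (le_intg (g := fun w => f w ^+ 2 + g w ^+ 2)).
- exact: measurable_funM.
- move=> w; rewrite ler_norml; have := sqr_ge0 (f w + g w).
  have := sqr_ge0 (f w - g w); nra.
- exact: intgD.
Qed.

Lemma sqintD f g : sqint f -> sqint g -> sqint (fun w => f w + g w).
Proof.
move=> [mf fi] [mg gi]; split; first exact: measurable_funD.
apply: (le_intg (g := fun w => 2 * (f w ^+ 2 + g w ^+ 2))).
- by apply: measurable_funX; exact: measurable_funD.
- move=> w; rewrite ger0_norm ?sqr_ge0//.
  have := sqr_ge0 (f w - g w); nra.
- by apply: intgZ; exact: intgD.
Qed.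

Lemma sqintZ c f : sqint f -> sqint (fun w => c * f w).
Proof.
move=> [mf fi]; split; first exact: measurable_funM.
by under eq_fun do rewrite exprMn; exact: intgZ.
Qed.

Lemma sqintB f g : sqint f -> sqint g -> sqint (fun w => f w - g w).
Proof.
move=> fi gi; under eq_fun do rewrite -mulN1r.
by apply: sqintD => //; exact: sqintZ.
Qed.

Lemma sqint_bounded f K : measurable_fun setT f -> (forall w, `|f w| <= K) ->
  sqint f.
Proof.
move=> mf fK; split=> //.
apply: (intg_bounded (K := K ^+ 2)); first exact: measurable_funX.
by move=> w; rewrite normrX lerXn2r ?nnegrE// (le_trans _ (fK w)).
Qed.

Lemma sqint_cst c : sqint (cst c).
Proof. exact: (@sqint_bounded _ `|c|). Qed.

Lemma sqint_sum (I : Type) (s : seq I) (h : I -> T -> R) :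
  (forall i, sqint (h i)) -> sqint (fun w => \sum_(i <- s) h i w).
Proof.
move=> hi; elim: s => [|i s ih].
  by under eq_fun do rewrite big_nil; exact: sqint_cst.
by under eq_fun do rewrite big_cons; exact: sqintD.
Qed.

Lemma sqint_Mbounded f g K : measurable_fun setT g -> (forall w, `|g w| <= K) ->
  sqint f -> sqint (fun w => g w * f w).
Proof.
move=> mg gK [mf fi]; split; first exact: measurable_funM.
apply: (le_intg (g := fun w => K ^+ 2 * f w ^+ 2)).
- by apply: measurable_funX; exact: measurable_funM.
- move=> w; rewrite exprMn normrM (ger0_norm (sqr_ge0 (f w))).
  rewrite ler_wpM2r ?sqr_ge0// normrX lerXn2r ?nnegrE//.
  by rewrite (le_trans _ (gK w)).
- exact: intgZ.
Qed.

Lemma sqint_intg f : sqint f -> intg f.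
Proof.
move=> fi; have := sqintM fi (sqint_cst 1).
by under eq_fun do rewrite mulr1.
Qed.

Lemma sqint_sqr f : sqint f -> intg (fun w => f w ^+ 2).
Proof. by case. Qed.

Lemma mean_sqrD f g : sqint f -> sqint g ->
  mean (fun w => (f w + g w) ^+ 2) <=
  2 * mean (fun w => f w ^+ 2) + 2 * mean (fun w => g w ^+ 2).
Proof.
move=> fi gi.
rewrite -!meanZ; [|exact: sqint_sqr..].
rewrite -meanD; [|by apply: intgZ; exact: sqint_sqr..].
apply: mean_le.
- by apply: sqint_sqr; exact: sqintD.
- by apply: intgD; apply: intgZ; exact: sqint_sqr.
- move=> w; have := sqr_ge0 (f w - g w); nra.
Qed.

(** Expands eta^-1 (eta |f| - |g|)^2 >= 0. The weight is free so that it can be small: it is the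
    accuracy in [ito_integral_ortho] and the time step in [one_step_error]. *)
Lemma mean_young (eta : R) f g : 0 < eta -> sqint f -> sqint g ->
  2 * `|mean (fun w => f w * g w)| <=
  eta * mean (fun w => f w ^+ 2) + eta^-1 * mean (fun w => g w ^+ 2).
Proof.
move=> eta0 fi gi.
apply: (@le_trans _ _ (2 * mean (fun w => `|f w * g w|))).
  by rewrite ler_wpM2l// mean_normr//; exact: sqintM.
have fgi : intg (fun w => `|f w * g w|) by apply: intg_normr; exact: sqintM.
rewrite -!meanZ; try by [exact: fgi|exact: sqint_sqr].
rewrite -meanD; [|by apply: intgZ; exact: sqint_sqr..].
apply: mean_le.
- exact: intgZ.
- by apply: intgD; apply: intgZ; exact: sqint_sqr.
- move=> w; rewrite normrM -(real_normK (num_real (f w))).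
  rewrite -(real_normK (num_real (g w))).
  set a := `|f w|; set b := `|g w|.
  have eta_neq0 : eta != 0 by rewrite gt_eqF.
  rewrite -subr_ge0.
  have -> : eta * a ^+ 2 + eta^-1 * b ^+ 2 - 2 * (a * b) =
            eta^-1 * (eta * a - b) ^+ 2 by field.
  by rewrite mulr_ge0 ?sqr_ge0// invr_ge0 ltW.
Qed.

End expectation_toolkit.

(** * Moments of a centred Gaussian variable *)

Section gaussian_moments.
Context {d} {T : measurableType d} {R : realType} (P : probability T R).
Local Notation mu := (@lebesgue_measure R).

(** The Radon-Nikodym derivative of [normal_prob] and [normal_pdf] have the same integral over every
    measurable set, so they agree almost everywhere. *)
Lemma ge0_integral_normal_prob (s : R) (h : R -> R) : s != 0 ->
  measurable_fun setT h -> (forall x, 0 <= h x) ->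
  (\int[normal_prob 0%R s]_x (h x)%:E =
   \int[mu]_x (h x * normal_pdf 0 s x)%:E)%E.
Proof.
move=> s0 mh h0.
have dom := normal_prob_dominates 0 s.
rewrite -(Radon_Nikodym_SigmaFinite.change_of_variables dom) => [|x| |]//=;
  [|by rewrite lee_fin|exact/measurable_EFinP].
apply: ae_eq_integral => //.
- apply: emeasurable_funM => //; first exact/measurable_EFinP.
  exact: (measurable_int mu (Radon_Nikodym_SigmaFinite.f_integrable dom)).
- apply/measurable_EFinP; apply: measurable_funM => //.
  exact: measurable_normal_pdf.
- under [X in ae_eq _ _ _ X]eq_fun do rewrite EFinM.
  apply: ae_eqe_mul2l => /=.
  apply: integral_ae_eq => //.
  + exact: Radon_Nikodym_SigmaFinite.f_integrable.
  + by apply/measurable_EFinP; exact: measurable_normal_pdf.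
  + by move=> E _ mE; rewrite -Radon_Nikodym_SigmaFinite.f_integral.
Qed.

Lemma normal_probN (s : R) (A : set R) : measurable A -> s != 0 ->
  normal_prob 0 s (-%R @^-1` A) = normal_prob 0 s A.
Proof.
move=> mA s0; rewrite /normal_prob.
transitivity (\int[pushforward mu (-%R : _ -> measurableTypeR R)]_(x in A)
   (normal_pdf 0 s x)%:E)%E; last first.
  apply: eq_measure_integral => //= B mB _; exact: lebesgue_measureN.
rewrite ge0_integral_pushforward//.
- apply: eq_integral => x _ /=; congr EFin.
  by rewrite !normal_pdfE// /normal_fun !subr0 sqrrN.
- by apply/measurable_EFinP; apply: measurable_funTS; exact: measurable_normal_pdf.
- by move=> x _; rewrite lee_fin normal_pdf_ge0.
Qed.

Variables (X : T -> R) (s : R).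
Hypothesis mX : measurable_fun setT X.
Hypothesis s_gt0 : 0 < s.
Hypothesis law : forall C, measurable C -> P (X @^-1` C) = normal_prob 0 s C.

Let mX' : measurable_fun setT (X : T -> measurableTypeR R).
Proof. exact: mX. Qed.

Let X' : {RV P >-> measurableTypeR R} :=
  @mfun_Sub _ _ T (measurableTypeR R) X (mem_set mX').

Let s_neq0 : s != 0. Proof. by rewrite gt_eqF. Qed.

Lemma gauss_ge0_integral (h : R -> R) :
  measurable_fun setT h -> (forall x, 0 <= h x) ->
  (\int[P]_w (h (X w))%:E = \int[mu]_x (h x * normal_pdf 0 s x)%:E)%E.
Proof.
move=> mh h0; rewrite -ge0_integral_normal_prob//.
transitivity (\int[distribution P X']_x (h x)%:E)%E.
  by rewrite ge0_integral_distribution//; exact/measurable_EFinP.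
by apply: eq_measure_integral => A mA _; exact: law.
Qed.

(** The Laplace transform of X^2, from which the moments below are extracted. Multiplying the
    density by exp (- h x^2) gives the constant u^-1/2 times the Gaussian density of standard
    deviation s u^-1/2. Negative h is allowed as long as u > 0. *)
Lemma gauss_expsq (h : R) : 0 < 1 + 2 * h * s ^+ 2 ->
  (\int[P]_w (expR (- h * X w ^+ 2))%:E =
   (Num.sqrt (1 + 2 * h * s ^+ 2)^-1)%:E)%E.
Proof.
move=> u0; set u := 1 + _ in u0 *.
rewrite (gauss_ge0_integral (h := fun x => expR (- h * x ^+ 2))); last 2 first.
- apply: measurableT_comp => //; apply: measurable_funM => //.
- by move=> x; exact: expR_ge0.
pose s' := s * Num.sqrt u^-1.
have u1 : 0 < u^-1 by rewrite invr_gt0.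
have s'0 : 0 < s' by rewrite mulr_gt0// sqrtr_gt0.
have s'E : s' ^+ 2 = s ^+ 2 / u.
  by rewrite /s' exprMn sqr_sqrtr// ltW.
under eq_integral => x _.
  have -> : expR (- h * x ^+ 2) * normal_pdf 0 s x =
     Num.sqrt u^-1 * normal_pdf 0 s' x.
    rewrite !normal_pdfE ?(gt_eqF s'0)// mulrCA mulrA.
    have -> : normal_peak s = Num.sqrt u^-1 * normal_peak s'.
      rewrite /normal_peak s'E.
      have -> : s ^+ 2 / u * pi *+ 2 = u^-1 * (s ^+ 2 * pi *+ 2) by ring.
      rewrite sqrtrM ?ltW//.
      rewrite invfM mulrA divff ?mul1r//.
      by rewrite gt_eqF// sqrtr_gt0.
    rewrite /normal_fun -!mulrA -expRD; congr (_ * (_ * expR _)).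
    rewrite s'E subr0 /u.
    field.
    by rewrite s_neq0 (gt_eqF u0).
  over.
under eq_integral do rewrite EFinM.
rewrite integralZl//; last exact: integrable_normal_pdf.
by rewrite integral_normal_pdf mule1.
Qed.

Let intg_expsq (h : R) : 0 < 1 + 2 * h * s ^+ 2 ->
  intg P (fun w => expR (- h * X w ^+ 2)).
Proof.
move=> u0; apply/integrableP; split.
  apply/measurable_EFinP; apply: measurableT_comp => //.
  by apply: measurable_funM => //; exact: measurable_funX.
under eq_integral do rewrite /= ger0_norm ?expR_ge0//.
by rewrite gauss_expsq// ltry.
Qed.

Let mean_expsq (h : R) : 0 < 1 + 2 * h * s ^+ 2 ->
  mean P (fun w => expR (- h * X w ^+ 2)) = Num.sqrt (1 + 2 * h * s ^+ 2)^-1.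
Proof. by move=> u0; rewrite /mean /Rintegral gauss_expsq. Qed.

(* The exponent for which E exp (- hq X^2) equals sqrt 2; it dominates all moments. *)
Let hq : R := - (4 * s ^+ 2)^-1.

Let hqE : 1 + 2 * hq * s ^+ 2 = 2^-1.
Proof. by rewrite /hq; field. Qed.

Let hq0 : 0 < 1 + 2 * hq * s ^+ 2.
Proof. by rewrite hqE. Qed.

Let sqrt2 : Num.sqrt (2^-1)^-1 <= 2 :> R.
Proof.
rewrite invrK -[leRHS]ger0_norm// -sqrtr_sqr ler_sqrt ?sqr_ge0//.
by rewrite expr2; lra.
Qed.

(** With y = X^2 / (4 s^2), the quotient y^(n+1) / (n+1)! is at most exp y, whose mean is sqrt 2 <=
    2. The constant is crude; what matters is the power of s. *)
Lemma gauss_moment (n : nat) : intg P (fun w => X w ^+ n.+1.*2) /\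
  mean P (fun w => X w ^+ n.+1.*2) <= 2 * n.+1`!%:R * (4 ^+ n.+1 * s ^+ n.+1.*2).
Proof.
have s2 : 0 < 4 * s ^+ 2 by rewrite mulr_gt0// exprn_gt0.
pose K := n.+1`!%:R * (4 ^+ n.+1 * s ^+ n.+1.*2).
have bnd w : X w ^+ n.+1.*2 <= K * expR (- hq * X w ^+ 2).
  rewrite /K /hq opprK; set y := _^-1 * _.
  have y0 : 0 <= y by rewrite mulr_ge0 ?sqr_ge0// invr_ge0 ltW.
  have := expR_ge1Dxn n y0.
  rewrite -lerBrDl => /(fun h => le_trans h (_ : expR y - 1 <= expR y)).
  move=> /(_ ltac:(lra)).
  rewrite ler_pdivrMr ?ltr0n ?fact_gt0// => yn.
  have -> : X w ^+ n.+1.*2 = (4 ^+ n.+1 * s ^+ n.+1.*2) * y ^+ n.+1.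
    rewrite -!mul2n !exprM -!exprMn /y; congr (_ ^+ _).
    by rewrite mulVKf// gt_eqF.
  set c := 4 ^+ n.+1 * _; have c0 : 0 <= c by rewrite mulr_ge0 ?exprn_ge0// ltW.
  by rewrite -/c (mulrC n.+1`!%:R) -[leRHS]mulrA ler_wpM2l// mulrC.
have int0 : intg P (fun w => X w ^+ n.+1.*2).
  apply: (le_intg _ _ (intgZ K (intg_expsq hq0))).
  - exact: measurable_funX.
  - by move=> w; rewrite ger0_norm ?exprn_even_ge0 ?odd_double.
split=> //.
apply: (le_trans (mean_le int0 (intgZ K (intg_expsq hq0)) bnd)).
rewrite meanZ; last exact: intg_expsq.
rewrite mean_expsq// hqE -[leRHS]mulrA -/K [leRHS]mulrC ler_wpM2l//.
by rewrite /K mulr_ge0// mulr_ge0// ?exprn_ge0// ltW.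
Qed.

Lemma gauss_sqint : sqint P X.
Proof. by split=> //; have [] := gauss_moment 0. Qed.

(** X and - X have the same law, so the mean equals its own opposite. *)
Lemma gauss_mean : mean P X = 0.
Proof.
have Xi : intg P X by exact/sqint_intg/gauss_sqint.
have mNX : measurable_fun setT (\- X : T -> measurableTypeR R).
  exact: measurable_funN.
pose NX : {RV P >-> measurableTypeR R} :=
  @mfun_Sub _ _ T (measurableTypeR R) (\- X) (mem_set mNX).
have NXi : intg P (\- X).
  by have := intgZ (-1) Xi; under eq_fun do rewrite mulN1r.
suff e : mean P X = mean P (\- X).
  have := meanZ (-1) Xi; under eq_fun do rewrite mulN1r.
  by rewrite mulN1r -[X in X = _ -> _]e; lra.
congr fine.
transitivity (\int[distribution P X']_y y%:E)%E.
  by rewrite integral_distribution.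
transitivity (\int[distribution P NX]_y y%:E)%E; last first.
  by rewrite integral_distribution.
apply: eq_measure_integral => A mA _.
change (P (X @^-1` A) = P (X @^-1` (-%R @^-1` A))).
rewrite !law ?normal_probN//.
by rewrite -[X in measurable X]setTI; exact: oppr_measurable.
Qed.

(** Here the exact constant is required: the isometry and the cancellation in
    [noise_quadratic_ortho] rest on it. It is minus the derivative at h = 0 of a (h) = (1 + 2 h
    s^2)^-1/2, the transform of [gauss_expsq], and is obtained by squeezing (1 - a) / h as h
    decreases to 0. *)
Lemma gauss_var : mean P (fun w => X w ^+ 2) = s ^+ 2.
Proof.
have [Xi2 _] := gauss_moment 0.
have [Xi4 _] := gauss_moment 1.
rewrite /= in Xi2 Xi4.
set q := LHS; pose r := mean P (fun w => X w ^+ 4).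
have r0 : 0 <= r by apply: mean_ge0 => w; rewrite exprn_even_ge0.
have key h : 0 < h -> s ^+ 2 * (1 - 2 * h * s ^+ 2) <= q <= s ^+ 2 + h * r.
  move=> h0.
  pose u := 1 + 2 * h * s ^+ 2.
  have hs : 0 < h * s ^+ 2 by rewrite mulr_gt0// exprn_gt0.
  have u0 : 0 < u by rewrite /u; lra.
  have u0V : 0 < u^-1 by rewrite invr_gt0.
  have ui := intg_expsq u0.
  have := mean_expsq u0; rewrite -/u.
  set a := Num.sqrt _ => exa.
  have a0 : 0 < a by rewrite sqrtr_gt0.
  have aE : a ^+ 2 * u = 1 by rewrite sqr_sqrtr ?ltW// mulVf// gt_eqF.
  have i1 : intg P (fun w => 1 - h * X w ^+ 2).
    by apply: intgB; [exact: (intg_cst _ 1)|exact: intgZ].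
  have lo : 1 - h * q <= a.
    have e1 : mean P (fun w => 1 - h * X w ^+ 2) = 1 - h * q.
      by rewrite meanB ?meanZ ?(mean_cst _ 1)//; [exact: (intg_cst _ 1)|exact: intgZ].
    rewrite -e1 -exa; apply: mean_le => // w.
    by rewrite (le_trans _ (expR_ge1Dx _))// mulNr.
  (* Uses exp (- y) <= 1 / (1 + y) <= 1 - y + y^2; the last inequality holds since (1 - y + y^2)(1 +
     y) = 1 + y^3. *)
  have hi : a <= 1 - h * q + h ^+ 2 * r.
    have e1 : mean P (fun w => 1 - h * X w ^+ 2 + h ^+ 2 * X w ^+ 4) =
        1 - h * q + h ^+ 2 * r.
      rewrite meanD ?meanB ?meanZ ?(mean_cst _ 1)//; try exact: intgZ.
      exact: (intg_cst _ 1).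
    rewrite -e1 -exa; apply: mean_le => //.
      by apply: intgD => //; exact: intgZ.
    move=> w; set y := h * X w ^+ 2.
    have y0 : 0 <= y by rewrite mulr_ge0 ?sqr_ge0// ltW.
    have -> : h ^+ 2 * X w ^+ 4 = y ^+ 2 by rewrite /y; ring.
    rewrite mulNr -/y expRN.
    have := expR_ge1Dx y => ey.
    apply: (@le_trans _ _ (1 + y)^-1).
      by rewrite lef_pV2 ?posrE ?expR_gt0//; lra.
    rewrite -[leLHS]div1r ler_pdivrMr; last by lra.
    have -> : (1 - h * X w ^+ 2 + y ^+ 2) * (1 + y) = 1 + y ^+ 3.
      by rewrite -/y; ring.
    by rewrite lerDl exprn_ge0.
  have a1 : a <= 1.
    rewrite -(@expr_le1 _ 2)// ?ltW//.
    have := aE; have : 0 <= a ^+ 2 by rewrite sqr_ge0.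
    by rewrite /u; nra.
  (* Since a^2 (1 + 2 h s^2) = 1, one has (1 - a)(1 + a) = 2 a^2 h s^2; with 0 < a <= 1 this
     encloses 1 - a between a^2 h s^2 and h s^2. *)
  apply/andP; split.
  - have h1 : 1 - a <= h * q by lra.
    have h2 : a ^+ 2 * (h * s ^+ 2) <= 1 - a.
      have : (1 - a) * (1 + a) = 2 * (a ^+ 2 * (h * s ^+ 2)).
        have := aE; rewrite /u; nra.
      have : (1 - a) * (1 + a) <= (1 - a) * 2 by rewrite ler_wpM2l; lra.
      lra.
    have h3 : (1 - 2 * h * s ^+ 2) <= a ^+ 2.
      have := aE; rewrite /u; have : 0 <= a ^+ 2 by rewrite sqr_ge0.
      nra.
    have h4 : (1 - 2 * h * s ^+ 2) * (h * s ^+ 2) <= h * q.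
      by rewrite (le_trans _ h1)// (le_trans _ h2)// ler_wpM2r// ltW.
    rewrite -(ler_pM2l h0); apply: le_trans h4; lra.
  - have h1 : h * q <= (1 - a) + h ^+ 2 * r by lra.
    have h2 : 1 - a <= h * s ^+ 2.
      have h5 : (1 - a) * (1 + a) = 2 * (a ^+ 2 * (h * s ^+ 2)).
        have := aE; rewrite /u; nra.
      have h6 : 2 * a ^+ 2 <= 1 + a by nra.
      rewrite -(@ler_pM2r _ (1 + a)); last by lra.
      by rewrite h5; nra.
    rewrite -(ler_pM2l h0); lra.
(* In each direction h is chosen so that the error term, h r or 2 h s^4, is at most e. *)
apply/eqP; rewrite eq_le; apply/andP; split; apply/ler_addgt0Pr => e e0.
- have /andP[_] := key (e / (1 + r)) ltac:(by rewrite divr_gt0//; lra).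
  move/le_trans; apply; rewrite lerD2l mulrAC ler_pdivrMr; last by lra.
  by rewrite ler_wpM2l; lra.
- have s4 : 0 < s ^+ 4 by rewrite exprn_gt0.
  have /andP[+ _] := key (e / (2 * s ^+ 4))
    ltac:(by rewrite divr_gt0// mulr_gt0).
  have -> : s ^+ 2 * (1 - 2 * (e / (2 * s ^+ 4)) * s ^+ 2) = s ^+ 2 - e.
    by field.
  lra.
Qed.

End gaussian_moments.

(** * Independence *)

Section independence.
Context {d} {T : measurableType d} {R : realType} (P : probability T R).

Definition indep_rv (U V : T -> R) : Prop :=
  forall A C : set R, measurable A -> measurable C ->
  P (U @^-1` A `&` V @^-1` C) = (P (U @^-1` A) * P (V @^-1` C))%E.

(** The joint law and the product of the laws agree on rectangles, hence everywhere by uniqueness of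
    the product measure; Fubini then factors the integral of the product. *)
Lemma indep_rvM (U V : T -> R) : intg P U -> intg P V -> indep_rv U V ->
  intg P (fun w => U w * V w) /\ mean P (fun w => U w * V w) = mean P U * mean P V.
Proof.
move=> Ui Vi UV.
have mU := intg_meas Ui; have mV := intg_meas Vi.
have mUV : measurable_fun setT (fun w => (U w, V w)).
  exact/measurable_fun_pair.
pose U' : {RV P >-> R} := mfun_Sub (mem_set mU).
pose V' : {RV P >-> R} := mfun_Sub (mem_set mV).
pose W' : {RV P >-> (R * R)%type} := mfun_Sub (mem_set mUV).
have law : forall A, measurable A ->
    (distribution P U' \x distribution P V')%E A = distribution P W' A.
  by move=> A mA; apply: product_measure_unique => // A1 A2 mA1 mA2; exact: UV.
have mM : measurable_fun setT (fun z : R * R => (z.1 * z.2)%:E).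
  by apply/measurable_EFinP; apply: measurable_funM; [exact: measurable_fst|exact: measurable_snd].
have mUVi : measurable_fun setT (fun w => U w * V w) by exact: measurable_funM.
have fU : (\int[distribution P U']_x x%:E = (mean P U)%:E)%E.
  by rewrite integral_distribution// -meanE// unlock.
have fV : (\int[distribution P V']_x x%:E = (mean P V)%:E)%E.
  by rewrite integral_distribution// -meanE// unlock.
have fV1 : (\int[distribution P V']_x `|x|%:E = (mean P (fun w => `|V w|))%:E)%E.
  rewrite ge0_integral_distribution//=; last exact/measurable_EFinP.
  by rewrite -meanE ?unlock//; exact: intg_normr.
have fU1 : (\int[distribution P U']_x `|x|%:E = (mean P (fun w => `|U w|))%:E)%E.
  rewrite ge0_integral_distribution//=; last exact/measurable_EFinP.
  by rewrite -meanE ?unlock//; exact: intg_normr.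
have prodi : (distribution P U' \x distribution P V')%E.-integrable setT
    (fun z : R * R => (z.1 * z.2)%:E).
  apply/integrable12ltyP => //=.
  under eq_integral => x _.
    under eq_integral => y _ do rewrite normrM EFinM.
    rewrite ge0_integralZl_EFin//; last exact/measurable_EFinP.
    rewrite fV1; over.
  rewrite ge0_integralZr//= ?fU1 -?EFinM ?ltry//.
  - exact/measurable_EFinP.
  - by rewrite lee_fin; exact: mean_ge0.
have UVi : intg P (fun w => U w * V w).
  have : (distribution P W').-integrable setT (fun z : R * R => (z.1 * z.2)%:E).
    move/integrableP : prodi => [_ prodi]; apply/integrableP; split => //.
    apply: le_lt_trans prodi; rewrite le_eqVlt; apply/orP; left; apply/eqP.
    by apply: eq_measure_integral => A mA _; first [exact: law|exact/esym/law].
  move=> /integrableP[_ Wi]; apply/integrableP; split.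
    exact/measurable_EFinP.
  move: Wi; rewrite ge0_integral_distribution//=.
  apply/measurable_EFinP; apply: measurableT_comp => //.
  exact/measurable_EFinP.
split=> //.
apply: EFin_inj; rewrite -meanE// unlock.
transitivity (\int[distribution P W']_z (z.1 * z.2)%:E)%E.
  by rewrite integral_distribution.
transitivity (\int[distribution P U' \x distribution P V']_z (z.1 * z.2)%:E)%E.
  by apply: eq_measure_integral => A mA _; first [exact: law|exact/esym/law].
rewrite -integral12_prod_meas1//= /fubini_F/=.
have Vi' : (distribution P V').-integrable setT (EFin : R -> \bar R).
  apply/integrableP; split=> //=; rewrite fV1 ltry.
  by [].
under eq_integral => x _.
  under eq_integral => y _ do rewrite EFinM.
  rewrite integralZl// fV; over.
have Ui' : (distribution P U').-integrable setT (EFin : R -> \bar R).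
  by apply/integrableP; split=> //=; rewrite fU1 ltry.
by rewrite integralZr//= fU EFinM.
Qed.

(** For fixed C both sides are finite measures in A: the restriction of P to the event V in C, and P
    scaled by the probability of that event. They agree on the pi-system G, hence on the
    sigma-algebra it generates. *)
Lemma indep_sigma_algebra (G : set (set T)) (V : T -> R) :
  G setT -> setI_closed G -> G `<=` measurable -> measurable_fun setT V ->
  (forall A C, G A -> measurable C ->
    P (A `&` V @^-1` C) = (P A * P (V @^-1` C))%E) ->
  forall A C, (<<s G >>) A -> measurable C ->
    P (A `&` V @^-1` C) = (P A * P (V @^-1` C))%E.
Proof.
move=> GT GI Gm mV GV A C GA mC.
have mVC : measurable (V @^-1` C) by rewrite -[X in measurable X]setTI; exact: mV.
have PVC : P (V @^-1` C) \is a fin_num by exact: fin_num_measure.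
have r0 : 0 <= fine (P (V @^-1` C)) by rewrite fine_ge0.
pose r := NngNum r0.
have : mrestr P mVC A = mscale r P A.
  apply: (g_sigma_algebra_measure_unique G Gm (fun=> setT)) => //.
  - by rewrite bigcup_const//; exists 0%N.
  - move=> A0 GA0; change (P (A0 `&` V @^-1` C) = (r%:num%:E * P A0)%E).
    by rewrite /= fineK// GV// muleC.
  - move=> _; change (P (setT `&` V @^-1` C) < +oo)%E.
    by rewrite setTI ltey_eq PVC.
by rewrite /mrestr /mscale/= fineK// => ->; rewrite muleC.
Qed.

End independence.

(** * Measurability with respect to a sub-sigma-algebra *)

Section measurable_wrt_theory.
Context {d} {T : measurableType d} {R : realType}.
Implicit Types (G : set (set T)) (Y Z : T -> R).

(** Turns G into the sigma-algebra of a measurable space, so that the closure properties of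
    measurable functions apply to [measurable_wrt]. *)
Lemma measurable_wrtP G Y : sigma_algebra setT G ->
  measurable_wrt G Y <->
  measurable_fun setT (Y : g_sigma_algebraType G -> R).
Proof.
move=> sG; have GE : <<s G >> = G by exact: sigma_algebra_id.
split=> [mY _ A mA|mY A mA].
  by rewrite setTI; change ((<<s G >>) (Y @^-1` A)); rewrite GE; exact: mY.
have := mY measurableT A mA; rewrite setTI.
by change ((<<s G >>) (Y @^-1` A) -> G (Y @^-1` A)); rewrite GE.
Qed.

Lemma measurable_wrtM G Y Z : sigma_algebra setT G ->
  measurable_wrt G Y -> measurable_wrt G Z ->
  measurable_wrt G (fun w => Y w * Z w).
Proof.
move=> sG /(measurable_wrtP _ sG) mY /(measurable_wrtP _ sG) mZ.
by apply/(measurable_wrtP _ sG); exact: measurable_funM.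
Qed.

Lemma measurable_wrtD G Y Z : sigma_algebra setT G ->
  measurable_wrt G Y -> measurable_wrt G Z ->
  measurable_wrt G (fun w => Y w + Z w).
Proof.
move=> sG /(measurable_wrtP _ sG) mY /(measurable_wrtP _ sG) mZ.
by apply/(measurable_wrtP _ sG); exact: measurable_funD.
Qed.

Lemma measurable_wrtB G Y Z : sigma_algebra setT G ->
  measurable_wrt G Y -> measurable_wrt G Z ->
  measurable_wrt G (fun w => Y w - Z w).
Proof.
move=> sG /(measurable_wrtP _ sG) mY /(measurable_wrtP _ sG) mZ.
by apply/(measurable_wrtP _ sG); exact: measurable_funB.
Qed.

Lemma measurable_wrt_cst G (c : R) : sigma_algebra setT G ->
  measurable_wrt G (cst c : T -> R).
Proof. by move=> sG; apply/(measurable_wrtP _ sG); exact: measurable_cst. Qed.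

Lemma measurable_wrt_fun G Y : G `<=` measurable -> measurable_wrt G Y ->
  measurable_fun setT Y.
Proof. by move=> Gm mY _ A mA; rewrite setTI; exact/Gm/mY. Qed.

Lemma measurable_wrt_sub G G' Y : G `<=` G' -> measurable_wrt G Y ->
  measurable_wrt G' Y.
Proof. by move=> GG' mY A mA; exact/GG'/mY. Qed.

End measurable_wrt_theory.

(** * Brownian increments and the Ito isometry *)

Section brownian_increments.
Context {d} {T : measurableType d} {R : realType} (P : probability T R).
Context {M : nat} {F : R -> set (set T)} {B : R -> T -> 'rV[R]_M}.
Hypothesis hF : filtration F.
Hypothesis hB : brownian_motion P F B.

Let sF t : 0 <= t -> sigma_algebra setT (F t).
Proof. by case: hF => + _ _; exact. Qed.

Let Fm t : 0 <= t -> F t `<=` measurable.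
Proof. by case: hF => _ + _; exact. Qed.

Let adB : adapted F B. Proof. by case: hB. Qed.

Lemma bm_measurable t m : 0 <= t -> measurable_fun setT (fun w => B t w 0 m).
Proof. by move=> t0; apply: (measurable_wrt_fun (Fm t0)); exact: adB. Qed.

Section increment.
Variables (u v : R).
Hypotheses (u0 : 0 <= u) (uv : u < v).

Let dB m w : R := (B v w - B u w) 0 m.

Let v0 : 0 <= v. Proof. by rewrite (le_trans u0)// ltW. Qed.

Let mdB m : measurable_fun setT (dB m).
Proof.
rewrite /dB; under eq_fun do rewrite !mxE.
by apply: measurable_funB; exact: bm_measurable.
Qed.

Let s : R := Num.sqrt (v - u).

Let s_gt0 : 0 < s. Proof. by rewrite sqrtr_gt0 subr_gt0. Qed.

Let s2 : s ^+ 2 = v - u. Proof. by rewrite sqr_sqrtr// subr_ge0 ltW. Qed.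

Let law2 A l m C C' : l != m -> F u A -> measurable C -> measurable C' ->
  P (A `&` dB l @^-1` C `&` dB m @^-1` C') =
  (P A * (normal_prob 0 s C * normal_prob 0 s C'))%E.
Proof.
move=> lm FA mC mC'; have [_ _ + _] := hB.
pose Cf k : set R := if k == l then C else if k == m then C' else setT.
move=> /(_ u v u0 uv A Cf FA).
have -> : [set w | forall k, Cf k ((B v w - B u w) 0 k)] =
    dB l @^-1` C `&` dB m @^-1` C'.
  apply/seteqP; split=> w /=.
    move=> h; split; first by have := h l; rewrite /Cf eqxx.
    by have := h m; rewrite /Cf eq_sym (negbTE lm) eqxx.
  move=> [h1 h2] k; rewrite /Cf; case: eqP => [->//|_].
  by case: eqP => [->|].
rewrite setIA => ->; last first.
  by move=> k; rewrite /Cf; case: ifP => // _; case: ifP.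
rewrite (bigD1 l)//= (bigD1 m)/=; last by rewrite eq_sym.
rewrite big1 ?mule1; last first.
  move=> k /andP[kl km]; rewrite /Cf (negbTE kl) (negbTE km).
  exact: probability_setT.
by rewrite /Cf eqxx eq_sym (negbTE lm) eqxx.
Qed.

Let law1 A m C : F u A -> measurable C ->
  P (A `&` dB m @^-1` C) = (P A * normal_prob 0 s C)%E.
Proof.
move=> FA mC; have [_ _ + _] := hB.
pose Cf k : set R := if k == m then C else setT.
move=> /(_ u v u0 uv A Cf FA).
have -> : [set w | forall k, Cf k ((B v w - B u w) 0 k)] = dB m @^-1` C.
  apply/seteqP; split=> w /=.
    by move=> h; have := h m; rewrite /Cf eqxx.
  by move=> h k; rewrite /Cf; case: eqP => [->|].
move=> ->; last by move=> k; rewrite /Cf; case: ifP.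
rewrite (bigD1 m)//= big1 ?mule1; last first.
  by move=> k kl; rewrite /Cf (negbTE kl); exact: probability_setT.
by rewrite /Cf eqxx.
Qed.

Let FT : F u setT.
Proof.
have [F0 FC _] := sF u0.
by have := FC _ F0; rewrite setD0.
Qed.

Lemma bm_law m C : measurable C -> P (dB m @^-1` C) = normal_prob 0 s C.
Proof.
move=> mC; have := law1 m FT mC; rewrite setTI => ->.
have -> : P setT = 1%E by exact: probability_setT.
by rewrite mul1e.
Qed.

Lemma bm_sqint m : sqint P (dB m).
Proof. exact: (gauss_sqint (mdB m) s_gt0 (@bm_law m)). Qed.

(** The constants here and in [bm_moment6] are those of [gauss_moment]: 64 = 2 * 2! * 4^2 and 768 =
    2 * 3! * 4^3. *)
Lemma bm_moment4 m : intg P (fun w => dB m w ^+ 4) /\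
  mean P (fun w => dB m w ^+ 4) <= 64 * (v - u) ^+ 2.
Proof.
have [i4 e4] := gauss_moment (mdB m) s_gt0 (@bm_law m) 1.
split=> //; apply: (le_trans e4); rewrite -s2 -[_.*2]/4%N.
have -> : 2`!%:R = 2 :> R by [].
by rewrite -exprM le_eqVlt; apply/orP; left; apply/eqP; ring.
Qed.

Lemma bm_moment6 m : intg P (fun w => dB m w ^+ 6) /\
  mean P (fun w => dB m w ^+ 6) <= 768 * (v - u) ^+ 3.
Proof.
have [i4 e4] := gauss_moment (mdB m) s_gt0 (@bm_law m) 2.
split=> //; apply: (le_trans e4); rewrite -s2 -[_.*2]/6%N.
have -> : 3`!%:R = 6 :> R by [].
by rewrite -exprM le_eqVlt; apply/orP; left; apply/eqP; ring.
Qed.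

Let indep1 m (Z : T -> R) : measurable_wrt (F u) Z -> indep_rv P Z (dB m).
Proof.
move=> mZ A C mA mC; rewrite law1//; last exact: mZ.
by rewrite bm_law.
Qed.

Lemma bm_ortho m (Z : T -> R) : measurable_wrt (F u) Z -> intg P Z ->
  intg P (fun w => Z w * dB m w) /\ mean P (fun w => Z w * dB m w) = 0.
Proof.
move=> mZ Zi.
have [i e] := indep_rvM Zi (sqint_intg (bm_sqint m)) (indep1 m mZ).
split=> //; rewrite e (gauss_mean (mdB m) s_gt0 (@bm_law m)).
by rewrite mulr0.
Qed.

Lemma bm_sqr m (Z : T -> R) : measurable_wrt (F u) Z -> intg P Z ->
  intg P (fun w => Z w * dB m w ^+ 2) /\
  mean P (fun w => Z w * dB m w ^+ 2) = mean P Z * (v - u).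
Proof.
move=> mZ Zi.
have ind : indep_rv P Z (fun w => dB m w ^+ 2).
  move=> A C mA mC.
  have mC2 : measurable ((fun x : R => x ^+ 2) @^-1` C).
    by rewrite -[X in measurable X]setTI; exact: exprn_measurable.
  exact: (indep1 m mZ mA mC2).
have [i e] := indep_rvM Zi (sqint_sqr (bm_sqint m)) ind.
by split=> //; rewrite e (gauss_var (mdB m) s_gt0 (@bm_law m)) s2.
Qed.

(** Z dB_l is not F_u-measurable, so [bm_ortho] does not apply directly. The events A [&] {dB_l in
    C} with A in F u form a pi-system on which independence from dB_m holds, and Z dB_l is
    measurable for the sigma-algebra that it generates. *)
Lemma bm_cross l m (Z : T -> R) : l != m -> measurable_wrt (F u) Z -> intg P Z ->
  intg P (fun w => Z w * dB l w * dB m w) /\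
  mean P (fun w => Z w * dB l w * dB m w) = 0.
Proof.
move=> lm mZ Zi; have [ZBi _] := bm_ortho l mZ Zi.
pose G := [set E | exists A C, [/\ F u A, measurable C & E = A `&` dB l @^-1` C]].
have mBl C : measurable C -> measurable (dB l @^-1` C).
  by move=> mC; rewrite -[X in measurable X]setTI; exact: mdB.
have GT : G setT by exists setT, setT; split=> //; rewrite setTI.
have GI : setI_closed G.
  move=> _ _ [A1 [C1 [FA1 mC1 ->]]] [A2 [C2 [FA2 mC2 ->]]].
  exists (A1 `&` A2), (C1 `&` C2); split.
  - have := @measurableI _ (g_sigma_algebraType (F u)) A1 A2.
    by rewrite /measurable /= (sigma_algebra_id (sF u0)); exact.
  - exact: measurableI.
  - by rewrite preimage_setI setIACA.
have Gm : G `<=` measurable.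
  move=> _ [A [C [FA mC ->]]]; apply: measurableI; last exact: mBl.
  exact: (Fm u0).
have ind : indep_rv P (fun w => Z w * dB l w) (dB m).
  move=> A C mA mC.
  apply: (indep_sigma_algebra GT GI Gm (mdB m)) => //.
    move=> _ C' [A1 [C1 [FA1 mC1 ->]]] mC'.
    by rewrite law2// law1// bm_law// muleA.
  have mZG : measurable_fun setT (Z : g_sigma_algebraType G -> R).
    move=> _ A1 mA1; rewrite setTI; apply: sub_sigma_algebra.
    by exists (Z @^-1` A1), setT; split=> //; [exact: mZ|rewrite preimage_setT setIT].
  have mBG : measurable_fun setT (dB l : g_sigma_algebraType G -> R).
    move=> _ A1 mA1; rewrite setTI; apply: sub_sigma_algebra.
    by exists setT, A1; split=> //; rewrite setTI.
  by have := (measurable_funM mZG mBG) measurableT A mA; rewrite setTI.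
have [i e] := indep_rvM ZBi (sqint_intg (bm_sqint m)) ind.
split=> //; rewrite e (gauss_mean (mdB m) s_gt0 (@bm_law m)).
by rewrite mulr0.
Qed.

End increment.

End brownian_increments.

(** * The Ito isometry for finite sums of increments *)

Section isometry.
Context {d} {T : measurableType d} {R : realType} (P : probability T R).
Context {M : nat} {F : R -> set (set T)} {B : R -> T -> 'rV[R]_M}.
Hypothesis hF : filtration F.
Hypothesis hB : brownian_motion P F B.
Variable m : 'I_M.

Let b t w : R := B t w 0 m.

Let sF t : 0 <= t -> sigma_algebra setT (F t).
Proof. by case: hF => + _ _; exact. Qed.

Let Fm t : 0 <= t -> F t `<=` measurable.
Proof. by case: hF => _ + _; exact. Qed.

Let Fle s t : 0 <= s -> s <= t -> F s `<=` F t.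
Proof. by case: hF => _ _; exact. Qed.

Let adb t : 0 <= t -> measurable_wrt (F t) (b t).
Proof. by move=> t0; case: hB => _ + _ _; exact. Qed.

Let adb_le s t : 0 <= s -> s <= t -> measurable_wrt (F t) (b s).
Proof. by move=> s0 st; apply: measurable_wrt_sub (adb s0); exact: Fle. Qed.

Let db u v w : R := b v w - b u w.

Let dbE u v : db u v = fun w => (B v w - B u w) 0 m.
Proof. by apply/funext => w; rewrite /db /b !mxE. Qed.

Let dbxx u : db u u = cst 0.
Proof. by apply/funext => w; rewrite /db subrr. Qed.

Definition bounded_wrt G (Z : T -> R) : Prop :=
  measurable_wrt G Z /\ exists K : R, forall w, `|Z w| <= K.

Lemma bounded_wrtM G Y Z : sigma_algebra setT G ->
  bounded_wrt G Y -> bounded_wrt G Z -> bounded_wrt G (fun w => Y w * Z w).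
Proof.
move=> sG [mY [K YK]] [mZ [L ZL]]; split; first exact: measurable_wrtM.
by exists (K * L) => w; rewrite normrM ler_pM.
Qed.

Lemma bounded_wrt_sub G G' Z : G `<=` G' -> bounded_wrt G Z ->
  bounded_wrt G' Z.
Proof. by move=> GG' [mZ ?]; split=> //; exact: measurable_wrt_sub mZ. Qed.

Lemma bounded_wrt_sqint G Z : G `<=` measurable -> bounded_wrt G Z ->
  sqint P Z.
Proof.
move=> Gm [mZ [K ZK]]; apply: (sqint_bounded P _ ZK).
exact: measurable_wrt_fun mZ.
Qed.

Lemma db_sqint u v : 0 <= u -> u <= v -> sqint P (fun w => B v w 0 m - B u w 0 m).
Proof.
move=> u0; rewrite le_eqVlt => /predU1P[<-|uv].
  by under eq_fun do rewrite subrr; exact: sqint_cst.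
by have := bm_sqint hF hB u0 uv m; under eq_fun do rewrite !mxE.
Qed.

Let Zdb_sqint G Z u v : G `<=` measurable -> bounded_wrt G Z ->
  0 <= u -> u <= v -> sqint P (fun w => Z w * db u v w).
Proof.
move=> Gm [mZ [K ZK]] u0 uv; apply: (sqint_Mbounded _ ZK).
  exact: measurable_wrt_fun mZ.
exact: db_sqint.
Qed.

Let ortho u v Z : 0 <= u -> u <= v -> measurable_wrt (F u) Z -> intg P Z ->
  mean P (fun w => Z w * db u v w) = 0.
Proof.
move=> u0; rewrite le_eqVlt => /predU1P[<-|uv] mZ Zi.
  by rewrite dbxx; under eq_fun do rewrite mulr0; exact: mean_cst.
by rewrite dbE; have [] := bm_ortho hF hB u0 uv m mZ Zi.
Qed.

Let sqr u v Z : 0 <= u -> u <= v -> measurable_wrt (F u) Z -> intg P Z ->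
  mean P (fun w => Z w * db u v w ^+ 2) = mean P Z * (v - u).
Proof.
move=> u0; rewrite le_eqVlt => /predU1P[<-|uv] mZ Zi.
  rewrite dbxx subrr mulr0.
  by under eq_fun do rewrite expr0n/= mulr0; exact: mean_cst.
by rewrite dbE; have [] := bm_sqr hF hB u0 uv m mZ Zi.
Qed.

(** Split the longer increment at v: the part after v is orthogonal to everything F_v-measurable,
    and only the square of the common part remains. *)
Let cross0 u v v' Z : 0 <= u -> u <= v -> v <= v' -> bounded_wrt (F u) Z ->
  mean P (fun w => Z w * db u v w * db u v' w) = mean P Z * (v - u).
Proof.
move=> u0 uv vv' bZ; have [mZ [K ZK]] := bZ.
have uv' : u <= v' by exact: le_trans vv'.
have v0 : 0 <= v by exact: le_trans uv.
have Zi : intg P Z by apply/sqint_intg/(bounded_wrt_sqint (Fm u0)).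
have Zd := Zdb_sqint (Fm u0) bZ u0 uv.
have -> : (fun w => Z w * db u v w * db u v' w) =
    (fun w => Z w * db u v w ^+ 2 + Z w * db u v w * db v v' w).
  by apply/funext => w; rewrite /db; ring.
rewrite meanD.
- rewrite sqr// ortho ?addr0//; last exact: sqint_intg.
  apply: measurable_wrtM; first exact: sF.
    by apply: measurable_wrt_sub mZ; exact: Fle.
  by apply: measurable_wrtB; [exact: sF|exact: adb|exact: adb_le].
- under eq_fun do rewrite expr2 mulrA.
  by apply: sqintM => //; exact: db_sqint.
- by apply: sqintM => //; exact: db_sqint.
Qed.

(* Length of the intersection of the intervals ]a, b] and ]a', b']. *)
Definition overlap (a b a' b' : R) : R :=
  Num.max 0 (Num.min b b' - Num.max a a').

Lemma overlapC a c a' c' : overlap a c a' c' = overlap a' c' a c.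
Proof. by rewrite /overlap minC maxC [Num.max a a']maxC maxC. Qed.

(** Cut the first increment at a'. The part before a' is F_a'-measurable, hence orthogonal to the
    second increment; the part after a' starts where the second one starts, which is the case of
    [cross0]. *)
Let cross_le a c a' c' X Y : 0 <= a -> a <= c -> 0 <= a' -> a' <= c' ->
  a <= a' -> bounded_wrt (F a) X -> bounded_wrt (F a') Y ->
  mean P (fun w => (X w * db a c w) * (Y w * db a' c' w)) =
  mean P (fun w => X w * Y w) * overlap a c a' c'.
Proof.
move=> a0 ac a'0 a'c' aa' bX bY.
have bX' : bounded_wrt (F a') X by apply: bounded_wrt_sub bX; exact: Fle.
have bXY : bounded_wrt (F a') (fun w => X w * Y w).
  by apply: bounded_wrtM => //; exact: sF.
have [mXY [K XYK]] := bXY.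
have XYi : intg P (fun w => X w * Y w).
  by apply/sqint_intg/(bounded_wrt_sqint (Fm a'0)).
rewrite /overlap (max_idPr aa').
have [ca'|a'c] := leP c a'.
  have -> : Num.max 0 (Num.min c c' - a') = 0.
    by apply/max_idPl; rewrite subr_le0 ge_min ca'.
  rewrite mulr0; have -> : (fun w => (X w * db a c w) * (Y w * db a' c' w)) =
      (fun w => (X w * Y w * db a c w) * db a' c' w).
    by apply/funext => w; ring.
  apply: ortho => //.
    apply: measurable_wrtM => //; first exact: sF.
    apply: measurable_wrtB; first exact: sF.
      by apply: adb_le => //; exact: le_trans ac.
    exact: adb_le.
  exact/sqint_intg/(Zdb_sqint (Fm a'0)).
have -> : (fun w => (X w * db a c w) * (Y w * db a' c' w)) =
    (fun w => (X w * Y w * db a a' w) * db a' c' w +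
              X w * Y w * db a' c w * db a' c' w).
  by apply/funext => w; rewrite /db; ring.
have a'c_ := ltW a'c.
rewrite meanD; first last.
- apply: sqintM; last exact: db_sqint.
  exact: (Zdb_sqint (Fm a'0)).
- apply: sqintM; last exact: db_sqint.
  exact: (Zdb_sqint (Fm a'0)).
rewrite ortho//; first last.
- exact/sqint_intg/(Zdb_sqint (Fm a'0)).
- apply: measurable_wrtM => //; first exact: sF.
  by apply: measurable_wrtB; [exact: sF|exact: adb|exact: adb_le].
rewrite add0r; have [cc'|/ltW c'c] := leP c c'.
- rewrite cross0//; congr (_ * _); apply/esym/max_idPr.
  by rewrite subr_ge0.
- under eq_fun do rewrite mulrAC.
  rewrite cross0//; congr (_ * _); apply/esym/max_idPr.
  by rewrite subr_ge0.
Qed.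

Let cross a c a' c' X Y : 0 <= a -> a <= c -> 0 <= a' -> a' <= c' ->
  bounded_wrt (F a) X -> bounded_wrt (F a') Y ->
  mean P (fun w => (X w * db a c w) * (Y w * db a' c' w)) =
  mean P (fun w => X w * Y w) * overlap a c a' c'.
Proof.
move=> a0 ac a'0 a'c' bX bY; have [aa'|/ltW a'a] := leP a a'.
  exact: cross_le.
under eq_fun do rewrite mulrC.
rewrite cross_le// overlapC; congr (mean P _ * _).
by apply/funext => w; rewrite mulrC.
Qed.

Section simple_process.
Variables (I : finType) (lo hi : I -> R) (c : I -> T -> R).

(** Unlike in [elementary_process], the intervals may overlap and are indexed by any finite type.
    Differences of simple processes are then disjoint unions of the families, and no common
    refinement of time grids is ever built. *)
Definition simple_process : Prop := forall i,
  [/\ 0 <= lo i, lo i <= hi i & bounded_wrt (F (lo i)) (c i)].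

Definition simple_integral w : R :=
  \sum_i c i w * (B (hi i) w 0 m - B (lo i) w 0 m).

Definition simple_val s w : R := \sum_i c i w * \1_(`]lo i, hi i]) s.

Hypothesis ok : simple_process.

Let cdb_sqint i : sqint P (fun w => c i w * db (lo i) (hi i) w).
Proof. by have [l0 lh bc] := ok i; exact: (Zdb_sqint (Fm l0)). Qed.

Let c_sqint i : sqint P (c i).
Proof. by have [l0 lh bc] := ok i; exact: (bounded_wrt_sqint (Fm l0)). Qed.

Lemma simple_integral_sqint : sqint P simple_integral.
Proof. by rewrite /simple_integral; exact: sqint_sum. Qed.

Lemma simple_integral_ortho u Z : 0 <= u -> (forall i, u <= lo i) ->
  bounded_wrt (F u) Z -> mean P (fun w => Z w * simple_integral w) = 0.
Proof.
move=> u0 ulo bZ.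
have bZ' i : bounded_wrt (F (lo i)) (fun w => Z w * c i w).
  have [l0 lh bc] := ok i; apply: bounded_wrtM => //; first exact: sF.
  by apply: bounded_wrt_sub bZ; exact: Fle.
have -> : (fun w => Z w * simple_integral w) =
    (fun w => \sum_i Z w * c i w * db (lo i) (hi i) w).
  by apply/funext => w; rewrite mulr_sumr; apply: eq_bigr => i _; rewrite mulrA.
rewrite mean_sum; last first.
  move=> i; have [l0 lh bc] := ok i.
  exact/sqint_intg/(Zdb_sqint (Fm l0)).
rewrite big1// => i _; have [l0 lh bc] := ok i.
apply: ortho => //; first by have [] := bZ' i.
exact/sqint_intg/(bounded_wrt_sqint (Fm l0)).
Qed.

Let sqr_sum (g : I -> R) : (\sum_i g i) ^+ 2 = \sum_(p : I * I) g p.1 * g p.2.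
Proof.
rewrite expr2 mulr_suml; under eq_bigr do rewrite mulr_sumr.
by rewrite pair_bigA.
Qed.

Lemma simple_integral_sqr : mean P (fun w => simple_integral w ^+ 2) =
  \sum_(p : I * I) mean P (fun w => c p.1 w * c p.2 w) *
     overlap (lo p.1) (hi p.1) (lo p.2) (hi p.2).
Proof.
rewrite /simple_integral; under eq_fun do rewrite sqr_sum.
rewrite mean_sum; last by move=> p; exact: sqintM.
apply: eq_bigr => p _; have [l0 lh bc] := ok p.1; have [l0' lh' bc'] := ok p.2.
exact: cross.
Qed.

Lemma simple_val_sqr s : ('E_P[fun w => (simple_val s w ^+ 2)%R] =
  \sum_(p : I * I) (mean P (fun w => c p.1 w * c p.2 w) *
     (\1_(`]lo p.1, hi p.1]) s * \1_(`]lo p.2, hi p.2]) s))%R%:E)%E.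
Proof.
rewrite sumEFin meanE; last first.
  apply/sqint_sqr/sqint_sum => i.
  by under eq_fun do rewrite mulrC; exact: sqintZ.
congr EFin; rewrite /simple_val; under eq_fun do rewrite sqr_sum.
rewrite mean_sum; last first.
  by move=> p; apply: sqintM; under eq_fun do rewrite mulrC; exact: sqintZ.
apply: eq_bigr => p _; rewrite mulrC -meanZ; last exact: sqintM.
by congr mean; apply/funext => w; ring.
Qed.

Let indicM (a e a' e' s : R) : \1_(`]a, e]) s * \1_(`]a', e']) s =
  \1_(`]Num.max a a', Num.min e e']) s :> R.
Proof.
rewrite !indicE -natrM mulnb; congr (_ %:R); congr nat_of_bool.
by rewrite !mem_setE !in_itv/= le_min gt_max andbACA.
Qed.

(** Both sides expand into the same sum over pairs of intervals: the product of two indicators is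
    the indicator of the intersection, whose length is the [overlap] produced by the increments. *)
Lemma simple_isometry (D : set R) : measurable D ->
  (forall i, `]lo i, hi i] `<=` D) ->
  (\int[lebesgue_measure]_(s in D) 'E_P[fun w => (simple_val s w ^+ 2)%R] =
   (mean P (fun w => simple_integral w ^+ 2))%:E)%E.
Proof.
move=> mD sub; rewrite simple_integral_sqr.
under eq_integral do rewrite simple_val_sqr.
have intI p : (lebesgue_measure : set (measurableTypeR R) -> \bar R).-integrable D
    (EFin \o \1_(`]Num.max (lo p.1) (lo p.2), Num.min (hi p.1) (hi p.2)] : set R)).
  apply: (integrableS measurableT) => //.
  exact: integrable_indic_itv.
under eq_integral => s _.
  under eq_bigr => p _ do rewrite indicM EFinM.
  over.
rewrite integral_sum//; last by move=> p; apply: integrableZl => //; exact: intI.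
rewrite -sumEFin; apply: eq_bigr => p _; rewrite integralZl//; last exact: intI.
rewrite EFinM.
congr (_ * _)%E; rewrite integral_indic//.
rewrite setIidl; last first.
  move=> s /=; rewrite in_itv/= gt_max le_min => /andP[/andP[h1 _] /andP[h2 _]].
  by apply: (sub p.1) => /=; rewrite in_itv/= h1.
rewrite /= lebesgue_measure_itv/= lte_fin /overlap.
by case: ltP => [/ltW|]; [rewrite -subr_ge0 => /max_idPr ->|
  rewrite -subr_le0 => /max_idPl ->].
Qed.

End simple_process.

End isometry.

(** * Increments of Ito integrals *)

Section ito_increments.
Context {d} {T : measurableType d} {R : realType} (P : probability T R).
Context {M : nat} {F : R -> set (set T)} {B : R -> T -> 'rV[R]_M}.
Hypothesis hF : filtration F.
Hypothesis hB : brownian_motion P F B.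
Variable m : 'I_M.

Local Notation mu := (@lebesgue_measure R).

Let b t w : R := B t w 0 m.

Let sF t : 0 <= t -> sigma_algebra setT (F t).
Proof. by case: hF => + _ _; exact. Qed.

Let Fm t : 0 <= t -> F t `<=` measurable.
Proof. by case: hF => _ + _; exact. Qed.

Let Fle s t : 0 <= s -> s <= t -> F s `<=` F t.
Proof. by case: hF => _ _; exact. Qed.

Lemma el_time_ge (E : elementary_process F) i : 0 <= el_time E i.
Proof. by apply: (le_trans (el_time_ge0 E)); exact: el_time_homo. Qed.

Lemma el_coef_wrt (E : elementary_process F) i :
  bounded_wrt (F (el_time E i)) (el_coef E i).
Proof. by split; [exact: el_coef_meas|exact: el_coef_bounded]. Qed.

(** Restricting an elementary process to ]u, v] yields a simple process whose intervals lie in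
    [u, v]; isometry and orthogonality thereby become statements about increments. *)
Lemma elementary_clip (E : elementary_process F) u v : 0 <= u -> u <= v ->
  exists (lo hi : 'I_(el_size E) -> R) (c : 'I_(el_size E) -> T -> R),
  [/\ simple_process (F := F) lo hi c,
      forall i, u <= lo i /\ hi i <= v,
      forall w, el_integral E b v w - el_integral E b u w =
        simple_integral (B := B) m lo hi c w &
      forall s w, u < s -> s <= v -> el_val E s w = simple_val lo hi c s w].
Proof.
move=> u0 uv; pose cl t := Num.min (Num.max t u) v.
have clu t : u <= cl t by rewrite le_min uv le_max lexx orbT.
have clv t : cl t <= v by rewrite ge_min lexx orbT.
(* A coefficient that starts after v need not be F_v-measurable, whereas its clipped interval starts
   at v. That interval is empty, so the coefficient may be replaced by 0. *)
exists (fun i => cl (el_time E i)), (fun i => cl (el_time E i.+1)),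
  (fun i => if el_time E i <= v then el_coef E i else cst 0); split=> [i||w|s w us sv].
- have le12 : el_time E i <= el_time E i.+1 by exact: el_time_homo.
  split; first by exact: le_trans u0 _.
    rewrite /cl le_min ge_min ge_max !le_max le12 !lexx !orbT /=.
    by rewrite ge_min lexx orbT.
  case: ifPn => tv; last first.
    split; last by exists 0 => w; rewrite normr0.
    by apply: measurable_wrt_cst; apply: sF; exact: le_trans u0 _.
  apply: bounded_wrt_sub (el_coef_wrt E i); apply: Fle.
    exact: el_time_ge.
  by rewrite le_min tv le_max lexx.
- by split.
- rewrite /el_integral /simple_integral -sumrB; apply: eq_bigr => i _.
  have le12 : el_time E i <= el_time E i.+1 by exact: el_time_homo.
  have key t : b (Num.min t v) w - b (Num.min t u) w = b (cl t) w - b u w.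
    rewrite /cl; have [tu|ut] := leP t u.
      by rewrite !(min_idPl _) ?(le_trans tu)// !subrr.
    by [].
  rewrite -/(b _ _) -/(b _ _); case: ifPn => tv.
    rewrite -mulrBr; congr (_ * _); have := key (el_time E i.+1).
    by have := key (el_time E i); lra.
  move: tv; rewrite -ltNge => /ltW tv.
  rewrite !(min_idPr _) ?subrr ?mul0r ?mulr0 ?subr0//; try lra.
- rewrite /el_val /simple_val; apply: eq_bigr => i _.
  have inE' a e : (s \in `]a, e]%classic) = (a < s) && (s <= e).
    by rewrite mem_setE in_itv.
  have scl t : (s <= cl t) = (s <= t).
    by rewrite /cl le_min le_max sv andbT (leNgt s u) us orbF.
  case: ifPn => tv.
    rewrite !indicE !inE' scl; congr (_ * (_ && _)%:R).
    by rewrite /cl gt_min gt_max us andbT ltNge [v < s]ltNge sv orbF.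
  rewrite /= mul0r indicE inE'; move: tv; rewrite -ltNge => tv.
  by rewrite [_ < s]ltNge (le_trans sv (ltW tv))/= mulr0.
Qed.

(** Juxtaposes the two families, with the coefficients of the second one negated. The clause on L
    and U keeps track of the interval containing all of them. *)
Lemma simple_process_sub (I J : finType) (lo hi : I -> R) (lo' hi' : J -> R)
    (c : I -> T -> R) (c' : J -> T -> R) :
  simple_process (F := F) lo hi c -> simple_process (F := F) lo' hi' c' ->
  exists (l h : (I + J)%type -> R) (e : (I + J)%type -> T -> R),
  [/\ simple_process (F := F) l h e,
      forall L U, (forall i, L <= lo i /\ hi i <= U) ->
        (forall i, L <= lo' i /\ hi' i <= U) ->
        forall i, L <= l i /\ h i <= U,
      forall w, simple_integral (B := B) m l h e w =
        simple_integral (B := B) m lo hi c w -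
        simple_integral (B := B) m lo' hi' c' w &
      forall s w, simple_val l h e s w =
        simple_val lo hi c s w - simple_val lo' hi' c' s w].
Proof.
move=> ok ok'.
exists (fun x => match x with inl i => lo i | inr j => lo' j end),
  (fun x => match x with inl i => hi i | inr j => hi' j end),
  (fun x => match x with inl i => c i | inr j => fun w => -1 * c' j w end).
split=> [[i|j]|L U h1 h2 [i|j]|w|s w].
- exact: ok.
- have [l0 lh bc] := ok' j; split=> //; apply: bounded_wrtM => //.
    exact: sF.
  split; first by apply: measurable_wrt_cst; exact: sF.
  by exists 1 => w; rewrite normrN normr1.
- exact: h1.
- exact: h2.
- rewrite /simple_integral big_sumType/= -[X in _ = _ - X]mul1r -mulNr mulr_sumr.
  by congr (_ + _); apply: eq_bigr => j _; rewrite mulrA.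
- rewrite /simple_val big_sumType/= -[X in _ = _ - X]mul1r -mulNr mulr_sumr.
  by congr (_ + _); apply: eq_bigr => j _; rewrite mulrA.
Qed.

Lemma el_integral_sqint (E : elementary_process F) v : 0 <= v ->
  sqint P (el_integral E b v).
Proof.
move=> v0; have [lo [hi [c [ok _ h _]]]] := elementary_clip E (lexx 0) v0.
have -> : el_integral E b v = simple_integral (B := B) m lo hi c.
  apply/funext => w; rewrite -h; rewrite [X in _ = _ - X](_ : _ = 0) ?subr0//.
  rewrite /el_integral big1// => i _.
  by rewrite !(min_idPr _) ?subrr ?mulr0//; exact: el_time_ge.
exact: (simple_integral_sqint hF hB m ok).
Qed.

Lemma el_val_sqint (E : elementary_process F) s : sqint P (el_val E s).
Proof.
apply: sqint_sum => i; under eq_fun do rewrite mulrC.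
apply: sqintZ; apply: (bounded_wrt_sqint _ (Fm (el_time_ge E i))).
exact: el_coef_wrt.
Qed.

Lemma el_isometry (E E' : elementary_process F) u v : 0 <= u -> u <= v ->
  (\int[mu]_(s in `]u, v]) 'E_P[fun w => ((el_val E s w - el_val E' s w) ^+ 2)%R] =
  (mean P (fun w => ((el_integral E b v w - el_integral E b u w) -
     (el_integral E' b v w - el_integral E' b u w)) ^+ 2))%:E)%E.
Proof.
move=> u0 uv.
have [lo [hi [c [ok bd hi1 hv1]]]] := elementary_clip E u0 uv.
have [lo' [hi' [c' [ok' bd' hi2 hv2]]]] := elementary_clip E' u0 uv.
have [l [h [e [okl bdl hil hvl]]]] := simple_process_sub ok ok'.
under [X in mean P X]eq_fun do rewrite hi1 hi2 -hil.
rewrite -(simple_isometry hF hB m okl (D := `]u, v]))//; last first.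
  move=> i s /=; rewrite !in_itv/= => /andP[ls sh].
  have [ul hv] := bdl u v bd bd' i.
  by rewrite (le_lt_trans ul ls) (le_trans sh hv).
apply: eq_integral => s; rewrite inE/= in_itv/= => /andP[us sv].
by congr expectation; apply/funext => w; rewrite hvl -hv1// -hv2.
Qed.

Lemma el_isometry_cst (E : elementary_process F) u v G : 0 <= u -> u <= v ->
  bounded_wrt (F u) G ->
  (\int[mu]_(s in `]u, v]) 'E_P[fun w => ((el_val E s w - G w) ^+ 2)%R] =
  (mean P (fun w => ((el_integral E b v w - el_integral E b u w) -
     G w * (b v w - b u w)) ^+ 2))%:E)%E.
Proof.
move=> u0 uv bG.
have [lo [hi [c [ok bd hi1 hv1]]]] := elementary_clip E u0 uv.
have ok' : simple_process (F := F) (fun _ : 'I_1 => u) (fun=> v) (fun=> G).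
  by move=> i; split.
have [l [h [e [okl bdl hil hvl]]]] := simple_process_sub ok ok'.
have -> : (fun w => ((el_integral E b v w - el_integral E b u w) -
     G w * (b v w - b u w)) ^+ 2) =
     (fun w => simple_integral (B := B) m l h e w ^+ 2).
  apply/funext => w; rewrite hil hi1; congr ((_ - _) ^+ 2).
  by rewrite /simple_integral big_ord1.
rewrite -(simple_isometry hF hB m okl (D := `]u, v]))//; last first.
  move=> i s /=; rewrite !in_itv/= => /andP[ls sh].
  have [ul hv] := bdl u v bd (fun=> conj (lexx u) (lexx v)) i.
  by rewrite (le_lt_trans ul ls) (le_trans sh hv).
apply: eq_integral => s; rewrite inE/= in_itv/= => /andP[us sv].
congr expectation; apply/funext => w; rewrite hvl -hv1//.
by rewrite /simple_val big_ord1 indicE mem_setE in_itv/= us sv mulr1.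
Qed.

Lemma el_ortho (E : elementary_process F) u v Z : 0 <= u -> u <= v ->
  bounded_wrt (F u) Z ->
  mean P (fun w => Z w * (el_integral E b v w - el_integral E b u w)) = 0.
Proof.
move=> u0 uv bZ.
have [lo [hi [c [ok bd hi1 hv1]]]] := elementary_clip E u0 uv.
under eq_fun do rewrite hi1.
by apply: (simple_integral_ortho hF hB m ok u0) => // i; have [] := bd i.
Qed.

(* [H] is the integrand as given and [Ht] a jointly measurable version of it, which
   Fubini needs; they agree almost surely at each time. *)
Variables (H Ht : R -> T -> R) (K : R).
Hypothesis mHt :
  measurable_fun setT (fun z : measurableTypeR R * T => Ht z.1 z.2).
Hypothesis mH : forall s, 0 <= s -> measurable_fun setT (H s).
Hypothesis HHt : forall s, 0 <= s -> {ae P, forall w, H s w = Ht s w}.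
Hypothesis HK : forall s w, `|H s w| <= K.

Let phi (E : elementary_process F) s :=
  'E_P[fun w => ((el_val E s w - H s w) ^+ 2)%R]%E.

Let phit (E : elementary_process F) s :=
  (\int[P]_w ((el_val E s w - Ht s w) ^+ 2)%:E)%E.

Let mHts s : measurable_fun setT (Ht s).
Proof.
have mp : measurable_fun setT (fun w : T => ((s : measurableTypeR R), w)).
  by apply/measurable_fun_pair => //; exact: measurable_cst.
exact: (measurableT_comp mHt mp).
Qed.

Let phiE E s : 0 <= s -> phi E s = phit E s.
Proof.
move=> s0; rewrite /phi /phit unlock; apply: ae_eq_integral => //.
- apply/measurable_EFinP; apply: measurable_funX; apply: measurable_funB.
    by have [] := el_val_sqint E s.
  exact: mH.
- apply/measurable_EFinP; apply: measurable_funX; apply: measurable_funB => //.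
  by have [] := el_val_sqint E s.
- have := HHt s0; apply: filterS => w h _; congr EFin.
  by rewrite h.
Qed.

Let mexp (g : R -> T -> R) :
  measurable_fun setT (fun z : measurableTypeR R * T => g z.1 z.2) ->
  measurable_fun setT (fun s : measurableTypeR R =>
    'E_P[fun w => (g s w ^+ 2)%R]%E).
Proof.
move=> mg; under eq_fun do rewrite unlock.
have := @measurable_fun_fubini_tonelli_F _ _ (measurableTypeR R) T R P
  (fun z => (g z.1 z.2 ^+ 2)%:E).
rewrite /fubini_F /=; apply.
- by apply/measurable_EFinP; exact: measurable_funX.
- by move=> z; rewrite lee_fin sqr_ge0.
Qed.

Let mel_val (E : elementary_process F) :
  measurable_fun setT (fun z : measurableTypeR R * T => el_val E z.1 z.2).
Proof.
rewrite /el_val; apply: measurable_sum => i; apply: measurable_funM.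
  apply: (measurableT_comp _ measurable_snd).
  apply: (measurable_wrt_fun (Fm (el_time_ge E i))).
  exact: el_coef_meas.
by apply: (measurableT_comp _ measurable_fst); exact: measurable_indic.
Qed.

Let mphit E : measurable_fun setT (phit E : measurableTypeR R -> \bar R).
Proof.
have := mexp (g := fun s w => el_val E s w - Ht s w)
  (measurable_funB (mel_val E) mHt).
by under eq_fun do rewrite unlock.
Qed.

Let mphi E (D : set R) : D `<=` [set s | 0 <= s] ->
  measurable_fun D (phi E : measurableTypeR R -> \bar R).
Proof.
move=> D0; apply: (eq_measurable_fun (phit E : measurableTypeR R -> \bar R)).
  by move=> s; rewrite inE => /D0 s0; rewrite phiE.
exact: measurable_funTS.
Qed.

Let phi_ge0 E s : (0 <= phi E s)%E.
Proof. by apply: expectation_ge0 => w; rewrite sqr_ge0. Qed.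

Let H_sqint s : 0 <= s -> sqint P (H s).
Proof. by move=> s0; apply: (sqint_bounded P (mH s0) (HK s)). Qed.

Let cvge0_lt (f : nat -> \bar R) (e : R) : (f @ \oo --> 0%E) -> 0 < e ->
  \forall n \near \oo, (f n < e%:E)%E.
Proof.
move=> /fine_cvgP[ffin f0] e0.
have fe : \forall n \near \oo, fine (f n) < e by exact: (cvgr_lt _ f0).
near=> n; rewrite -[f n]fineK ?lte_fin; near: n => //.
Unshelve. all: by end_near. Qed.

Let ito_approx1 t I e : 0 <= t -> is_ito_integral P F b H t I -> 0 < e ->
  exists E : elementary_process F,
  [/\ sqint P I, mean P (fun w => (I w - el_integral E b t w) ^+ 2) <= e &
      (\int[mu]_(s in `[0%R, t]) phi E s <= e%:E)%E].
Proof.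
move=> t0 [mI [E [E1 E2]]] e0.
have h1 := cvge0_lt E1 e0; have h2 := cvge0_lt E2 e0.
near \oo => n; exists (E n).
have si := el_integral_sqint (E n) t0; have [mel _] := si.
have e2 : ('E_P[fun w => ((el_integral (E n) b t w - I w) ^+ 2)%R] < e%:E)%E.
  by near: n.
(* By definition I is merely measurable; it is square integrable because its L^2 distance to some
   elementary integral is finite. *)
have di : sqint P (fun w => el_integral (E n) b t w - I w).
  split; first exact: measurable_funB.
  apply/integrableP; split.
    by apply/measurable_EFinP; apply: measurable_funX; exact: measurable_funB.
  rewrite unlock in e2; under eq_integral do rewrite /= ger0_norm ?sqr_ge0//.
  exact: lt_trans e2 (ltry _).
split.
- have -> : I = (fun w => el_integral (E n) b t w - (el_integral (E n) b t w - I w)).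
    by apply/funext => w; ring.
  exact: sqintB.
- have -> : (fun w => (I w - el_integral (E n) b t w) ^+ 2) =
            (fun w => (el_integral (E n) b t w - I w) ^+ 2).
    by apply/funext => w; ring.
  rewrite -lee_fin -meanE; last exact: sqint_sqr.
  exact: ltW.
- by apply: ltW; near: n.
Unshelve. all: by end_near. Qed.

Lemma ito_integral_at0 I : is_ito_integral P F b H 0 I ->
  sqint P I /\ mean P (fun w => I w ^+ 2) = 0.
Proof.
move=> hI; have [? [si _ _]] := ito_approx1 (lexx 0) hI ltr01; split=> //.
apply/eqP; rewrite eq_le [X in _ && X]mean_ge0 ?andbT; last first.
  by move=> w; exact: sqr_ge0.
apply/ler_addgt0Pr => e e0; rewrite add0r.
have [E [_ + _]] := ito_approx1 (lexx 0) hI e0.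
congr (_ <= _); congr mean; apply/funext => w.
rewrite /el_integral big1 ?subr0// => i _.
by rewrite !(min_idPr _) ?subrr ?mulr0//; exact: el_time_ge.
Qed.

Variables (u v : R) (Iu Iv : T -> R).
Hypotheses (u0 : 0 <= u) (uv : u <= v).
Hypothesis hIu : is_ito_integral P F b H u Iu.
Hypothesis hIv : is_ito_integral P F b H v Iv.

Let v0 : 0 <= v. Proof. exact: le_trans uv. Qed.

Lemma ito_integral_sqint : sqint P (fun w => Iv w - Iu w).
Proof.
have [? [? _ _]] := ito_approx1 u0 hIu ltr01.
have [? [? _ _]] := ito_approx1 v0 hIv ltr01.
exact: sqintB.
Qed.

(** The definition supplies E' for time u and E for time v. That E also works at u follows from the
    isometry on ]0, u]: both processes are close to H there, so their integrals up to u are close to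
    each other. *)
Let ito_approx e : 0 < e ->
  exists E : elementary_process F,
  mean P (fun w => ((Iv w - Iu w) -
    (el_integral E b v w - el_integral E b u w)) ^+ 2) <= e /\
  (\int[mu]_(s in `[0%R, v]) phi E s <= e%:E)%E.
Proof.
(* 22 = 2 + 4 + 4 * 4: the square of a sum is split twice, and the third piece, the distance between
   E and E' at u, has mean square at most 4 e'. *)
move=> e0; pose e' := e / 22; have e'0 : 0 < e' by rewrite divr_gt0.
have [E' [Iui hE'1 hE'2]] := ito_approx1 u0 hIu e'0.
have [E [Ivi hE1 hE2]] := ito_approx1 v0 hIv e'0.
exists E; split; last by apply: (le_trans hE2); rewrite lee_fin /e'; lra.
have Eu := el_integral_sqint E u0; have Ev := el_integral_sqint E v0.
have E'u := el_integral_sqint E' u0.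
have phiS (E0 : elementary_process F) t : u <= t ->
    (\int[mu]_(s in `]0%R, u]) phi E0 s <= \int[mu]_(s in `[0%R, t]) phi E0 s)%E.
  move=> ut; apply: ge0_subset_integral => //.
    apply: mphi => s /=; rewrite in_itv/= => /andP[//].
  move=> s /=; rewrite !in_itv/= => /andP[/ltW -> su]/=.
  exact: le_trans ut.
have EE' : mean P (fun w => (el_integral E b u w - el_integral E' b u w) ^+ 2) <=
    4 * e'.
  have el0 (E0 : elementary_process F) w : el_integral E0 b 0 w = 0.
    rewrite /el_integral big1// => i _.
    by rewrite !(min_idPr _) ?subrr ?mulr0//; exact: el_time_ge.
  have -> : (fun w => (el_integral E b u w - el_integral E' b u w) ^+ 2) =
     (fun w => ((el_integral E b u w - el_integral E b 0 w) -
     (el_integral E' b u w - el_integral E' b 0 w)) ^+ 2).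
    by apply/funext => w; rewrite !el0 !subr0.
  rewrite -lee_fin -el_isometry//.
  apply: (@le_trans _ _
    (\int[mu]_(s in `]0%R, u]) (2%:E * phi E s + 2%:E * phi E' s))%E).
    apply: ge0_le_integral => //.
    - by move=> s _; apply: expectation_ge0 => w; rewrite sqr_ge0.
    - apply: measurable_funTS.
      exact: (mexp (g := fun s w => el_val E s w - el_val E' s w)
        (measurable_funB (mel_val E) (mel_val E'))).
    - have m1 (E0 : elementary_process F) : 
          measurable_fun `]0%R, u] (phi E0 : measurableTypeR R -> \bar R).
        by apply: mphi => s /=; rewrite in_itv/= => /andP[/ltW].
      by apply: emeasurable_funD; apply: emeasurable_funM => //; exact: m1.
    - move=> s /=; rewrite in_itv/= => /andP[/ltW s0 su].
      have i1 := sqintB (el_val_sqint E s) (H_sqint s0).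
      have i2 := sqintB (H_sqint s0) (el_val_sqint E' s).
      rewrite [phi E' s](_ : _ =
        'E_P[fun w => ((H s w - el_val E' s w) ^+ 2)%R]%E); last first.
        by congr expectation; apply/funext => w; ring.
      rewrite /phi !meanE; try exact: sqint_sqr; last first.
        by apply: sqint_sqr; apply: sqintB; exact: el_val_sqint.
      rewrite -!EFinM -EFinD lee_fin; apply: le_trans (mean_sqrD i1 i2).
      by rewrite le_eqVlt; apply/orP; left; apply/eqP; congr mean;
        apply/funext => w; ring.
  have m1 (E0 : elementary_process F) :
      measurable_fun `]0%R, u] (fun s : measurableTypeR R => 2%:E * phi E0 s)%E.
    apply: emeasurable_funM => //.
    by apply: mphi => s /=; rewrite in_itv/= => /andP[/ltW].
  have p0 (E0 : elementary_process F) s : (0 <= 2%:E * phi E0 s)%E.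
    by rewrite mule_ge0.
  rewrite ge0_integralD//; [|exact: m1|exact: m1].
  rewrite !ge0_integralZl_EFin//; last 2 first.
  - by apply: mphi => s /=; rewrite in_itv/= => /andP[/ltW].
  - by apply: mphi => s /=; rewrite in_itv/= => /andP[/ltW].
  have -> : (4 * e')%:E = (2%:E * e'%:E + 2%:E * e'%:E)%E.
    by rewrite -!EFinM -EFinD; congr EFin; ring.
  rewrite leeD// lee_pmul2l//.
    exact: (le_trans (phiS _ _ uv)).
  exact: (le_trans (phiS _ _ (lexx u))).
have -> : (fun w => ((Iv w - Iu w) - (el_integral E b v w - el_integral E b u w)) ^+ 2) =
   (fun w => ((Iv w - el_integral E b v w) +
     (-1 * (Iu w - el_integral E' b u w) +
      (el_integral E b u w - el_integral E' b u w))) ^+ 2).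
  by apply/funext => w; ring.
have d1 := sqintB Ivi Ev; have d2 := sqintZ (-1) (sqintB Iui E'u).
have d3 := sqintB Eu E'u.
apply: (le_trans (mean_sqrD d1 (sqintD d2 d3))).
have := mean_sqrD d2 d3.
have -> : mean P (fun w => (-1 * (Iu w - el_integral E' b u w)) ^+ 2) =
    mean P (fun w => (Iu w - el_integral E' b u w) ^+ 2).
  by congr mean; apply/funext => w; ring.
have : e = 22 * e' by rewrite /e'; field.
clearbody e'; lra.
Qed.

(** True for elementary integrals by [el_ortho]. The error of approximation is controlled by
    [mean_young] with weight e, for an elementary process of accuracy e^2. *)
Lemma ito_integral_ortho Z : bounded_wrt (F u) Z ->
  mean P (fun w => Z w * (Iv w - Iu w)) = 0.
Proof.
move=> bZ; have Zi := bounded_wrt_sqint P (Fm u0) bZ.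
have II := ito_integral_sqint.
suff h e : 0 < e -> 2 * `|mean P (fun w => Z w * (Iv w - Iu w))| <=
    e * (mean P (fun w => Z w ^+ 2) + 1).
  apply/eqP; rewrite -normr_eq0 eq_le normr_ge0 andbT.
  have Z2 : 0 <= mean P (fun w => Z w ^+ 2) by apply: mean_ge0 => w; rewrite sqr_ge0.
  apply/ler_addgt0Pr => e e0; rewrite add0r.
  have := h (e / (mean P (fun w => Z w ^+ 2) + 1)) ltac:(by rewrite divr_gt0//; lra).
  rewrite divfK; last by rewrite gt_eqF//; lra.
  have := normr_ge0 (mean P (fun w => Z w * (Iv w - Iu w))); lra.
move=> e0; have [E [hE _]] := ito_approx (mulr_gt0 e0 e0).
have Eu := el_integral_sqint E u0; have Ev := el_integral_sqint E v0.
have dE := sqintB II (sqintB Ev Eu).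
have -> : mean P (fun w => Z w * (Iv w - Iu w)) =
  mean P (fun w => Z w * (Iv w - Iu w - (el_integral E b v w - el_integral E b u w))).
  rewrite -[RHS]addr0 -(el_ortho E u0 uv bZ) -meanD; last 2 first.
  - exact: sqintM.
  - by apply: sqintM => //; exact: sqintB.
  by congr mean; apply/funext => w; ring.
apply: (le_trans (mean_young e0 Zi dE)).
rewrite mulrDr mulr1 lerD2l -(ler_pM2l e0) mulrA divff ?gt_eqF// mul1r.
exact: hE.
Qed.

(** A one-sided substitute for the isometry of the limit. The square is split at the elementary
    integral, and the integrand of the second piece, E - G, is split at H: hence the factor 4, and a
    total error 2 e' + 4 e' = e. *)
Lemma ito_integral_bound G kappa : bounded_wrt (F u) G -> 0 <= kappa ->
  (forall s, u < s <= v -> mean P (fun w => (H s w - G w) ^+ 2) <= kappa) ->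
  mean P (fun w => ((Iv w - Iu w) - G w * (b v w - b u w)) ^+ 2) <=
  4 * kappa * (v - u).
Proof.
move=> bG k0 hk.
have Gi := bounded_wrt_sqint P (Fm u0) bG.
apply/ler_addgt0Pr => e e0; pose e' := e / 6.
have e'0 : 0 < e' by rewrite divr_gt0.
have [E [hE1 hE2]] := ito_approx e'0.
have Eu := el_integral_sqint E u0; have Ev := el_integral_sqint E v0.
have Eint := sqintB Ev Eu.
have Gd : sqint P (fun w => G w * (b v w - b u w)).
  have [mG [L GL]] := bG; apply: (sqint_Mbounded _ GL).
    exact: (measurable_wrt_fun (Fm u0) mG).
  exact: (db_sqint hF hB m u0 uv).
have d1 := sqintB ito_integral_sqint Eint.
have d2 := sqintB Eint Gd.
have key : mean P (fun w => ((el_integral E b v w - el_integral E b u w) -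
     G w * (b v w - b u w)) ^+ 2) <= 2 * e' + 2 * kappa * (v - u).
  rewrite -lee_fin -el_isometry_cst//.
  have m1 : measurable_fun `]u, v] (phi E : measurableTypeR R -> \bar R).
    by apply: mphi => s /=; rewrite in_itv/= => /andP[us _]; rewrite ltW// (le_lt_trans u0).
  apply: (@le_trans _ _
    (\int[mu]_(s in `]u, v]) (2%:E * phi E s + (2 * kappa)%:E))%E).
    apply: ge0_le_integral => //.
    - by move=> s _; apply: expectation_ge0 => w; rewrite sqr_ge0.
    - apply: measurable_funTS.
      apply: (mexp (g := fun s w => el_val E s w - G w)).
      apply: measurable_funB => //; apply: (measurableT_comp _ measurable_snd).
      by have [] := Gi.
    - by apply: emeasurable_funD => //; apply: emeasurable_funM.
    - move=> s /=; rewrite in_itv/= => /andP[us sv].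
      have s0 : 0 <= s by rewrite ltW// (le_lt_trans u0).
      have i1 := sqintB (el_val_sqint E s) (H_sqint s0).
      have i2 := sqintB (H_sqint s0) Gi.
      rewrite /phi !meanE; try exact: sqint_sqr; last first.
        by apply: sqint_sqr; apply: sqintB => //; exact: el_val_sqint.
      rewrite -!EFinM -EFinD lee_fin.
      apply: (@le_trans _ _ (2 * mean P (fun w => (el_val E s w - H s w) ^+ 2) +
        2 * mean P (fun w => (H s w - G w) ^+ 2))).
        apply: le_trans (mean_sqrD i1 i2).
        by rewrite le_eqVlt; apply/orP; left; apply/eqP; congr mean;
          apply/funext => w; ring.
      by rewrite lerD2l ler_wpM2l//; apply: hk; rewrite us.
  rewrite ge0_integralD//; first last.
  - by move=> s _; rewrite lee_fin mulr_ge0.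
  - exact: emeasurable_funM.
  - by move=> s _; rewrite mule_ge0.
  rewrite ge0_integralZl_EFin// integral_cst//= lebesgue_measure_itv/= lte_fin.
  rewrite [leRHS]EFinD leeD//.
    rewrite EFinM lee_pmul2l//; apply: le_trans hE2.
    apply: ge0_subset_integral => //.
      by apply: mphi => s /=; rewrite in_itv/= => /andP[].
    move=> s /=; rewrite !in_itv/= => /andP[us ->]; rewrite andbT.
    by rewrite ltW// (le_lt_trans u0).
  case: ifPn => [_|_]; first by rewrite -EFinD -EFinM.
  by rewrite mule0 lee_fin mulr_ge0 ?subr_ge0// mulr_ge0.
have -> : (fun w => ((Iv w - Iu w) - G w * (b v w - b u w)) ^+ 2) =
  (fun w => (((Iv w - Iu w) - (el_integral E b v w - el_integral E b u w)) +
   ((el_integral E b v w - el_integral E b u w) - G w * (b v w - b u w))) ^+ 2).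
  by apply/funext => w; ring.
apply: (le_trans (mean_sqrD d1 d2)).
have : e = 6 * e' by rewrite /e'; field.
clearbody e'; lra.
Qed.

End ito_increments.

(** * Measurability of functions of a process *)

Section coordinatewise_measurability.
Context {d} {T : measurableType d} {R : realType} {n : nat}.
Variable Y : T -> 'rV[R]_n.
Hypothesis mY : forall k, measurable_fun setT (fun w => Y w 0 k).

Let box (p : 'rV[rat]_n * rat) : set 'rV[R]_n :=
  [set x | forall k, `|x 0 k - ratr (p.1 0 k)| < ratr p.2].

Let box_measurable p : measurable (Y @^-1` box p).
Proof.
have -> : Y @^-1` box p = \bigcap_(k in [set: 'I_n])
    ((fun w => `|Y w 0 k - ratr (p.1 0 k)|) @^-1` `]-oo, ratr p.2[).
  apply/seteqP; split=> [w /= h k _ /=|w /= h k]; first by rewrite in_itv/= h.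
  by have := h k I; rewrite /= in_itv.
apply: fin_bigcap_measurable => // k _; rewrite -[X in measurable X]setTI.
have mk : measurable_fun setT (fun w => `|Y w 0 k - ratr (p.1 0 k)|).
  by apply: measurableT_comp => //; apply: measurable_funB.
exact: mk.
Qed.

(** An open set is the union of the boxes with rational centre and radius that it contains. There
    are countably many of them, enumerated by [unpickle], and the preimage of a box involves only
    the coordinates of Y. *)
Lemma open_preimage_measurable (O : set 'rV[R]_n) : open O ->
  measurable (Y @^-1` O).
Proof.
move=> oO.
pose A (i : nat) : set T :=
  if unpickle i is Some p then
    if `[< box p `<=` O >] then Y @^-1` box p else set0
  else set0.
have -> : Y @^-1` O = \bigcup_i A i.
  apply/seteqP; split=> [w /= Ow|w [i _]]; last first.
    rewrite /A; case: unpickle => [p|//]; case: asboolP => // pO /= bp.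
    exact: pO.
  move: oO; rewrite openE => /(_ _ Ow) /nbhs_ballP[e /= e0 eO].
  have e20 : 0 < e / 2 by rewrite divr_gt0.
  have [r] := rat_in_itvoo e20; rewrite in_itv/= => /andP[r0 re].
  have qP k : exists q : rat, `|Y w 0 k - ratr q| < ratr r :> R.
    have h : Y w 0 k - ratr r < Y w 0 k + ratr r by lra.
    have [q] := rat_in_itvoo h; rewrite in_itv/= => /andP[q1 q2].
    by exists q; rewrite ltr_norml; lra.
  (* A rational centre is chosen coordinate by coordinate; the default 0 of [xget] is never taken,
     by [qP]. As r < e / 2, the box lies in the ball of radius e around Y w. *)
  pose p : 'rV[rat]_n * rat := (\row_k xget 0 [set q : rat | `|Y w 0 k - ratr q| < ratr r :> R], r).
  have pE k : `|Y w 0 k - ratr (p.1 0 k)| < ratr r :> R.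
    rewrite mxE; case: xgetP => [q _ //|/= h].
    by have [q qk] := qP k; have := h q.
  exists (pickle p) => //; rewrite /A pickleK.
  case: asboolP => [_ k|]; first exact: pE.
  case => x bx; apply: eO; split=> // i k; rewrite ord1.
  have := bx k; have := pE k; rewrite /= /ball /= !ltr_norml.
  lra.
apply: bigcup_measurable => i _; rewrite /A; case: unpickle => // p.
by case: ifP.
Qed.

(** The preimage of an open interval under f is only relatively open in D. It coincides on D with an
    open set, and Y stays in D. *)
Lemma within_continuous_measurable (D : set 'rV[R]_n) (f : 'rV[R]_n -> R) :
  {within D, continuous f} -> (forall w, D (Y w)) ->
  measurable_fun setT (fun w => f (Y w)).
Proof.
move=> /continuousP cf DY.
apply: (measurability _ (RGenOpens.measurableE R)).
move=> _ [_ [a [b ->] <-]]; rewrite setTI.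
have oab : open (`]a, b[%classic : set R) by exact: interval_open.
have /open_subspaceP[V oV VE] := cf _ oab.
have -> : (fun w => f (Y w)) @^-1` `]a, b[ = Y @^-1` V.
  apply/seteqP; split=> w /= h.
    by have : (V `&` D) (Y w) by [rewrite VE; split=> //]; case.
  by have : (f @^-1` `]a, b[ `&` D) (Y w) by [rewrite -VE; split=> //]; case.
exact: open_preimage_measurable.
Qed.

End coordinatewise_measurability.

Section caratheodory.
Context {d} {T : measurableType d} {R : realType}.

(** Time is rounded down to multiples of 1 / (i + 1). The rounded process takes countably many
    times, so its level sets are countable unions of rectangles, and it converges to h by
    continuity. The maximum with 0 restricts measurability of h to nonnegative times. *)
Lemma continuous_process_measurable (h : R -> T -> R) :
  (forall w, continuous (h ^~ w)) ->
  (forall s, 0 <= s -> measurable_fun setT (h s)) ->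
  measurable_fun setT
    (fun z : measurableTypeR R * T => h (Num.max 0 z.1) z.2).
Proof.
move=> ch mh.
pose tn (i : nat) (s : R) : nat := Num.truncn (i.+1%:R * Num.max 0 s).
pose hn (i : nat) (z : measurableTypeR R * T) : R :=
  h ((tn i z.1)%:R / i.+1%:R) z.2.
apply: (@measurable_fun_cvg _ _ _ _ hn).
  move=> i _ A mA; rewrite setTI.
  have -> : hn i @^-1` A = \bigcup_j
     ([set s | tn i s = j] `*` (h (j%:R / i.+1%:R) @^-1` A)).
    apply/seteqP; split=> [[s w] /= hA|[s w] [j _ [/= <-]] //].
    by exists (tn i s).
  apply: bigcup_measurable => j _; apply: measurableX; last first.
    by rewrite -[X in measurable X]setTI; apply: mh.
  have -> : [set s | tn i s = j] =
     (fun s : measurableTypeR R => i.+1%:R * Num.max 0 s) @^-1` `[j%:R, j.+1%:R[.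
    apply/seteqP; split=> s /=; rewrite in_itv/= /tn.
      by move=> <-; apply: truncn_itv; rewrite mulr_ge0// le_max lexx.
    exact: truncn_def.
  rewrite -[X in measurable X]setTI.
  have mm : measurable_fun setT
      (fun s : measurableTypeR R => i.+1%:R * Num.max 0 s : R).
    by apply: measurable_funM => //; exact: measurable_maxr.
  exact: mm.
move=> [s w] _ /=; set s' := Num.max 0 s.
have s'0 : 0 <= s' by rewrite /s' le_max lexx.
apply: (@cvg_comp _ _ _ (fun i => (tn i s)%:R / i.+1%:R) (h ^~ w) _ _ _ _ (ch w s')).
apply/(@cvgrPdist_le _ R^o) => e e0; near=> i.
have i0 : (0 : R) < i.+1%:R by [].
have /andP[h1 h2] := truncn_itv (mulr_ge0 (ltW i0) s'0).
rewrite /tn /= -/s'; set t := Num.truncn _ in h1 h2 *.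
have h3 : s' - t%:R / i.+1%:R = (i.+1%:R * s' - t%:R) / i.+1%:R by field.
rewrite h3 ger0_norm; last by rewrite divr_ge0// subr_ge0.
rewrite ler_pdivrMr//; apply: (@le_trans _ _ 1).
  by move: h2; rewrite -natr1; lra.
rewrite mulrC -ler_pdivrMr// mul1r.
near: i; exists (Num.truncn e^-1).+1 => // i /= hi.
have : e^-1 < (Num.truncn e^-1).+1%:R by exact: truncnS_gt.
move=> /ltW/le_trans; apply; rewrite ler_nat.
by rewrite (leq_trans hi).
Unshelve. all: by end_near. Qed.

End caratheodory.

(** * Integrals over time *)

Section time_integral.
Context {d} {T : measurableType d} {R : realType} (P : probability T R).
Local Notation mu := (@lebesgue_measure R).
Variables (g : R -> T -> R) (C u v : R).
Hypothesis mg : measurable_fun setT (fun z : measurableTypeR R * T => g z.1 z.2).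
Hypothesis gC : forall s w, `|g s w| <= C.
Hypothesis uv : u <= v.

Let J w := \int[mu]_(s in `]u, v]) g s w.

Let C0 : 0 <= C. Proof. exact: le_trans (gC 0 point). Qed.

Let mgw w : measurable_fun setT (g ^~ w : measurableTypeR R -> R).
Proof.
have mp : measurable_fun setT (fun s : measurableTypeR R => (s, w)).
  by apply/measurable_fun_pair => //; exact: measurable_cst.
exact: (measurableT_comp mg mp).
Qed.

Let mgs s : measurable_fun setT (g s).
Proof.
have mp : measurable_fun setT (fun w : T => ((s : measurableTypeR R), w)).
  by apply/measurable_fun_pair => //; exact: measurable_cst.
exact: (measurableT_comp mg mp).
Qed.

Let muE : mu `]u, v]%classic = (v - u)%:E.
Proof.
rewrite lebesgue_measure_itv/= lte_fin; case: ltP => [_|vu]; first by rewrite -EFinD.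
by have /eqP -> : v == u by [rewrite eq_le uv vu]; rewrite subrr.
Qed.

Let int_bounded (h : measurableTypeR R -> R) c : measurable_fun setT h ->
  (forall s, `|h s| <= c) -> mu.-integrable `]u, v] (EFin \o h).
Proof.
move=> mh hc; apply: measurable_bounded_integrable => //.
- by rewrite /= muE ltry.
- exact: measurable_funTS.
- exists c; split; rewrite ?num_real// => x cx s _.
  exact: (le_trans (hc s) (ltW cx)).
Qed.

Lemma time_integrable w : mu.-integrable `]u, v] (fun s => (g s w)%:E).
Proof. exact: (int_bounded (mgw w) (fun s => gC s w)). Qed.

Lemma time_integral_le w : `|J w| <= C * (v - u).
Proof.
rewrite (le_trans (le_normr_Rintegral _ (time_integrable w)))//.
apply: (@le_trans _ _ (\int[mu]_(s in `]u, v]) (cst C s))).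
  apply: le_Rintegral => //.
  - exact: (integrable_norm (time_integrable w)).
  - by apply: (int_bounded (c := `|C|)) => //.
by rewrite Rintegral_cst//= [mu _]muE.
Qed.

Lemma time_integral_measurable : measurable_fun setT J.
Proof.
(* The integrand is shifted by C to be nonnegative, so that Tonelli applies; the shift is subtracted
   in [JE]. *)
pose f (z : measurableTypeR R * T) : \bar R :=
  ((g z.1 z.2 + C) * \1_(`]u, v]%classic : set (measurableTypeR R)) z.1)%:E.
have f0 z : (0 <= f z)%E.
  rewrite lee_fin mulr_ge0//; have := gC z.1 z.2; rewrite ler_norml; lra.
have mf : measurable_fun setT f.
  apply/measurable_EFinP; apply: measurable_funM.
    exact: measurable_funD.
  by apply: (measurableT_comp _ measurable_fst); exact: measurable_indic.
have := measurable_fun_fubini_tonelli_G (m1 := mu) f mf f0.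
rewrite /fubini_G => mG.
have JE w : J w = fine (\int[mu]_s f (s, w)) - C * (v - u).
  have -> : (\int[mu]_s f (s, w) = \int[mu]_(s in `]u, v]) (g s w + C)%:E)%E.
    rewrite [RHS]integral_mkcond; apply: eq_integral => s _.
    by rewrite /f /patch /= indicE; case: ifPn => _; rewrite /= ?mulr1 ?mulr0.
  have -> : fine (\int[mu]_(s in `]u, v]) (g s w + C)%:E) =
     \int[mu]_(s in `]u, v]) (g s w + cst C s) by [].
  rewrite RintegralD//; last 2 first.
  - exact: time_integrable.
  - by apply: (int_bounded (c := `|C|)) => //.
  by rewrite Rintegral_cst//= [mu _]muE/= addrK.
rewrite (funext JE); apply: measurable_funB => //.
exact: (measurableT_comp (fine_measurable measurableT) mG).
Qed.

Lemma time_integral_sqint : sqint P J.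
Proof. exact: (sqint_bounded P time_integral_measurable time_integral_le). Qed.

Let mg2 w : measurable_fun setT (fun s : measurableTypeR R => g s w ^+ 2).
Proof. exact: measurable_funX. Qed.

Let g2C s w : `|g s w ^+ 2| <= C ^+ 2.
Proof. by rewrite normrX lerXn2r ?nnegrE. Qed.

(** Jensen's inequality for the square: the integral of (g - c)^2 is nonnegative, with c the time
    average of g. *)
Let jensen w : J w ^+ 2 <= (v - u) * \int[mu]_(s in `]u, v]) (g s w ^+ 2).
Proof.
have [vu|uv'] := leP v u.
  have /eqP uvE : u == v by rewrite eq_le uv vu.
  have -> : J w = 0.
    apply/eqP; rewrite -normr_eq0 eq_le normr_ge0 andbT.
    by rewrite (le_trans (time_integral_le w))// uvE subrr mulr0.
  by rewrite expr0n/= uvE subrr mul0r.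
have l0 : 0 < v - u by rewrite subr_gt0.
pose c := J w / (v - u).
have i2 := int_bounded (mg2 w) (fun s => g2C s w).
have i1 := time_integrable w.
have ic : mu.-integrable `]u, v] (EFin \o cst (c ^+ 2)).
  by apply: (int_bounded (c := `|c ^+ 2|)) => //.
have i1' : mu.-integrable `]u, v] (EFin \o (fun s => 2 * c * g s w)).
  apply: (int_bounded (c := `|2 * c| * C)); first exact: measurable_funM.
  by move=> s; rewrite normrM ler_wpM2l.
have : 0 <= \int[mu]_(s in `]u, v]) (g s w - c) ^+ 2.
  by apply: Rintegral_ge0 => s _; rewrite sqr_ge0.
have -> : \int[mu]_(s in `]u, v]) (g s w - c) ^+ 2 =
    \int[mu]_(s in `]u, v]) (g s w ^+ 2 - 2 * c * g s w + cst (c ^+ 2) s).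
  by apply: eq_Rintegral => s _ /=; ring.
have i3 : mu.-integrable `]u, v] (EFin \o (fun s => g s w ^+ 2 - 2 * c * g s w)).
  apply: (int_bounded (c := C ^+ 2 + `|2 * c| * C)).
    by apply: measurable_funB => //; exact: measurable_funM.
  by move=> s; rewrite (le_trans (ler_normB _ _))// lerD// normrM ler_wpM2l.
rewrite RintegralD//.
rewrite RintegralB// RintegralZl// Rintegral_cst//= [mu _]muE/= -/(J w).
have JE : J w = c * (v - u) by rewrite /c divfK// gt_eqF.
rewrite JE; set I2 := Rintegral _ _ _ => h.
have h2 : 0 <= (v - u) * (I2 - 2 * c * (c * (v - u)) + c ^+ 2 * (v - u)).
  by rewrite mulr_ge0// ltW.
lra.
Qed.

Lemma time_integral_sqr kappa :
  (forall s, u < s <= v -> mean P (fun w => g s w ^+ 2) <= kappa) ->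
  mean P (fun w => J w ^+ 2) <= (v - u) ^+ 2 * kappa.
Proof.
move=> hk; have Ji := time_integral_sqint.
rewrite -lee_fin -meanE; last exact: sqint_sqr.
rewrite unlock.
pose f (z : measurableTypeR R * T) : \bar R :=
  (g z.1 z.2 ^+ 2 * \1_(`]u, v]%classic : set (measurableTypeR R)) z.1)%:E.
have f0 z : (0 <= f z)%E by rewrite lee_fin mulr_ge0// sqr_ge0.
have mf : measurable_fun setT f.
  apply/measurable_EFinP; apply: measurable_funM.
    exact: measurable_funX.
  by apply: (measurableT_comp _ measurable_fst); exact: measurable_indic.
have fE w : (\int[mu]_s f (s, w) = \int[mu]_(s in `]u, v]) (g s w ^+ 2)%:E)%E.
  rewrite [RHS]integral_mkcond; apply: eq_integral => s _.
  by rewrite /f /patch /= indicE; case: ifPn => _; rewrite /= ?mulr1 ?mulr0.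
have fin w : (\int[mu]_(s in `]u, v]) (g s w ^+ 2)%:E)%E \is a fin_num.
  by apply: integrable_fin_num => //; exact: (int_bounded (mg2 w) (fun s => g2C s w)).
have mG := measurable_fun_fubini_tonelli_G (m1 := mu) f mf f0.
apply: (@le_trans _ _ (\int[P]_w ((v - u)%:E * \int[mu]_s f (s, w)))%E).
  apply: ge0_le_integral => //.
  - by move=> w _; rewrite lee_fin sqr_ge0.
  - by apply/measurable_EFinP; apply: measurable_funX; exact: time_integral_measurable.
  - by apply: emeasurable_funM.
  - by move=> w _; rewrite fE -[X in (_ * X)%E]fineK// -EFinM lee_fin; exact: jensen.
rewrite ge0_integralZl_EFin//; last 2 first.
- by move=> w _; apply: integral_ge0.
- by rewrite subr_ge0.
rewrite -(fubini_tonelli (m1 := mu) (m2 := P) f mf f0)//.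
rewrite expr2 -mulrA EFinM lee_wpmul2l ?lee_fin ?subr_ge0//.
apply: (@le_trans _ _ (\int[mu]_(s in `]u, v]) kappa%:E)%E); last first.
  by rewrite integral_cst//= [mu _]muE -EFinM lee_fin mulrC.
rewrite [leRHS]integral_mkcond; apply: ge0_le_integral => //.
- by move=> s _; apply: integral_ge0.
- exact: (measurable_fun_fubini_tonelli_F (m2 := P) f mf f0).
- exact/(measurable_restrictT _ _).1.
- move=> s _; rewrite /f /patch /=; case: ifPn => [|sN].
    rewrite inE/= in_itv/= => h; rewrite indicE mem_setE in_itv/= h.
    under eq_integral do rewrite mulr1.
    have gi : intg P (fun w => g s w ^+ 2).
      by apply: (intg_bounded P _ (g2C s)); exact: measurable_funX.
    by have := meanE gi; rewrite unlock => ->; rewrite lee_fin hk.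
  rewrite indicE (negbTE sN).
  by under eq_integral do rewrite mulr0; rewrite integral0.
Qed.

End time_integral.

(** * Squared distances and versions of the solution *)

Section sum_of_squares.
Context {R : realType}.

Lemma sqr_sum_le (n : nat) (x : 'I_n -> R) :
  (\sum_i x i) ^+ 2 <= n%:R * \sum_i x i ^+ 2.
Proof.
set S := \sum_i x i ^+ 2.
have -> : n%:R * S = \sum_i \sum_j (x i ^+ 2 + x j ^+ 2) / 2.
  transitivity (\sum_(i < n) (n%:R * (x i ^+ 2 / 2) + S / 2)).
    rewrite big_split/= -mulr_sumr -mulr_suml -/S sumr_const card_ord.
    by rewrite -[X in _ + X]mulr_natl; field.
  apply: eq_bigr => i _; rewrite -mulr_suml big_split/= sumr_const card_ord -/S.
  by rewrite -mulr_natl; field.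
rewrite expr2 mulr_suml; apply: ler_sum => i _.
rewrite mulr_sumr; apply: ler_sum => j _.
by have := sqr_ge0 (x i - x j); nra.
Qed.

Definition sqdist (n : nat) (x y : 'rV[R]_n) : R :=
  \sum_j (x 0 j - y 0 j) ^+ 2.

Lemma sqdist_ge0 (n : nat) (x y : 'rV[R]_n) : 0 <= sqdist x y.
Proof. by apply: sumr_ge0 => j _; exact: sqr_ge0. Qed.

Lemma sqdist_triangle (n : nat) (x y z : 'rV[R]_n) :
  sqdist x z <= 2 * sqdist x y + 2 * sqdist y z.
Proof.
rewrite /sqdist !mulr_sumr -big_split/=; apply: ler_sum => j _.
by have := sqr_ge0 (x 0 j - y 0 j - (y 0 j - z 0 j)); nra.
Qed.

End sum_of_squares.

Section cube_clip.
Context {d} {T : measurableType d} {R : realType} {n : nat}.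
Variables (Y : T -> 'rV[R]_n) (x0 : 'rV[R]_n).
Hypothesis mY : forall k, measurable_fun setT (fun w => Y w 0 k).

Lemma cube_measurable : measurable [set w | cube R n (Y w)].
Proof.
have -> : [set w | cube R n (Y w)] =
    \bigcap_(k in [set: 'I_n]) ((fun w => Y w 0 k) @^-1` `[-1, 1]).
  apply/seteqP; split=> [w /= h k _ /=|w /= h k]; first by rewrite in_itv/=; exact: h.
  by have := h k I; rewrite /= in_itv.
apply: fin_bigcap_measurable => // k _; rewrite -[X in measurable X]setTI.
exact: (mY k).
Qed.

Lemma cube_if_measurable (f g : T -> R) :
  measurable_fun setT f -> measurable_fun setT g ->
  measurable_fun setT (fun w => if `[< cube R n (Y w) >] then f w else g w).
Proof.
move=> mf mg; apply: measurable_fun_ifT => //.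
apply: (measurable_fun_bool true); rewrite setTI.
have -> : (fun w => `[< cube R n (Y w) >]) @^-1` [set true] =
    [set w | cube R n (Y w)].
  by apply/seteqP; split=> w /= => [/asboolP//|h]; exact/asboolP.
exact: cube_measurable.
Qed.

End cube_clip.

Section regular_version.
Context {d} {T : measurableType d} {R : realType} (P : probability T R) {n : nat}.
Variables (X : R -> T -> 'rV[R]_n) (x0 : 'rV[R]_n).

(** Paths in a null set N containing all the irregular ones are replaced by the constant x0, and
    time is frozen at 0 for t < 0; every path is then continuous on the whole line and
    [continuous_process_measurable] applies. Adaptedness is not preserved, as N need not belong to F
    t. *)
Lemma regular_version : cube R n x0 ->
  (forall t k, 0 <= t -> measurable_fun setT (fun w => X t w 0 k)) ->
  as_continuous P X ->
  {ae P, forall w, forall t, 0 <= t -> cube R n (X t w)} ->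
  exists Xt : R -> T -> 'rV[R]_n,
  [/\ forall t w, cube R n (Xt t w),
      forall k, measurable_fun setT
        (fun z : measurableTypeR R * T => Xt z.1 z.2 0 k) &
      {ae P, forall w, forall t, 0 <= t -> X t w = Xt t w}].
Proof.
move=> Dx0 mX [N1 [mN1 N10 cX]] [N2 [mN2 N20 DX]].
pose N := N1 `|` N2; have mN : measurable N by exact: measurableU.
have N0 : P N = 0%E by rewrite /N measureU0.
exists (fun t w => if w \in N then x0 else X (Num.max 0 t) w); split.
- move=> t w; case: ifPn => // wN.
  apply: contrapT => h; move/negP: wN; apply; rewrite inE; right; apply: DX.
  by move=> /= /(_ (Num.max 0 t)) h'; apply: h; apply: h'; rewrite le_max lexx.
- move=> k.
  pose h t w := if w \in N then x0 0 k else X (Num.max 0 t) w 0 k.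
  have -> : (fun z : measurableTypeR R * T =>
      (if z.2 \in N then x0 else X (Num.max 0 z.1) z.2) 0 k) =
      (fun z : measurableTypeR R * T => h (Num.max 0 z.1) z.2).
    apply/funext => z; rewrite /h.
    have -> : Num.max 0 (Num.max 0 z.1) = Num.max 0 z.1 :> R.
      by apply/max_idPr; rewrite le_max lexx.
    by case: ifP.
  apply: continuous_process_measurable.
  + move=> w; have [wN|wN] := boolP (w \in N).
      have -> : h ^~ w = cst (x0 0 k) by apply/funext => t; rewrite /h wN.
      exact: cst_continuous.
    have -> : h ^~ w = fun t => X (Num.max 0 t) w 0 k.
      by apply/funext => t; rewrite /h (negbTE wN).
    have cw : {within `[0, +oo[, continuous (fun t => X t w)}.
      apply: contrapT => h'; move/negP: wN; apply; rewrite inE; left.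
      by apply: cX => /=.
    move=> t; apply: (cvg_comp _ (fun x : 'rV[R]_n => x 0 k)); last first.
      exact: coord_continuous.
    move/subspace_continuousP : cw => /(_ (Num.max 0 t)) /= cw.
    have t0 : 0 <= Num.max 0 t by rewrite le_max lexx.
    have {}cw := cw ltac:(by rewrite in_itv/= t0).
    apply: (cvg_comp (fun t => Num.max 0 t) (fun t => X t w) _ cw).
    have cm : Num.max 0 (x : R) @[x --> t] --> Num.max 0 t.
      by apply: (continuous_max (f := cst 0) (g := id)); [exact: cvg_cst|exact: cvg_id].
    move=> A /= /cm; rewrite /= !nbhs_simpl/=; apply: filterS => x; apply.
    by rewrite in_itv/= le_max lexx.
  + move=> s s0.
    have mfN : measurable_fun setT (fun w => w \in N).
      apply: (measurable_fun_bool true); rewrite setTI.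
      have -> : (fun w => w \in N) @^-1` [set true] = N.
        by apply/seteqP; split=> w /= => [/set_mem|/mem_set].
      exact: mN.
    apply: (measurable_fun_ifT mfN); first exact: measurable_cst.
    by apply: mX; rewrite le_max lexx.
- exists N; split=> // w /= h.
  apply: contrapT => wN; apply: h => t t0.
  by rewrite memNset// (max_idPr t0).
Qed.

End regular_version.

(** * One step of the solution *)

Section sde_increments.
Context {d} {T : measurableType d} {R : realType} (P : probability T R).
Context {n M : nat} {F : R -> set (set T)} {B : R -> T -> 'rV[R]_M}.
Hypothesis hF : filtration F.
Hypothesis hB : brownian_motion P F B.
Local Notation mu := (@lebesgue_measure R).
Local Notation D := (cube R n).
Variables (a : 'I_n -> 'rV[R]_n -> R) (b : 'I_M -> 'I_n -> 'rV[R]_n -> R).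
Variables (K L : R) (x0 : 'rV[R]_n) (X : R -> T -> 'rV[R]_n).
Hypotheses (K0 : 0 <= K) (L0 : 0 <= L) (Dx0 : D x0).
Hypothesis ca : forall k, {within D, continuous (a k)}.
Hypothesis cb : forall m k, {within D, continuous (b m k)}.
Hypothesis aK : forall k x, D x -> `|a k x| <= K.
Hypothesis bK : forall m k x, D x -> `|b m k x| <= K.
Hypothesis aL : forall k x y, D x -> D y ->
  (a k x - a k y) ^+ 2 <= L * sqdist x y.
Hypothesis bL : forall m k x y, D x -> D y ->
  (b m k x - b m k y) ^+ 2 <= L * sqdist x y.
Hypothesis hX : ito_solution P F B D a b x0 X.

Let sF t : 0 <= t -> sigma_algebra setT (F t).
Proof. by case: hF => + _ _; exact. Qed.

Let Fm t : 0 <= t -> F t `<=` measurable.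
Proof. by case: hF => _ + _; exact. Qed.

Let Fle s t : 0 <= s -> s <= t -> F s `<=` F t.
Proof. by case: hF => _ _; exact. Qed.

Let adX : adapted F X. Proof. by case: hX. Qed.

Let mX t k : 0 <= t -> measurable_fun setT (fun w => X t w 0 k).
Proof. by move=> t0; apply: (measurable_wrt_fun (Fm t0)); exact: adX. Qed.

(* The solution lies in the cube only almost surely; [clip] does so everywhere
   and, unlike [regular_version], stays adapted. *)
Definition clip t w : 'rV[R]_n := if `[< D (X t w) >] then X t w else x0.

Lemma clip_cube t w : D (clip t w).
Proof. by rewrite /clip; case: asboolP. Qed.

Lemma clip_ae : {ae P, forall w, forall t, 0 <= t -> X t w = clip t w}.
Proof.
have [_ _ DX _] := hX; apply: filterS DX => w h t t0.
by rewrite /clip; case: asboolP => // nD; exfalso; apply: nD; exact: h.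
Qed.

Lemma clip_adapted t k : 0 <= t -> measurable_wrt (F t) (fun w => clip t w 0 k).
Proof.
move=> t0; apply/(measurable_wrtP _ (sF t0)).
have mXF j : measurable_fun setT
    ((fun w => X t w 0 j) : g_sigma_algebraType (F t) -> R).
  by apply/(measurable_wrtP _ (sF t0)); exact: adX.
have -> : (fun w => clip t w 0 k) =
    (fun w => if `[< D (X t w) >] then X t w 0 k else x0 0 k).
  by apply/funext => w; rewrite /clip; case: ifP.
apply: (@cube_if_measurable _ (g_sigma_algebraType (F t)) R n (X t) mXF) => //.
Qed.

Let compF (f : 'rV[R]_n -> R) t (Y : T -> 'rV[R]_n) : 0 <= t ->
  {within D, continuous f} -> (forall w, D (Y w)) ->
  (forall k, measurable_wrt (F t) (fun w => Y w 0 k)) ->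
  measurable_wrt (F t) (fun w => f (Y w)).
Proof.
move=> t0 cf DY mY; apply/(measurable_wrtP _ (sF t0)).
apply: (@within_continuous_measurable _ (g_sigma_algebraType (F t)) R n Y _ D) => //.
by move=> k; apply/(measurable_wrtP _ (sF t0)).
Qed.

Variable Xt : R -> T -> 'rV[R]_n.
Hypothesis DXt : forall t w, D (Xt t w).
Hypothesis mXt : forall k, measurable_fun setT
  (fun z : measurableTypeR R * T => Xt z.1 z.2 0 k).
Hypothesis XXt : {ae P, forall w, forall t, 0 <= t -> X t w = Xt t w}.

Let mXts t k : measurable_fun setT (fun w => Xt t w 0 k).
Proof.
have mp : measurable_fun setT (fun w : T => ((t : measurableTypeR R), w)).
  by apply/measurable_fun_pair => //; exact: measurable_cst.
exact: (measurableT_comp (mXt k) mp).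
Qed.

Let mcomp (f : 'rV[R]_n -> R) : {within D, continuous f} ->
  measurable_fun setT (fun z : measurableTypeR R * T => f (Xt z.1 z.2)).
Proof. by move=> cf; apply: (within_continuous_measurable mXt cf) => z. Qed.

Let H m k s w := patch (fun=> 0) D (b m k) (X s w).
Let Ht m k s w := b m k (Xt s w).

Let mH m k s : 0 <= s -> measurable_fun setT (H m k s).
Proof.
move=> s0; have -> : H m k s =
    (fun w => if `[< D (X s w) >] then b m k (clip s w) else 0).
  apply/funext => w; rewrite /H /patch /clip.
  have -> : (X s w \in D) = `[< D (X s w) >] by [].
  by case: ifP.
apply: cube_if_measurable => //; first by move=> j; exact: mX.
apply: (@within_continuous_measurable _ T R n (clip s) _ D _ (@cb m k)).
  move=> j; apply: (measurable_wrt_fun (Fm s0)); exact: clip_adapted.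
exact: clip_cube.
Qed.

Let HHt m k s : 0 <= s -> {ae P, forall w, H m k s w = Ht m k s w}.
Proof.
move=> s0; apply: filterS XXt => w h; rewrite /H /Ht h//.
by rewrite patchT//; exact/mem_set.
Qed.

Let HK m k s w : `|H m k s w| <= K.
Proof.
rewrite /H /patch; case: ifPn => [|_]; last by rewrite normr0.
by rewrite inE => /bK.
Qed.

Let mHt m k : measurable_fun setT
  (fun z : measurableTypeR R * T => Ht m k z.1 z.2).
Proof. exact: mcomp. Qed.

Section increment.
Variables (u v : R).
Hypotheses (u0 : 0 <= u) (uv : u <= v).

Let v0 : 0 <= v. Proof. exact: le_trans uv. Qed.

Let J k w := \int[mu]_(s in `]u, v]) a k (Xt s w).

Let J_drift k w t : 0 <= t ->
  (forall s, 0 <= s -> X s w = Xt s w) ->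
  \int[mu]_(s in `[0, t]) patch (fun=> 0) D (a k) (X s w) =
  \int[mu]_(s in `[0, t]) a k (Xt s w).
Proof.
move=> t0 h; apply: eq_Rintegral => s; rewrite inE/= in_itv/= => /andP[s0 _].
by rewrite h// patchT//; exact/mem_set.
Qed.

Let J_int k w : mu.-integrable `[0, v] (EFin \o (fun s => a k (Xt s w))).
Proof.
apply: measurable_bounded_integrable => //.
- by rewrite /= lebesgue_measure_itv/=; case: ifP => _; rewrite ltry.
- have mp : measurable_fun setT (fun s : measurableTypeR R => (s, w)).
    by apply/measurable_fun_pair => //; exact: measurable_cst.
  by apply: measurable_funTS; exact: (measurableT_comp (mcomp (@ca k)) mp).
- exists K; split; rewrite ?num_real// => x cx s _.
  exact: (le_trans (aK k (DXt s w)) (ltW cx)).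
Qed.

(** [clip] on the left, since errors have to be F_u-measurable; [Xt] inside the time integral, since
    Fubini needs joint measurability. *)
Let increment_ae k : exists Iu Iv : 'I_M -> T -> R,
  [/\ forall m, is_ito_integral P F (fun s w => B s w 0 m) (H m k) u (Iu m),
      forall m, is_ito_integral P F (fun s w => B s w 0 m) (H m k) v (Iv m) &
      {ae P, forall w, clip v w 0 k - clip u w 0 k =
         J k w + \sum_m (Iv m w - Iu m w)}].
Proof.
have [_ _ _ hI] := hX.
have [Iu [hIu eu]] := hI u u0 k; have [Iv [hIv ev]] := hI v v0 k.
exists Iu, Iv; split=> //.
apply: filterS3 eu ev (filterI XXt clip_ae) => w eu ev [xt cl].
rewrite -!cl// eu ev !J_drift// sumrB.
have -> : J k w = \int[mu]_(s in `[0, v]) a k (Xt s w) -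
                  \int[mu]_(s in `[0, u]) a k (Xt s w).
  by rewrite Rintegral_itvB//; rewrite bnd_simp.
ring.
Qed.

Let Ibnd k m Iu Iv G kappa :
  is_ito_integral P F (fun s w => B s w 0 m) (H m k) u Iu ->
  is_ito_integral P F (fun s w => B s w 0 m) (H m k) v Iv ->
  bounded_wrt (F u) G -> 0 <= kappa ->
  (forall s, u < s <= v -> mean P (fun w => (Ht m k s w - G w) ^+ 2) <= kappa) ->
  mean P (fun w => ((Iv w - Iu w) - G w * (B v w 0 m - B u w 0 m)) ^+ 2) <=
  4 * kappa * (v - u).
Proof.
move=> hIu hIv bG k0 hk.
apply: (ito_integral_bound hF hB (mHt m k) (mH m k) (HHt m k) (HK m k) u0 uv
  hIu hIv bG k0) => s /[dup] /hk + /andP[us sv].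
have s0 : 0 <= s by rewrite ltW// (le_lt_trans u0).
have mG : measurable_fun setT G by case: bG => mG _; exact: measurable_wrt_fun (Fm u0) mG.
congr (_ <= _); apply: mean_ae.
- apply: measurable_funX; apply: measurable_funB => //.
  exact: (within_continuous_measurable (mXts s) (@cb m k) (DXt s)).
- by apply: measurable_funX; apply: measurable_funB => //; exact: mH.
- by apply: filterS (HHt m k s0) => w ->.
Qed.

(** The drift contributes at most (v - u)^2 K^2 by [time_integral_sqr], and each of the M Ito
    integrals at most 4 K^2 (v - u), by [ito_integral_bound] with G = 0 and kappa = K^2. *)
Lemma clip_increment_sqr k T0 : v - u <= T0 ->
  mean P (fun w => (clip v w 0 k - clip u w 0 k) ^+ 2) <=
  (2 * T0 * K ^+ 2 + 8 * M%:R * M%:R * K ^+ 2) * (v - u).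
Proof.
move=> vuT; have [Iu [Iv [hIu hIv e]]] := increment_ae k.
have vu0 : 0 <= v - u by rewrite subr_ge0.
have si m : sqint P (fun w => Iv m w - Iu m w).
  exact: (ito_integral_sqint hF hB u0 uv (hIu m) (hIv m)).
have gC s w : `|a k (Xt s w)| <= K by exact: aK.
have Ji := time_integral_sqint (g := fun s w => a k (Xt s w)) P (mcomp (@ca k)) gC uv.
have mcl t j : 0 <= t -> measurable_fun setT (fun w => clip t w 0 j).
  by move=> t0; apply: (measurable_wrt_fun (Fm t0)); exact: clip_adapted.
have -> : mean P (fun w => (clip v w 0 k - clip u w 0 k) ^+ 2) =
   mean P (fun w => (J k w + \sum_m (Iv m w - Iu m w)) ^+ 2).
  apply: mean_ae.
  - by apply: measurable_funX; apply: measurable_funB; exact: mcl.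
  - apply: measurable_funX; apply: measurable_funD; first by case: Ji.
    by case: (sqint_sum (index_enum _) si).
  - by apply: filterS e => w ->.
have Is := sqint_sum (index_enum 'I_M) si.
apply: (le_trans (mean_sqrD Ji Is)).
have h1 : mean P (fun w => J k w ^+ 2) <= (v - u) ^+ 2 * K ^+ 2.
  apply: (time_integral_sqr (P := P) (g := fun s w => a k (Xt s w)) (mcomp (@ca k)) gC uv) => s _.
  rewrite -[leRHS](mean_cst P); apply: mean_le.
  - apply: (intg_bounded P (K := K ^+ 2)).
      apply: measurable_funX.
      exact: (within_continuous_measurable (mXts s) (@ca k) (DXt s)).
    by move=> w; rewrite normrX lerXn2r ?nnegrE.
  - exact: intg_cst.
  - by move=> w; rewrite -(real_normK (num_real (a k (Xt s w)))) lerXn2r ?nnegrE.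
have h2 : mean P (fun w => (\sum_m (Iv m w - Iu m w)) ^+ 2) <=
    M%:R * \sum_(m < M) (4 * K ^+ 2 * (v - u)).
  apply: (@le_trans _ _ (mean P (fun w => M%:R * \sum_m (Iv m w - Iu m w) ^+ 2))).
    apply: mean_le.
    - exact: sqint_sqr.
    - by apply/intgZ/intg_sum => m; exact: sqint_sqr.
    - by move=> w; exact: sqr_sum_le.
  rewrite meanZ; last by apply: intg_sum => m; exact: sqint_sqr.
  rewrite ler_wpM2l// mean_sum; last by move=> m; exact: sqint_sqr.
  apply: ler_sum => m _.
  have bG0 : bounded_wrt (F u) (cst 0 : T -> R).
    split; first by apply: measurable_wrt_cst; exact: sF.
    by exists 0 => w; rewrite normr0.
  have := Ibnd (hIu m) (hIv m) bG0 (sqr_ge0 K).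
  under eq_fun do rewrite mul0r subr0.
  apply=> s _.
  rewrite -[leRHS](mean_cst P); apply: mean_le.
  - apply: (intg_bounded P (K := K ^+ 2)).
      apply: measurable_funX; apply: measurable_funB => //.
      exact: (within_continuous_measurable (mXts s) (@cb m k) (DXt s)).
    by move=> w; rewrite subr0 normrX lerXn2r ?nnegrE// bK.
  - exact: intg_cst.
  - move=> w; rewrite subr0 -(real_normK (num_real (Ht m k s w))) lerXn2r ?nnegrE//.
    exact: bK.
move: h2; rewrite sumr_const card_ord -[X in _ * X]mulr_natl => h2.
have h3 : (v - u) ^+ 2 * K ^+ 2 <= T0 * K ^+ 2 * (v - u).
  rewrite -[leRHS]mulrA (_ : _ * K ^+ 2 = (v - u) * (K ^+ 2 * (v - u))); last by ring.
  by rewrite ler_wpM2r// mulr_ge0// sqr_ge0.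
lra.
Qed.

(** Y stands for the scheme value at time u: the Euler terms are those of the scheme, and [mse] is
    the price for not expanding at the solution itself. [Dr] is the time integral of a (X_s) - a (Y)
    and [W] the sum of the Ito integrals of b^m (X_s) - b^m (Y); [kappa] bounds the mean squares of
    both integrands. *)
Lemma clip_increment_euler (Y : T -> 'rV[R]_n) (C2 : R) k : 0 <= C2 ->
  (forall w, D (Y w)) ->
  (forall j, measurable_wrt (F u) (fun w => Y w 0 j)) ->
  (forall s, u <= s -> s <= v ->
    mean P (fun w => sqdist (clip s w) (clip u w)) <= C2 * (s - u)) ->
  let mse := mean P (fun w => sqdist (clip u w) (Y w)) in
  let kappa := 2 * L * (C2 * (v - u) + mse) in
  exists Dr W : T -> R,
  [/\ sqint P Dr /\ sqint P W,
      {ae P, forall w, clip v w 0 k - clip u w 0 k =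
         a k (Y w) * (v - u) +
         \sum_m b m k (Y w) * (B v w 0 m - B u w 0 m) + Dr w + W w},
      mean P (fun w => Dr w ^+ 2) <= (v - u) ^+ 2 * kappa,
      forall Z, bounded_wrt (F u) Z -> mean P (fun w => Z w * W w) = 0 &
      mean P (fun w => W w ^+ 2) <= M%:R * M%:R * (4 * kappa * (v - u))].
Proof.
move=> C20 DY mYF hC2 mse kappa.
have [Iu [Iv [hIu hIv e]]] := increment_ae k.
have vu0 : 0 <= v - u by rewrite subr_ge0.
have mY j : measurable_fun setT (fun w => Y w 0 j).
  exact: (measurable_wrt_fun (Fm u0) (mYF j)).
have mcl t j : 0 <= t -> measurable_fun setT (fun w => clip t w 0 j).
  by move=> t0; apply: (measurable_wrt_fun (Fm t0)); exact: clip_adapted.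
have D1 x j : D x -> `|x 0 j| <= 1 by move=> h; rewrite ler_norml; exact: h.
have sqd_int (Y1 Y2 : T -> 'rV[R]_n) : (forall w, D (Y1 w)) ->
    (forall w, D (Y2 w)) ->
    (forall j, measurable_fun setT (fun w => Y1 w 0 j)) ->
    (forall j, measurable_fun setT (fun w => Y2 w 0 j)) ->
    intg P (fun w => sqdist (Y1 w) (Y2 w)).
  move=> DY1 DY2 mY1 mY2; apply: intg_sum => j; apply: sqint_sqr.
  by apply: sqintB; apply: (sqint_bounded P (K := 1)) => // w; exact: D1.
have mse0 : 0 <= mse by apply: mean_ge0 => w; exact: sqdist_ge0.
have kappa0 : 0 <= kappa.
  by rewrite /kappa mulr_ge0 ?addr_ge0 ?mulr_ge0.
have mclF t j : 0 <= t -> measurable_fun setT (fun w => clip t w 0 j) by exact: mcl.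
(* Lipschitz continuity, then the triangle inequality through the solution at u: [hC2] bounds the
   motion since u, and the rest is [mse]. It serves for the drift and for each diffusion
   coefficient. *)
have lip (f : 'rV[R]_n -> R) : {within D, continuous f} ->
    (forall x, D x -> `|f x| <= K) ->
    (forall x y, D x -> D y -> (f x - f y) ^+ 2 <= L * sqdist x y) ->
    forall s, u < s <= v ->
    mean P (fun w => (f (Xt s w) - f (Y w)) ^+ 2) <= kappa.
  move=> cf fK fL s /andP[us sv].
  have s0 : 0 <= s by rewrite ltW// (le_lt_trans u0).
  have mf Y1 : (forall w, D (Y1 w)) ->
      (forall j, measurable_fun setT (fun w => Y1 w 0 j)) ->
      sqint P (fun w => f (Y1 w)).
    move=> DY1 mY1; apply: (sqint_bounded P (K := K)); last by move=> w; exact: fK.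
    exact: (within_continuous_measurable mY1 cf DY1).
  have -> : mean P (fun w => (f (Xt s w) - f (Y w)) ^+ 2) =
            mean P (fun w => (f (clip s w) - f (Y w)) ^+ 2).
    apply: mean_ae.
    - by have [] := sqint_sqr (sqintB (mf _ (DXt s) (mXts s)) (mf _ DY mY)) => /intg_meas.
    - by have [] := sqint_sqr (sqintB (mf _ (clip_cube s) (mcl s ^~ s0)) (mf _ DY mY)) => /intg_meas.
    - by apply: filterS2 XXt clip_ae => w <-// <-.
  apply: (@le_trans _ _ (mean P (fun w => 2 * L * (sqdist (clip s w) (clip u w) +
       sqdist (clip u w) (Y w))))).
    apply: mean_le.
    - by apply/sqint_sqr/sqintB; apply: mf => //; [exact: clip_cube|move=> j; exact: mcl].
    - by apply: intgZ; apply: intgD; apply: sqd_int => //; try exact: clip_cube;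
        move=> j; exact: mcl.
    - move=> w; apply: (le_trans (fL _ _ (clip_cube _ _) (DY w))).
      rewrite (mulrC 2) -mulrA ler_wpM2l// mulrDr.
      exact: sqdist_triangle.
  rewrite meanZ; last first.
    by apply: intgD; apply: sqd_int => //; try exact: clip_cube;
        move=> j; exact: mcl.
  rewrite ler_wpM2l// ?mulr_ge0//.
  rewrite meanD; try by apply: sqd_int => //; try exact: clip_cube;
        move=> j; exact: mcl.
  rewrite lerD2r; apply: (le_trans (hC2 s (ltW us) sv)).
  by rewrite ler_wpM2l// lerD2r.
pose g s w := a k (Xt s w) - a k (Y w).
have mg : measurable_fun setT (fun z : measurableTypeR R * T => g z.1 z.2).
  apply: measurable_funB; first exact: mcomp.
  have maY := within_continuous_measurable mY (@ca k) DY.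
  exact: (measurableT_comp maY measurable_snd).
have gC s w : `|g s w| <= K + K.
  by rewrite (le_trans (ler_normB _ _))// lerD//; exact: aK.
pose Dr w := \int[mu]_(s in `]u, v]) g s w.
have bG m : bounded_wrt (F u) (fun w => b m k (Y w)).
  split; last by exists K => w; exact: bK.
  exact: (compF u0 (@cb m k) DY mYF).
pose W w := \sum_m ((Iv m w - Iu m w) -
   b m k (Y w) * (B v w 0 m - B u w 0 m)).
have si m : sqint P (fun w => Iv m w - Iu m w).
  exact: (ito_integral_sqint hF hB u0 uv (hIu m) (hIv m)).
have sG m : sqint P (fun w => b m k (Y w) * (B v w 0 m - B u w 0 m)).
  have [mG [KG GK]] := bG m; apply: (sqint_Mbounded _ GK).
    exact: (measurable_wrt_fun (Fm u0) mG).
  exact: (db_sqint hF hB m u0 uv).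
have sd m := sqintB (si m) (sG m).
exists Dr, W; split.
- split; first exact: (time_integral_sqint P mg gC uv).
  exact: sqint_sum.
- apply: filterS e => w ->.
  have -> : J k w = Dr w + a k (Y w) * (v - u).
    have i1 : mu.-integrable `]u, v] (EFin \o (fun s => a k (Xt s w))).
      apply: integrableS (J_int k w) => //.
      move=> s /=; rewrite !in_itv/= => /andP[us ->]; rewrite andbT.
      by rewrite ltW// (le_lt_trans u0).
    have gi := time_integrable mg gC uv w.
    have l1 : fine (mu `]u, v]%classic) = v - u.
      rewrite lebesgue_measure_itv/= lte_fin; case: ltP => //= vu.
      by apply/eqP; rewrite eq_sym subr_eq0 eq_le vu uv.
    have ci : mu.-integrable `]u, v] (EFin \o cst (a k (Y w))).
      apply: measurable_bounded_integrable => //.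
      - by rewrite /= lebesgue_measure_itv/=; case: ifP => _; rewrite ltry.
      - exists `|a k (Y w)|; split; rewrite ?num_real// => x cx s _.
        exact: ltW.
    have -> : J k w = \int[mu]_(s in `]u, v]) (g s w + cst (a k (Y w)) s).
      by apply: eq_Rintegral => s _; rewrite /g /= subrK.
    by rewrite RintegralD// Rintegral_cst//= [fine _]l1.
  have -> : W w = \sum_m (Iv m w - Iu m w) -
      \sum_m b m k (Y w) * (B v w 0 m - B u w 0 m) by rewrite -sumrB.
  ring.
- exact: (time_integral_sqr (P := P) mg gC uv (lip _ (@ca k) (@aK k) (@aL k))).
- move=> Z bZ; have Zi := bounded_wrt_sqint P (Fm u0) bZ.
  have -> : (fun w => Z w * W w) = (fun w => \sum_m (Z w * (Iv m w - Iu m w) -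
      Z w * (b m k (Y w) * (B v w 0 m - B u w 0 m)))).
    by apply/funext => w; rewrite /W mulr_sumr; apply: eq_bigr => m _; ring.
  rewrite mean_sum; last by move=> m; apply: intgB; exact: sqintM.
  rewrite big1// => m _; rewrite meanB; try exact: sqintM.
  rewrite (ito_integral_ortho hF hB (mHt m k) (mH m k) (HHt m k) (HK m k) u0 uv
    (hIu m) (hIv m) bZ) sub0r.
  have bZG : bounded_wrt (F u) (fun w => Z w * b m k (Y w)).
    by apply: bounded_wrtM => //; exact: sF.
  under eq_fun do rewrite mulrA.
  move: uv; rewrite le_eqVlt => /predU1P[<-|uv'].
    by under eq_fun do rewrite subrr mulr0; rewrite mean_cst oppr0.
  have [] := bm_ortho hF hB u0 uv' m bZG.1 (sqint_intg (bounded_wrt_sqint P (Fm u0) bZG)).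
  by under eq_fun do rewrite !mxE; move=> _ ->; rewrite oppr0.
- apply: (@le_trans _ _ (mean P (fun w => M%:R * \sum_m ((Iv m w - Iu m w) -
      b m k (Y w) * (B v w 0 m - B u w 0 m)) ^+ 2))).
    apply: mean_le.
    - by apply: sqint_sqr; exact: sqint_sum.
    - by apply/intgZ/intg_sum => m; exact: sqint_sqr.
    - by move=> w; exact: sqr_sum_le.
  rewrite meanZ; last by apply: intg_sum => m; exact: sqint_sqr.
  rewrite -mulrA ler_wpM2l// mean_sum; last by move=> m; exact: sqint_sqr.
  apply: (@le_trans _ _ (\sum_(m < M) (4 * kappa * (v - u)))).
    apply: ler_sum => m _.
    exact: (Ibnd (hIu m) (hIv m) (bG m) kappa0 (lip _ (@cb m k) (@bK m k) (@bL m k))).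
  by rewrite sumr_const card_ord -[X in X <= _]mulr_natl.
Qed.

End increment.

(** The initial condition is contained in the integral equation at time 0, where the Ito integrals
    vanish only in mean square. *)
Lemma clip_initial k : mean P (fun w => (clip 0 w 0 k - x0 0 k) ^+ 2) = 0.
Proof.
have [_ _ _ hI] := hX; have [I [hI0 e]] := hI 0 (lexx 0) k.
have I0 m := ito_integral_at0 hF hB (hI0 m).
apply/eqP; rewrite eq_le [X in _ && X]mean_ge0 ?andbT; last first.
  by move=> w; exact: sqr_ge0.
have si m : sqint P (I m) by case: (I0 m).
have Is := sqint_sum (index_enum 'I_M) si.
have -> : mean P (fun w => (clip 0 w 0 k - x0 0 k) ^+ 2) =
    mean P (fun w => (\sum_m I m w) ^+ 2).
  apply: mean_ae.
  - apply: measurable_funX; apply: measurable_funB => //.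
    by apply: (measurable_wrt_fun (Fm (lexx 0))); exact: clip_adapted.
  - by apply: measurable_funX; case: Is.
  - apply: filterS2 e clip_ae => w ew <-//.
    by rewrite ew set_itv1 Rintegral_set1 addr0 addrC addKr.
apply: (@le_trans _ _ (mean P (fun w => M%:R * \sum_m I m w ^+ 2))).
  apply: mean_le.
  - exact: sqint_sqr.
  - by apply/intgZ/intg_sum => m; exact: sqint_sqr.
  - by move=> w; exact: sqr_sum_le.
rewrite meanZ; last by apply: intg_sum => m; exact: sqint_sqr.
rewrite mean_sum; last by move=> m; exact: sqint_sqr.
by rewrite big1 ?mulr0// => m _; case: (I0 m).
Qed.

End sde_increments.

(** * Taylor expansions and bounds on the cube *)

Section one_variable.
Context {R : realType}.
Implicit Types phi psi : R -> R.

(** The hypotheses of the mean value theorem: continuity up to the end points, derivative inside.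
    This accommodates s = 0, where the derivatives of Phi in s are one-sided. *)
Definition deriv_on (al be : R) phi psi : Prop :=
  {within `[al, be], continuous phi} /\
  forall t, t \in `]al, be[ -> is_derive t 1 phi (psi t).

Lemma deriv_on_sub al be al' be' phi psi : al <= al' -> be' <= be ->
  deriv_on al be phi psi -> deriv_on al' be' phi psi.
Proof.
move=> aa bb [cphi dphi]; split.
  apply: continuous_subspaceW cphi => t /=; rewrite !in_itv/= => /andP[h1 h2].
  by rewrite (le_trans aa)// (le_trans h2).
move=> t; rewrite in_itv/= => /andP[h1 h2]; apply: dphi; rewrite in_itv/=.
by rewrite (le_lt_trans aa)// (lt_le_trans h2).
Qed.

(** The bound on psi is asked only for |r| <= |t|, so that an estimate in powers of |r| can be fed
    back in and the lemma iterated. *)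
Lemma deriv_on_le al be phi psi K t : deriv_on al be phi psi ->
  al <= 0 <= be -> al <= t <= be ->
  (forall r, al <= r <= be -> `|r| <= `|t| -> `|psi r| <= K) ->
  `|phi t - phi 0| <= K * `|t|.
Proof.
move=> dphi /andP[al0 be0] /andP[alt tbe] hK.
have [t0|/ltW t0] := leP 0 t.
- have [c0 d0] := deriv_on_sub al0 tbe dphi.
  have [c] := MVT_segment t0 d0 c0; rewrite in_itv/= => /andP[cl cr] ->.
  rewrite subr0 normrM ler_wpM2r// hK//; first by rewrite (le_trans al0)// (le_trans cr).
  by rewrite !ger0_norm.
- have [c0 d0] := deriv_on_sub alt be0 dphi.
  have [c] := MVT_segment t0 d0 c0; rewrite in_itv/= => /andP[cl cr] e.
  rewrite distrC e sub0r normrM normrN ler_wpM2r// hK//.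
    by rewrite (le_trans alt)// (le_trans cr).
  by rewrite !ler0_norm// lerN2.
Qed.

Lemma deriv_onB al be phi psi (c0 c1 c2 : R) : deriv_on al be phi psi ->
  deriv_on al be (fun t => phi t - (c0 + c1 * t + c2 * t ^+ 2))
                 (fun t => psi t - (c1 + 2 * c2 * t)).
Proof.
move=> [cphi dphi].
pose p : R -> R := fun t => c0 + c1 * t + c2 * t ^+ 2.
have dp (t : R) : is_derive t (1 : R) p (c1 + 2 * c2 * t).
  have -> : p = cst c0 + (c1 \*: (id : R -> R)) + (c2 \*: ((id : R -> R) ^+ 2)).
    by apply/funext.
  by apply: is_derive_eq; rewrite /GRing.scale/=; ring.
have cp : continuous p.
  by move=> t; apply/differentiable_continuous/derivable1_diffP; case: (dp t).
split; last first.
  move=> t h; have := dphi t h => dt; exact: is_deriveB.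
have cps : {within `[al, be], continuous p} by exact: continuous_subspaceT.
by move=> x; apply: (@cvgB _ R^o); [exact: cphi|exact: cps].
Qed.

(** [deriv_on_le] applied to the remainder, whose derivative is the remainder of order one less. The
    factorials are given up here and in [taylor3]. *)
Lemma taylor2 al be (phi psi xi : R -> R) K t :
  deriv_on al be phi psi -> deriv_on al be psi xi ->
  al <= 0 <= be -> al <= t <= be -> 0 <= K ->
  (forall r, al <= r <= be -> `|xi r| <= K) ->
  `|phi t - (phi 0 + psi 0 * t)| <= K * `|t| ^+ 2.
Proof.
move=> d1 d2 ab0 abt K0 hK.
have h := deriv_onB 0 (psi 0) 0 d1.
have -> : phi t - (phi 0 + psi 0 * t) =
    phi t - (0 + psi 0 * t + 0 * t ^+ 2) - (phi 0 - (0 + psi 0 * 0 + 0 * 0 ^+ 2)).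
  by ring.
have -> : K * `|t| ^+ 2 = K * `|t| * `|t| by ring.
apply: (deriv_on_le h ab0 abt) => r abr rt.
have -> : psi r - (psi 0 + 2 * 0 * r) = psi r - psi 0 by ring.
apply: (@le_trans _ _ (K * `|r|)); last by rewrite ler_wpM2l.
by apply: (deriv_on_le d2) => // r' abr' _; exact: hK.
Qed.

Lemma taylor3 al be (phi psi xi zeta : R -> R) K t :
  deriv_on al be phi psi -> deriv_on al be psi xi -> deriv_on al be xi zeta ->
  al <= 0 <= be -> al <= t <= be -> 0 <= K ->
  (forall r, al <= r <= be -> `|zeta r| <= K) ->
  `|phi t - (phi 0 + psi 0 * t + 2^-1 * xi 0 * t ^+ 2)| <= K * `|t| ^+ 3.
Proof.
move=> d1 d2 d3 ab0 abt K0 hK.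
have h := deriv_onB (phi 0) (psi 0) (2^-1 * xi 0) d1.
have -> : phi t - (phi 0 + psi 0 * t + 2^-1 * xi 0 * t ^+ 2) =
    phi t - (phi 0 + psi 0 * t + 2^-1 * xi 0 * t ^+ 2) -
    (phi 0 - (phi 0 + psi 0 * 0 + 2^-1 * xi 0 * 0 ^+ 2)).
  by ring.
have -> : K * `|t| ^+ 3 = K * `|t| ^+ 2 * `|t| by ring.
apply: (deriv_on_le h ab0 abt) => r abr rt.
have -> : psi r - (psi 0 + 2 * (2^-1 * xi 0) * r) = psi r - (psi 0 + xi 0 * r).
  by field.
apply: (le_trans (taylor2 d2 d3 ab0 abr K0 hK)).
by rewrite ler_wpM2l// lerXn2r ?nnegrE.
Qed.

End one_variable.

Section axis_derivative.
Context {R : realType} {n : nat}.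
Implicit Types (D : set 'rV[R]_n) (f : 'rV[R]_n -> R) (x : 'rV[R]_n) (i : 'I_n).

(** Strictly inside the segment all small increments stay in D, so the limit within D defining
    [pderive] is the ordinary two-sided one. *)
Lemma pderive_deriv_on D f i x (al be : R) :
  {within D, continuous f} -> (forall y, D y -> pderivable D f i y) ->
  (forall t, al <= t <= be -> D (x + t *: 'e_i)) ->
  deriv_on al be (fun t => f (x + t *: 'e_i))
                 (fun t => pderive D i f (x + t *: 'e_i)).
Proof.
move=> cf df hD; split.
  have /subspace_continuousP cf' := cf.
  apply/subspace_continuousP => t /=; rewrite in_itv/= => abt.
  apply: (cvg_comp (fun t => x + t *: 'e_i) f _ (cf' _ (hD t abt))).
  have cl : (x + s *: 'e_i) @[s --> t] --> x + t *: 'e_i.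
    by apply: cvgD; [exact: cvg_cst|apply: cvgZr_tmp; exact: cvg_id].
  move=> A /= /cl; rewrite /= !nbhs_simpl/=; apply: filterS => s h /= abs.
  by apply: h; apply: hD; move: abs; rewrite in_itv.
move=> t; rewrite in_itv/= => /andP[alt tbe].
have Dt : D (x + t *: 'e_i) by apply: hD; rewrite !ltW.
have near0 : \forall h \near (0 : R)^', pdom D i (x + t *: 'e_i) h.
  apply: (@cvg_within _ (nbhs (0 : R))).
  have e0 : 0 < Num.min (t - al) (be - t) by rewrite lt_min !subr_gt0 alt.
  have := nbhsx_ballx (0 : R) _ e0; apply: filterS => h.
  rewrite /ball/= sub0r normrN lt_min ltr_norml ltr_norml => /andP[h1 h2].
  rewrite /pdom/= -addrA -scalerDl; apply: hD; lra.
have withinE : within (pdom D i (x + t *: 'e_i)) (0 : R)^' = (0 : R)^'.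
  apply/seteqP; split=> A; rewrite /within/=.
    by move=> h; apply: filterS2 near0 h => h0 h1; exact.
  by apply: filterS.
have quotE : (fun h : R => h^-1 *: (((fun t => f (x + t *: 'e_i)) \o shift t) (h *: (1 : R)) -
    f (x + t *: 'e_i))) = pquot f i (x + t *: 'e_i).
  apply/funext => h; rewrite /pquot /= /GRing.scale/= mulr1.
  by rewrite -addrA -scalerDl [h + t]addrC.
split.
- have := df _ Dt; rewrite /pderivable withinE -quotE; exact.
- by rewrite /derive quotE /pderive withinE.
Qed.

End axis_derivative.

(** * Boundedness and Lipschitz continuity on the cube *)

Section compact_bounds.
Context {R : realType}.

Lemma compact_within_bounded (n : nat) (D A : set 'rV[R]_n) (f : 'rV[R]_n -> R) :
  {within D, continuous f} -> A `<=` D -> compact A ->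
  exists2 K : R, 0 <= K & forall x, A x -> `|f x| <= K.
Proof.
move=> cf AD cA; have cf' := continuous_subspaceW AD cf.
have [K [_ hK]] := compact_bounded (continuous_compact cf' cA).
exists (Num.max 0 K + 1) => [|x Ax].
  by rewrite addr_ge0// le_max lexx.
apply: (hK (Num.max 0 K + 1)); last by exists x.
by rewrite ltr_pwDr// le_max lexx orbT.
Qed.

Lemma cube_compact (n : nat) : compact (cube R n).
Proof.
have := @rV_compact _ n (fun=> `[-1 : R, 1]%classic) (fun=> @segment_compact R _ _).
by congr compact; apply/seteqP; split=> x /= h k; have := h k; rewrite in_itv.
Qed.

Lemma finite_bound (I : finType) (Q : I -> R -> Prop) :
  (forall i K K', K <= K' -> Q i K -> Q i K') ->
  (forall i, exists2 K : R, 0 <= K & Q i K) ->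
  exists2 K : R, 0 <= K & forall i, Q i K.
Proof.
move=> mono h.
have /choice[K hK'] : forall i, exists K : R, 0 <= K /\ Q i K.
  by move=> i; have [K K0 hK] := h i; exists K.
have K0 i : 0 <= K i by case: (hK' i).
have hK i : Q i (K i) by case: (hK' i).
exists (\sum_i K i); first exact: sumr_ge0.
move=> i; apply: mono (hK i); rewrite (bigD1 i)//= lerDl.
exact: sumr_ge0.
Qed.

End compact_bounds.

Section cube_lipschitz.
Context {R : realType} {n : nat}.
Local Notation D := (cube R n).
Implicit Types f : 'rV[R]_n -> R.

(** The l^1 distance is what moving along one axis at a time produces; [lipschitz_on_cube_sqr]
    passes to [sqdist]. The bound on f is carried along because products use it. *)
Definition lipschitz_on_cube f : Prop :=
  [/\ {within D, continuous f},
      (exists2 K : R, 0 <= K & forall x, D x -> `|f x| <= K) &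
      exists2 L : R, 0 <= L & forall x y, D x -> D y ->
        `|f x - f y| <= L * \sum_j `|x 0 j - y 0 j|].

Lemma lipschitz_on_cubeD f g : lipschitz_on_cube f -> lipschitz_on_cube g ->
  lipschitz_on_cube (fun x => f x + g x).
Proof.
move=> [cf [K K0 fK] [L L0 fL]] [cg [K' K'0 gK] [L' L'0 gL]]; split.
- by move=> x; apply: (@cvgD _ R^o); [exact: cf|exact: cg].
- exists (K + K'); first exact: addr_ge0.
  by move=> x Dx; rewrite (le_trans (ler_normD _ _))// lerD ?fK ?gK.
- exists (L + L'); first exact: addr_ge0.
  move=> x y Dx Dy; rewrite opprD addrACA (le_trans (ler_normD _ _))//.
  by rewrite mulrDl lerD ?fL ?gL.
Qed.

Lemma lipschitz_on_cubeM f g : lipschitz_on_cube f -> lipschitz_on_cube g ->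
  lipschitz_on_cube (fun x => f x * g x).
Proof.
move=> [cf [K K0 fK] [L L0 fL]] [cg [K' K'0 gK] [L' L'0 gL]]; split.
- by move=> x; apply: (@cvgM R); [exact: cf|exact: cg].
- exists (K * K'); first exact: mulr_ge0.
  by move=> x Dx; rewrite normrM ler_pM ?fK ?gK.
- exists (K * L' + K' * L); first by rewrite addr_ge0 ?mulr_ge0.
  move=> x y Dx Dy.
  have -> : f x * g x - f y * g y = f x * (g x - g y) + g y * (f x - f y) by ring.
  rewrite (le_trans (ler_normD _ _))// mulrDl -!mulrA !normrM.
  apply: lerD; apply: ler_pM => //.
  - exact: fK.
  - exact: gL.
  - exact: gK.
  - exact: fL.
Qed.

Lemma lipschitz_on_cube_cst c : lipschitz_on_cube (cst c).
Proof.
split.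
- by apply: continuous_subspaceT; exact: cst_continuous.
- by exists `|c|.
- by exists 0 => // x y _ _; rewrite subrr normr0 mul0r.
Qed.

Lemma lipschitz_on_cube_sum (I : Type) (s : seq I) (f : I -> 'rV[R]_n -> R) :
  (forall i, lipschitz_on_cube (f i)) ->
  lipschitz_on_cube (fun x => \sum_(i <- s) f i x).
Proof.
move=> hf; elim: s => [|i s ih].
  by under eq_fun do rewrite big_nil; exact: lipschitz_on_cube_cst.
by under eq_fun do rewrite big_cons; exact: lipschitz_on_cubeD.
Qed.

(** Go from x to y changing one coordinate at a time. The cube is a product, so each segment stays
    in it, and the partial derivatives are bounded by compactness. *)
Lemma classC_lipschitz p f : classC D p.+1 f -> lipschitz_on_cube f.
Proof.
move=> [cf df].
have dC i x : D x -> pderivable D f i x by case: (df i) => h _; exact: h.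
have [K K0 fK] : exists2 K : R, 0 <= K &
    forall i x, D x -> `|pderive D i f x| <= K.
  apply: (@finite_bound R 'I_n (fun i K => forall x, D x -> `|pderive D i f x| <= K)).
    by move=> i K K' KK' h x Dx; exact: le_trans (h x Dx) KK'.
  move=> i; have cdf : {within D, continuous (pderive D i f)}.
    by case: (df i) => _; case: p {df} => [|p] [].
  exact: (compact_within_bounded cdf (@subset_refl _ _) (@cube_compact R n)).
split=> //; first exact: (compact_within_bounded cf (@subset_refl _ _) (@cube_compact R n)).
exists K => // x y Dx Dy.
(* The first k coordinates are already those of y; z goes from x at k = 0 to y at k = n. *)
pose z (k : nat) : 'rV[R]_n := \row_j (if (j < k)%N then y 0 j else x 0 j).
have z0 : z 0%N = x by apply/rowP => j; rewrite mxE.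
have zn : z n = y by apply/rowP => j; rewrite mxE ltn_ord.
rewrite -{1}z0 -{1}zn distrC -(telescope_sumr (fun k => f (z k)))//.
rewrite (le_trans (ler_norm_sum _ _ _))// mulr_sumr big_mkord; apply: ler_sum => j _.
have zS : z j.+1 = z j + (y 0 j - x 0 j) *: 'e_j.
  apply/rowP => k; rewrite !mxE eqxx/= ltnS leq_eqVlt.
  have [/val_inj <-|kj] := eqVneq (k : nat) (j : nat).
    by rewrite eqxx/= ltnn mulr1 addrC subrK.
  by rewrite -val_eqE/= eq_sym (eq_sym (j : nat)) (negbTE kj)/= mulr0 addr0.
have zD (t : R) : Num.min 0 (y 0 j - x 0 j) <= t <= Num.max 0 (y 0 j - x 0 j) ->
    D (z j + t *: 'e_j).
  move=> ht k; rewrite !mxE eqxx/=; have [->|kj] := eqVneq k j; last first.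
    by have := Dx k; have := Dy k; rewrite mulr0 addr0; case: ifP.
  have hx := Dx j; have hy := Dy j; rewrite ltnn mulr1; move: ht.
  by case: (leP 0 (y 0 j - x 0 j)) => h /andP[h1 h2]; lra.
have dphi := pderive_deriv_on (x := z j) (al := Num.min 0 (y 0 j - x 0 j))
  (be := Num.max 0 (y 0 j - x 0 j)) cf (dC j) zD.
have := deriv_on_le dphi (t := y 0 j - x 0 j) (K := K).
rewrite scale0r addr0 -zS (distrC (y 0 j) (x 0 j)); apply.
- by rewrite ge_min le_max !lexx.
- by rewrite ge_min le_max !lexx !orbT.
- by move=> r hr _; apply: fK; exact: zD.
Qed.

Lemma classC_pderive p f i : classC D p.+1 f -> classC D p (pderive D i f).
Proof. by move=> [_ /(_ i)[]]. Qed.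

Lemma lipschitz_on_cube_sqr f : lipschitz_on_cube f ->
  exists2 L : R, 0 <= L & forall x y, D x -> D y ->
    (f x - f y) ^+ 2 <= L * sqdist x y.
Proof.
move=> [_ _ [L L0 fL]]; exists (L ^+ 2 * n%:R).
  by rewrite mulr_ge0 ?sqr_ge0.
move=> x y Dx Dy; rewrite -(real_normK (num_real (f x - f y))).
apply: (@le_trans _ _ ((L * \sum_j `|x 0 j - y 0 j|) ^+ 2)).
  rewrite lerXn2r ?nnegrE ?fL//; last by rewrite mulr_ge0 ?sumr_ge0.
rewrite exprMn -mulrA ler_wpM2l ?sqr_ge0//.
apply: (le_trans (sqr_sum_le _)); rewrite ler_wpM2l//.
by rewrite le_eqVlt; apply/orP; left; apply/eqP; apply: eq_bigr => j _;
  rewrite real_normK ?num_real.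
Qed.

End cube_lipschitz.

(** * Expansion of Phi around (0, 0, y) *)

Section scheme_map.
Context {R : realType}.
Variable Phi : R -> R -> R -> R.
Local Notation D := (domPhi R).
Hypothesis range : forall s gamma y, 0 <= s -> -1 <= y <= 1 ->
  -1 <= Phi s gamma y <= 1.
Hypothesis Phi0 : forall y, -1 <= y <= 1 -> Phi 0 0 y = y.
Hypothesis Phi_gamma : forall y, -1 <= y <= 1 -> dPhi Phi 0 1 0 0 0 y = sigma y.
Hypothesis Phi_s : forall y, -1 <= y <= 1 ->
  dPhi Phi 1 0 0 0 0 y + 2^-1 * dPhi Phi 0 2 0 0 0 y = 0.
Hypothesis Phi_C3 : classC D 3 (unc3 Phi).

Let unc3E s g y : unc3 Phi (pt3 s g y) = Phi s g y.
Proof. by rewrite /unc3 /pt3 !mxE. Qed.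

Let pt3_s (s g y : R) : pt3 0 g y + s *: 'e_ix_s = pt3 s g y.
Proof.
by apply/rowP; case=> [[|[|[|//]]] i]; rewrite !mxE/= ?mulr1 ?mulr0 ?add0r ?addr0.
Qed.

Let pt3_gamma (s g y : R) : pt3 s 0 y + g *: 'e_ix_gamma = pt3 s g y.
Proof.
by apply/rowP; case=> [[|[|[|//]]] i]; rewrite !mxE/= ?mulr1 ?mulr0 ?add0r ?addr0.
Qed.

Let pt3_dom (s g y : R) : 0 <= s -> -1 <= y <= 1 -> D (pt3 s g y).
Proof. by move=> s0 y1; rewrite /domPhi/= !mxE. Qed.

Let classC_cont p (f : 'rV[R]_3 -> R) : classC D p f -> {within D, continuous f}.
Proof. by case: p => [|p] []. Qed.

Let classC_pd p (f : 'rV[R]_3 -> R) i : classC D p.+1 f ->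
  (forall x, D x -> pderivable D f i x) /\ classC D p (pderive D i f).
Proof. by case=> _ /(_ i). Qed.

Let box (S : R) : set 'rV[R]_3 := [set v | forall i, (match nat_of_ord i with
  | 0%N => `[0, S]%classic | _ => `[-1, 1]%classic end) (v 0 i)].

Let box_compact S : compact (box S).
Proof.
apply: (@rV_compact _ 3 (fun i : 'I_3 => match nat_of_ord i with
  | 0%N => `[0, S]%classic | _ => `[-1, 1]%classic end)).
by case=> [[|m] hm]; exact: segment_compact.
Qed.

Let box_pt3 (S s g y : R) : box S (pt3 s g y) <-> [/\ 0 <= s <= S, -1 <= g <= 1 & -1 <= y <= 1].
Proof.
split=> [h|[hs hg hy]].
  have := h ix_s; have := h ix_gamma; have := h ix_y.
  by rewrite !mxE/= !in_itv/= => ? ? ?; split.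
by case=> [[|[|[|//]]] i]; rewrite !mxE/= in_itv.
Qed.

Let box_dom S : box S `<=` D.
Proof.
move=> v h; have := h ix_s; have := h ix_y; rewrite /= !in_itv/=.
by move=> hy /andP[hs _]; split.
Qed.

Let fg := pderive D ix_gamma (unc3 Phi).
Let fgg := pderive D ix_gamma fg.
Let fggg := pderive D ix_gamma fgg.
Let fs := pderive D ix_s (unc3 Phi).
Let fss := pderive D ix_s fs.
Let fsg := pderive D ix_s fg.
Let fsgg := pderive D ix_s fgg.

Let c y := dPhi Phi 0 2 0 0 0 y.

Let sigma_le1 (y : R) : -1 <= y <= 1 -> `|sigma y| <= 1.
Proof. by move=> /andP[h1 h2]; rewrite /sigma ler_norml; nra. Qed.

(* For |g| > 1 the cubic term alone dominates, as Phi takes values in [-1, 1];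
   so the derivatives need only be bounded on a compact box. *)
Lemma Phi_taylor (S : R) : 0 <= S -> exists2 C : R, 0 <= C &
  (forall y, -1 <= y <= 1 -> `|c y| <= C) /\
  forall s g y, 0 <= s <= S -> -1 <= y <= 1 ->
  `|Phi s g y - (y + sigma y * g + 2^-1 * c y * (g ^+ 2 - s))| <=
  C * (`|g| ^+ 3 + s * `|g| + s ^+ 2).
Proof.
move=> S0.
have [d0g C0g] := classC_pd ix_gamma Phi_C3.
have [d0s C0s] := classC_pd ix_s Phi_C3.
have [dgg Cgg] := classC_pd ix_gamma C0g.
have [dgs Cgs] := classC_pd ix_s C0g.
have [dss Css] := classC_pd ix_s C0s.
have [dggg Cggg] := classC_pd ix_gamma Cgg.
have [dggs Cggs] := classC_pd ix_s Cgg.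
have bnd p f : classC D p f -> exists2 K : R, 0 <= K & forall x, box S x -> `|f x| <= K.
  by move=> /classC_cont cf; exact: (compact_within_bounded cf (@box_dom S) (@box_compact S)).
have [K1 K10 h1] := bnd _ _ Cggg; have [K2 K20 h2] := bnd _ _ Css.
have [K3 K30 h3] := bnd _ _ Cgs; have [K4 K40 h4] := bnd _ _ Cggs.
have [K5 K50 h5] := bnd _ _ Cgg.
rewrite -/fg -/fgg -/fggg -/fs -/fss -/fsg -/fsgg in d0g d0s dgg dgs dss dggg dggs h1 h2 h3 h4 h5 C0g C0s Cgg Cgs.
pose K := K1 + K2 + K3 + K4 + K5.
(* K bounds all the derivatives used on the box. The 4 absorbs the terms 2 + |g| of the case |g| >
   1, where 1 and |g| are at most |g|^3. *)
exists (2 * K + 4); first by rewrite /K; lra.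
have cK y : -1 <= y <= 1 -> `|c y| <= K.
  move=> hy; apply: (@le_trans _ _ K5); last by rewrite /K; lra.
  by apply: h5; apply/box_pt3; split; rewrite ?lexx ?lerN10 ?ler01.
split=> [y /cK /le_trans|s g y /andP[s0 sS] hy].
  by apply; rewrite /K; lra.
have cy := cK _ hy.
have sg0 : 0 <= s * `|g| by rewrite mulr_ge0.
have [g1|g1] := leP (`|g|) 1; last first.
  have hP : `|Phi s g y - y| <= 2.
    have := range g s0 hy; move: hy => /andP[? ?] /andP[? ?].
    by rewrite ler_norml; lra.
  have hs : `|sigma y * g| <= `|g|.
    by rewrite normrM -[leRHS]mul1r ler_wpM2r// sigma_le1.
  have hc : `|2^-1 * c y * (g ^+ 2 - s)| <= 2^-1 * K * (`|g| ^+ 2 + s).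
    rewrite normrM; apply: ler_pM => //.
      by rewrite normrM gtr0_norm// ler_wpM2l.
    rewrite (le_trans (ler_normB _ _))// normrX (ger0_norm s0)//.
  have -> : Phi s g y - (y + sigma y * g + 2^-1 * c y * (g ^+ 2 - s)) =
    (Phi s g y - y) - sigma y * g - 2^-1 * c y * (g ^+ 2 - s) by ring.
  rewrite (le_trans (ler_normB _ _))//.
  apply: (@le_trans _ _ (2 + `|g| + 2^-1 * K * (`|g| ^+ 2 + s))).
    rewrite lerD// (le_trans (ler_normB _ _))// lerD//.
  have K0 : 0 <= K by rewrite /K; lra.
  have e1 : `|g| <= `|g| ^+ 3.
    rewrite exprS -[leLHS]mulr1 ler_wpM2l//.
    by rewrite exprn_ege1// ltW.
  have e2 : `|g| ^+ 2 <= `|g| ^+ 3.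
    by rewrite [leRHS]exprSr -[leLHS]mulr1 ler_wpM2l ?exprn_ge0// ltW.
  have e3 : s <= s * `|g| by rewrite -[leLHS]mulr1 ler_wpM2l// ltW.
  have e4 : 0 <= s ^+ 2 by rewrite sqr_ge0.
  have e5 : K * (`|g| ^+ 2 + s) <= K * (`|g| ^+ 3 + s * `|g| + s ^+ 2).
    by rewrite ler_wpM2l//; lra.
  have e6 : 0 <= K * (`|g| ^+ 3 + s * `|g| + s ^+ 2).
    by rewrite mulr_ge0// ?addr_ge0// exprn_ge0.
  have e7 : 1 <= `|g| ^+ 3 by rewrite exprn_ege1// ltW.
  lra.
have g1' : -1 <= g <= 1 by rewrite -ler_norml.
have ax_g f p : classC D p.+1 f -> forall s', 0 <= s' -> deriv_on (-1) 1
    (fun t => f (pt3 s' t y)) (fun t => pderive D ix_gamma f (pt3 s' t y)).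
  move=> Cf s' s'0; have [df _] := classC_pd ix_gamma Cf.
  have h t : -1 <= t <= 1 -> D (pt3 s' 0 y + t *: 'e_ix_gamma).
    by move=> _; rewrite pt3_gamma; exact: pt3_dom.
  have := pderive_deriv_on (classC_cont Cf) df h.
  by congr deriv_on; apply/funext => t; rewrite pt3_gamma.
have ax_s f p : classC D p.+1 f -> deriv_on 0 S
    (fun t => f (pt3 t 0 y)) (fun t => pderive D ix_s f (pt3 t 0 y)).
  move=> Cf; have [df _] := classC_pd ix_s Cf.
  have h t : 0 <= t <= S -> D (pt3 0 0 y + t *: 'e_ix_s).
    by move=> /andP[t0 _]; rewrite pt3_s; exact: pt3_dom.
  have := pderive_deriv_on (classC_cont Cf) df h.
  by congr deriv_on; apply/funext => t; rewrite pt3_s.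
have I0 : (-1 : R) <= 0 <= (1 : R) by rewrite lerN10 ler01.
have IS : 0 <= (0 : R) <= S by rewrite lexx.
have sI : 0 <= s <= S by rewrite s0.
(* First an expansion in g at fixed s, with remainder |g|^3; then its three coefficients are moved
   from s to 0, with errors s^2, s |g| and s g^2 <= s |g|. Only derivatives of total order at most 3
   occur. *)
have t1 : `|Phi s g y - (Phi s 0 y + fg (pt3 s 0 y) * g +
     2^-1 * fgg (pt3 s 0 y) * g ^+ 2)| <= K1 * `|g| ^+ 3.
  have := taylor3 (ax_g _ _ Phi_C3 s s0) (ax_g _ _ C0g s s0) (ax_g _ _ Cgg s s0)
    I0 g1' K10.
  rewrite !unc3E; apply=> r hr; apply: h1; apply/box_pt3; split=> //.
have t2 : `|Phi s 0 y - (Phi 0 0 y + fs (pt3 0 0 y) * s)| <= K2 * s ^+ 2.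
  have := taylor2 (ax_s _ _ Phi_C3) (ax_s _ _ C0s) IS sI K20.
  rewrite !unc3E (ger0_norm s0); apply=> r hr; apply: h2; apply/box_pt3; split=> //.
have t3 : `|fg (pt3 s 0 y) - fg (pt3 0 0 y)| <= K3 * s.
  have := deriv_on_le (ax_s _ _ C0g) IS sI (K := K3).
  by rewrite (ger0_norm s0); apply=> r hr _; apply: h3; apply/box_pt3; split.
have t4 : `|fgg (pt3 s 0 y) - fgg (pt3 0 0 y)| <= K4 * s.
  have := deriv_on_le (ax_s _ _ Cgg) IS sI (K := K4).
  by rewrite (ger0_norm s0); apply=> r hr _; apply: h4; apply/box_pt3; split.
have e0 : Phi 0 0 y = y by exact: Phi0.
have eg : fg (pt3 0 0 y) = sigma y by have := Phi_gamma hy.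
have egg : fgg (pt3 0 0 y) = c y by [].
(* The hypothesis on the derivative in s turns the linear term in s into the compensator of g^2:
   together they form c (g^2 - s) / 2. *)
have es : fs (pt3 0 0 y) = - (2^-1 * c y).
  by have := Phi_s hy; rewrite -/(c y) {1}/dPhi/= -/fs; lra.
rewrite e0 es in t2; rewrite eg in t3; rewrite egg in t4.
have -> : Phi s g y - (y + sigma y * g + 2^-1 * c y * (g ^+ 2 - s)) =
  (Phi s g y - (Phi s 0 y + fg (pt3 s 0 y) * g + 2^-1 * fgg (pt3 s 0 y) * g ^+ 2)) +
  (Phi s 0 y - (y + - (2^-1 * c y) * s)) +
  (fg (pt3 s 0 y) - sigma y) * g +
  2^-1 * (fgg (pt3 s 0 y) - c y) * g ^+ 2 by ring.
have u3 : `|(fg (pt3 s 0 y) - sigma y) * g| <= K3 * (s * `|g|).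
  by rewrite normrM mulrA ler_wpM2r.
have u4 : `|2^-1 * (fgg (pt3 s 0 y) - c y) * g ^+ 2| <= K4 * (s * `|g|).
  rewrite !normrM gtr0_norm//.
  apply: (@le_trans _ _ (2^-1 * (K4 * s) * `|g|)).
    apply: ler_pM; rewrite ?mulr_ge0//.
      by rewrite ler_wpM2l.
    by rewrite -[leRHS]mulr1 ler_wpM2l.
  have : 0 <= K4 * (s * `|g|) by rewrite mulr_ge0.
  lra.
rewrite (le_trans (ler_normD _ _))//.
apply: (@le_trans _ _ (K1 * `|g| ^+ 3 + K2 * s ^+ 2 + K3 * (s * `|g|) + K4 * (s * `|g|))).
  rewrite lerD// (le_trans (ler_normD _ _))// lerD//.
  by rewrite (le_trans (ler_normD _ _))// lerD.
have v1 : 0 <= `|g| ^+ 3 by rewrite exprn_ge0.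
have v2 : 0 <= s ^+ 2 by rewrite sqr_ge0.
have w (k : R) z : 0 <= k -> k <= K -> 0 <= z -> k * z <= K * z.
  by move=> k0 kK z0; rewrite ler_wpM2r.
have wK (k z : R) : 0 <= z -> k <= K -> k * z <= K * z by move=> z0 kK; rewrite ler_wpM2r.
have x1 : K1 * `|g| ^+ 3 <= K * `|g| ^+ 3 by apply: wK => //; rewrite /K; lra.
have x2 : K2 * s ^+ 2 <= K * s ^+ 2 by apply: wK => //; rewrite /K; lra.
have x3 : (K3 + K4) * (s * `|g|) <= K * (s * `|g|) by apply: wK => //; rewrite /K; lra.
have K0 : 0 <= K by rewrite /K; lra.
have x4 : 0 <= K * `|g| ^+ 3 by rewrite mulr_ge0.
have x5 : 0 <= K * s ^+ 2 by rewrite mulr_ge0.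
have x6 : 0 <= K * (s * `|g|) by rewrite mulr_ge0.
lra.
Qed.

Lemma domPhi_continuous : {within D, continuous (unc3 Phi)}.
Proof. exact: classC_cont Phi_C3. Qed.

Lemma dPhi_gamma2_continuous :
  {within D, continuous (pderive D ix_gamma (pderive D ix_gamma (unc3 Phi)))}.
Proof.
have [_ Cg] := classC_pd ix_gamma Phi_C3.
by have [_ /classC_cont] := classC_pd ix_gamma Cg.
Qed.

End scheme_map.

(** * Moments of the noise over one step *)

Section power_sums.
Context {R : realType}.

(** Some index carries at least the average, S <= n y_i, and the power of this y_i is one term of
    the right-hand sum. *)
Lemma sum_pow_le (n p : nat) (y : 'I_n -> R) : (forall i, 0 <= y i) ->
  (\sum_i y i) ^+ p.+1 <= n%:R ^+ p.+1 * \sum_i y i ^+ p.+1.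
Proof.
move=> y0; set S := \sum_i y i.
have S0 : 0 <= S by exact: sumr_ge0.
have sp0 : 0 <= \sum_i y i ^+ p.+1 by apply: sumr_ge0 => i _; rewrite exprn_ge0.
case: n y y0 @S S0 sp0 => [|n] y y0 S S0 sp0.
  by rewrite /S !big_ord0 expr0n/= mulr0.
have [i hi] : exists i, S <= n.+1%:R * y i.
  apply: contrapT => /forallNP h.
  have : \sum_i (n.+1%:R * y i) < \sum_(i < n.+1) S.
    apply: ltr_sum; last by move=> i _; rewrite ltNge; apply/negP; exact: h.
    by apply/hasP; exists ord0 => //; exact: mem_index_enum.
  by rewrite -mulr_sumr sumr_const card_ord mulr_natl ltxx.
apply: (@le_trans _ _ ((n.+1%:R * y i) ^+ p.+1)).
  by rewrite lerXn2r ?nnegrE// mulr_ge0.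
rewrite exprMn ler_wpM2l ?exprn_ge0// (bigD1 i)//= lerDl.
by apply: sumr_ge0 => j _; rewrite exprn_ge0.
Qed.

End power_sums.

Section noise.
Context {d} {T : measurableType d} {R : realType} (P : probability T R).
Context {M : nat} {F : R -> set (set T)} {B : R -> T -> 'rV[R]_M}.
Hypothesis hF : filtration F.
Hypothesis hB : brownian_motion P F B.
Variables (u v : R).
Hypotheses (u0 : 0 <= u) (uv : u < v).

Let sF : sigma_algebra setT (F u).
Proof. by case: hF => + _ _; exact. Qed.

Let Fm : F u `<=` measurable.
Proof. by case: hF => _ + _; exact. Qed.

Let dB m w : R := B v w 0 m - B u w 0 m.

Let dBE m : dB m = fun w => (B v w - B u w) 0 m.
Proof. by apply/funext => w; rewrite /dB !mxE. Qed.

(** A single scalar that dominates every linear form in the increments, so the estimates for one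
    step are polynomial inequalities in [noise] and the step size. *)
Definition noise w : R := \sum_m `|dB m w|.

Lemma noise_ge0 w : 0 <= noise w. Proof. exact: sumr_ge0. Qed.

Let mdB m : measurable_fun setT (dB m).
Proof. by rewrite dBE; have [] := bm_sqint hF hB u0 uv m. Qed.

Lemma noise_measurable : measurable_fun setT noise.
Proof. by apply: measurable_sum => m; exact: measurableT_comp. Qed.

Let noise_moment p c : odd p = true ->
  (forall m, intg P (fun w => dB m w ^+ p.+1) /\ mean P (fun w => dB m w ^+ p.+1) <= c) ->
  intg P (fun w => noise w ^+ p.+1) /\
  mean P (fun w => noise w ^+ p.+1) <= M%:R ^+ p.+1 * (M%:R * c).
Proof.
move=> op h; have hi m := (h m).1.
have bnd w : noise w ^+ p.+1 <= M%:R ^+ p.+1 * \sum_m dB m w ^+ p.+1.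
  have -> : \sum_m dB m w ^+ p.+1 = \sum_m `|dB m w| ^+ p.+1.
    apply: eq_bigr => m _; rewrite -normrX ger0_norm//.
    by rewrite exprn_even_ge0//= op.
  exact: sum_pow_le.
have si : intg P (fun w => M%:R ^+ p.+1 * \sum_m dB m w ^+ p.+1).
  by apply/intgZ/intg_sum.
have ni : intg P (fun w => noise w ^+ p.+1).
  apply: (le_intg _ _ si); first by apply: measurable_funX; exact: noise_measurable.
  by move=> w; rewrite ger0_norm ?exprn_ge0 ?noise_ge0.
split=> //; apply: (le_trans (mean_le ni si bnd)).
rewrite meanZ; last exact: intg_sum.
rewrite ler_wpM2l ?exprn_ge0// mean_sum//.
apply: (@le_trans _ _ (\sum_(m < M) c)); first by apply: ler_sum => m _; case: (h m).
by rewrite sumr_const card_ord -[leLHS]mulr_natl.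
Qed.

Lemma noise_moment2 : intg P (fun w => noise w ^+ 2) /\
  mean P (fun w => noise w ^+ 2) <= M%:R ^+ 2 * (M%:R * (v - u)).
Proof.
apply: noise_moment => // m; rewrite dBE.
have cst1 : measurable_wrt (F u) (cst 1 : T -> R) by apply: measurable_wrt_cst.
have [] := bm_sqr hF hB u0 uv m cst1 (intg_cst P 1).
by under eq_fun do rewrite mul1r; move=> i; rewrite mean_cst mul1r => ->.
Qed.

Lemma noise_moment4 : intg P (fun w => noise w ^+ 4) /\
  mean P (fun w => noise w ^+ 4) <= M%:R ^+ 4 * (M%:R * (64 * (v - u) ^+ 2)).
Proof. by apply: noise_moment => // m; rewrite dBE; exact: (bm_moment4 hF hB u0 uv m). Qed.

Lemma noise_moment6 : intg P (fun w => noise w ^+ 6) /\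
  mean P (fun w => noise w ^+ 6) <= M%:R ^+ 6 * (M%:R * (768 * (v - u) ^+ 3)).
Proof. by apply: noise_moment => // m; rewrite dBE; exact: (bm_moment6 hF hB u0 uv m). Qed.

Lemma noise_linear_le (phi : 'I_M -> R) K w : 0 <= K ->
  (forall m, `|phi m| <= K) ->
  `|\sum_m phi m * (B v w 0 m - B u w 0 m)| <= K * noise w.
Proof.
move=> K0 hK; rewrite (le_trans (ler_norm_sum _ _ _))// mulr_sumr.
by apply: ler_sum => m _; rewrite normrM ler_wpM2r.
Qed.

(** Expanding the square, the off-diagonal terms vanish by [bm_cross], and on the diagonal [bm_sqr]
    replaces dB_m^2 by v - u, which the subtracted term compensates. *)
Lemma noise_quadratic_ortho (phi : 'I_M -> T -> R) Z :
  (forall m, bounded_wrt (F u) (phi m)) -> bounded_wrt (F u) Z ->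
  mean P (fun w => Z w * ((\sum_m phi m w * (B v w 0 m - B u w 0 m)) ^+ 2 -
    (\sum_m phi m w ^+ 2) * (v - u))) = 0.
Proof.
move=> bphi bZ.
pose c (p : 'I_M * 'I_M) w := Z w * (phi p.1 w * phi p.2 w).
have bc p : bounded_wrt (F u) (c p).
  by apply: bounded_wrtM => //; exact: bounded_wrtM.
have ci p : intg P (c p) by exact/sqint_intg/(bounded_wrt_sqint P Fm).
have dsq m : sqint P (dB m) by rewrite dBE; exact: (bm_sqint hF hB u0 uv m).
have cdi p : intg P (fun w => c p w * dB p.1 w * dB p.2 w).
  have [mc [L cL]] := bc p; apply: sqintM => //.
  by apply: (sqint_Mbounded _ cL) => //; exact: (measurable_wrt_fun Fm mc).
have -> : (fun w => Z w * ((\sum_m phi m w * (B v w 0 m - B u w 0 m)) ^+ 2 -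
    (\sum_m phi m w ^+ 2) * (v - u))) =
  (fun w => \sum_(p : 'I_M * 'I_M) c p w * dB p.1 w * dB p.2 w -
     \sum_m (v - u) * c (m, m) w).
  apply/funext => w; rewrite mulrBr expr2 mulr_suml; congr (_ - _).
    under eq_bigr do rewrite mulr_sumr.
    rewrite pair_bigA/= mulr_sumr; apply: eq_bigr => p _.
    by rewrite /c /dB; ring.
  rewrite mulr_suml mulr_sumr; apply: eq_bigr => m _.
  by rewrite /c/=; ring.
rewrite meanB; last 2 first.
- exact: intg_sum.
- by apply: intg_sum => m; exact: intgZ.
rewrite !mean_sum//; last by move=> m; exact: intgZ.
apply/eqP; rewrite subr_eq0; apply/eqP.
rewrite -(pair_bigA _ (fun i j => mean P (fun w => c (i, j) w * dB i w * dB j w)))/=.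
apply: eq_bigr => i _; rewrite (bigD1 i)//= big1 ?addr0; last first.
  move=> j ji; rewrite !dBE; have ij : i != j by rewrite eq_sym.
  have [mc _] := bc (i, j).
  by have [] := bm_cross hF hB u0 uv ij mc (ci (i, j)).
have [mc _] := bc (i, i).
have [_] := bm_sqr hF hB u0 uv i mc (ci (i, i)).
rewrite meanZ// mulrC => <-; congr mean; apply/funext => w.
by rewrite -mulrA -expr2 dBE.
Qed.

End noise.

(** * Discrete Gronwall lemma *)

Section gronwall.
Context {R : realType}.

(** By induction e_k <= k b tau^2 (1 + a tau)^k. One factor tau combines with k into at most T, the
    other is the rate; the power is bounded through 1 + x <= exp x. *)
Lemma discrete_gronwall (e : nat -> R) (N : nat) (a b tau T : R) :
  0 <= a -> 0 <= b -> 0 <= tau -> N%:R * tau <= T ->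
  e 0%N = 0 -> (forall n, (n < N)%N -> e n.+1 <= (1 + a * tau) * e n + b * tau ^+ 2) ->
  forall n, (n <= N)%N -> e n <= T * b * expR (a * T) * tau.
Proof.
move=> a0 b0 tau0 NT e0 rec n nN.
have q1 : 1 <= 1 + a * tau by rewrite lerDl mulr_ge0.
have q0 : 0 <= 1 + a * tau by exact: le_trans ler01 q1.
have bt : 0 <= b * tau ^+ 2 by rewrite mulr_ge0 ?sqr_ge0.
have key k : (k <= N)%N -> e k <= k%:R * (b * tau ^+ 2) * (1 + a * tau) ^+ k.
  elim: k => [_|k IH kN]; first by rewrite e0 !mul0r.
  apply: (le_trans (rec k kN)).
  apply: (@le_trans _ _ ((1 + a * tau) * (k%:R * (b * tau ^+ 2) * (1 + a * tau) ^+ k) +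
     b * tau ^+ 2 * (1 + a * tau) ^+ k.+1)).
    rewrite lerD//; first by rewrite ler_wpM2l// IH// ltnW.
    by rewrite -[leLHS]mulr1 ler_wpM2l// exprn_ege1.
  by rewrite (exprS (1 + a * tau) k) -(natr1 k) le_eqVlt; apply/orP; left; apply/eqP; ring.
have T0 : 0 <= T by apply: le_trans NT; rewrite mulr_ge0.
apply: (le_trans (key n nN)).
have -> : n%:R * (b * tau ^+ 2) * (1 + a * tau) ^+ n =
  (n%:R * tau) * (1 + a * tau) ^+ n * (b * tau) by ring.
have -> : T * b * expR (a * T) * tau = T * expR (a * T) * (b * tau) by ring.
rewrite ler_wpM2r ?mulr_ge0//.
have nT : n%:R * tau <= T by apply: le_trans NT; rewrite ler_wpM2r// ler_nat.
apply: ler_pM => //; rewrite ?mulr_ge0 ?exprn_ge0//.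
apply: (@le_trans _ _ (expR (a * tau) ^+ n)).
  by rewrite lerXn2r ?nnegrE ?expR_ge0// expR_ge1Dx.
rewrite -expRM_natl ler_expR mulrCA ler_wpM2l//.
Qed.

End gronwall.

(** * Local expansion of the solution with uniform constants *)

Section sde_euler.
Context {d} {T : measurableType d} {R : realType} (P : probability T R).
Context {n M : nat} {F : R -> set (set T)} {B : R -> T -> 'rV[R]_M}.
Hypothesis hF : filtration F.
Hypothesis hB : brownian_motion P F B.
Local Notation D := (cube R n).
Variables (a : 'I_n -> 'rV[R]_n -> R) (b : 'I_M -> 'I_n -> 'rV[R]_n -> R).
Variables (x0 : 'rV[R]_n) (X : R -> T -> 'rV[R]_n).
Hypothesis Dx0 : D x0.
Hypothesis aL : forall k, lipschitz_on_cube (a k).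
Hypothesis bL : forall m k, lipschitz_on_cube (b m k).
Hypothesis hX : ito_solution P F B D a b x0 X.

(** Assembles the previous lemmas with one constant that serves all u, v, Y and k; the bounds, the
    Lipschitz constants and the regular version are chosen here. *)
Lemma sde_euler_local (T0 : R) : 0 <= T0 -> exists2 C : R, 0 <= C &
  forall (u v : R) (Y : T -> 'rV[R]_n) (k : 'I_n),
  0 <= u -> u <= v -> v - u <= T0 -> (forall w, D (Y w)) ->
  (forall j, measurable_wrt (F u) (fun w => Y w 0 j)) ->
  let mse := mean P (fun w => sqdist (clip x0 X u w) (Y w)) in
  exists Dr W : T -> R,
  [/\ sqint P Dr /\ sqint P W,
      {ae P, forall w, clip x0 X v w 0 k - clip x0 X u w 0 k =
         a k (Y w) * (v - u) +
         \sum_m b m k (Y w) * (B v w 0 m - B u w 0 m) + Dr w + W w},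
      mean P (fun w => Dr w ^+ 2) <= C * (v - u) ^+ 2 * ((v - u) + mse),
      forall Z, bounded_wrt (F u) Z -> mean P (fun w => Z w * W w) = 0 &
      mean P (fun w => W w ^+ 2) <= C * (v - u) * ((v - u) + mse)].
Proof.
move=> T00.
have ca k : {within D, continuous (a k)} by case: (aL k).
have cb m k : {within D, continuous (b m k)} by case: (bL m k).
have [K1 K10 aK] : exists2 K : R, 0 <= K & forall k x, D x -> `|a k x| <= K.
  apply: (@finite_bound R 'I_n (fun k K => forall x, D x -> `|a k x| <= K)).
    by move=> i K K' KK' h x Dx; exact: le_trans (h x Dx) KK'.
  by move=> k; case: (aL k).
have [K2 K20 bK] : exists2 K : R, 0 <= K &
    forall (p : 'I_M * 'I_n) x, D x -> `|b p.1 p.2 x| <= K.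
  apply: (@finite_bound R ('I_M * 'I_n)%type
    (fun p K => forall x, D x -> `|b p.1 p.2 x| <= K)).
    by move=> i K K' KK' h x Dx; exact: le_trans (h x Dx) KK'.
  by move=> p; case: (bL p.1 p.2).
have [L1 L10 aS] : exists2 L : R, 0 <= L & forall k x y, D x -> D y ->
    (a k x - a k y) ^+ 2 <= L * sqdist x y.
  apply: (@finite_bound R 'I_n (fun k L => forall x y, D x -> D y ->
    (a k x - a k y) ^+ 2 <= L * sqdist x y)).
    move=> i K K' KK' h x y Dx Dy; apply: (le_trans (h x y Dx Dy)).
    by rewrite ler_wpM2r// sqdist_ge0.
  by move=> k; exact: lipschitz_on_cube_sqr.
have [L2 L20 bS] : exists2 L : R, 0 <= L & forall (p : 'I_M * 'I_n) x y,
    D x -> D y -> (b p.1 p.2 x - b p.1 p.2 y) ^+ 2 <= L * sqdist x y.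
  apply: (@finite_bound R ('I_M * 'I_n)%type (fun p L => forall x y, D x -> D y ->
    (b p.1 p.2 x - b p.1 p.2 y) ^+ 2 <= L * sqdist x y)).
    move=> i K K' KK' h x y Dx Dy; apply: (le_trans (h x y Dx Dy)).
    by rewrite ler_wpM2r// sqdist_ge0.
  by move=> p; exact: lipschitz_on_cube_sqr.
pose K := K1 + K2; pose L := L1 + L2.
have K0 : 0 <= K by exact: addr_ge0.
have L0 : 0 <= L by exact: addr_ge0.
have aK' k x : D x -> `|a k x| <= K.
  by move=> Dx; rewrite (le_trans (aK k x Dx))// lerDl.
have bK' m k x : D x -> `|b m k x| <= K.
  by move=> Dx; rewrite (le_trans (bK (m, k) x Dx))// lerDr.
have aS' k x y : D x -> D y -> (a k x - a k y) ^+ 2 <= L * sqdist x y.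
  move=> Dx Dy; rewrite (le_trans (aS k x y Dx Dy))// ler_wpM2r ?sqdist_ge0//.
  by rewrite lerDl.
have bS' m k x y : D x -> D y -> (b m k x - b m k y) ^+ 2 <= L * sqdist x y.
  move=> Dx Dy; rewrite (le_trans (bS (m, k) x y Dx Dy))//.
  by rewrite ler_wpM2r ?sqdist_ge0// lerDr.
have [adX cX DX _] := hX.
have mX t k : 0 <= t -> measurable_fun setT (fun w => X t w 0 k).
  move=> t0; case: hF => _ Fm _.
  by apply: (measurable_wrt_fun (Fm _ t0)); exact: adX.
have [Xt [DXt mXt XXt]] := regular_version Dx0 mX cX DX.
(* C1 is the constant of [clip_increment_sqr] for one coordinate, C2 its sum over the n coordinates,
   C3 bounds [kappa] by C3 (v - u + mse), and C4 adds the factor 4 M^2 of the martingale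
   remainder. *)
pose C1 := 2 * T0 * K ^+ 2 + 8 * M%:R * M%:R * K ^+ 2.
have C10 : 0 <= C1 by rewrite addr_ge0 ?mulr_ge0 ?sqr_ge0.
pose C2 := n%:R * C1; have C20 : 0 <= C2 by rewrite mulr_ge0.
pose C3 := 2 * L * (C2 + 1).
have C30 : 0 <= C3 by rewrite !mulr_ge0 ?addr_ge0.
pose C4 := 4 * M%:R * M%:R * C3.
have C40 : 0 <= C4 by apply: mulr_ge0 => //; apply: mulr_ge0.
exists (C3 + C4); first exact: addr_ge0.
move=> u v Y k u0 uv uvT DY mY mse.
have mse0 : 0 <= mse by apply: mean_ge0 => w; exact: sqdist_ge0.
have hC2 s : u <= s -> s <= v ->
    mean P (fun w => sqdist (clip x0 X s w) (clip x0 X u w)) <= C2 * (s - u).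
  move=> us sv; have s0 := le_trans u0 us.
  have suT : s - u <= T0 by rewrite (le_trans _ uvT)// lerB.
  rewrite /sqdist mean_sum; last first.
    move=> j; apply: sqint_sqr; apply: sqintB;
      apply: (sqint_bounded P (K := 1)); case: hF => _ Fm _.
    - by apply: (measurable_wrt_fun (Fm _ s0)); apply: (clip_adapted hF hX).
    - by move=> w; rewrite ler_norml; exact: clip_cube.
    - by apply: (measurable_wrt_fun (Fm _ u0)); apply: (clip_adapted hF hX).
    - by move=> w; rewrite ler_norml; exact: clip_cube.
  apply: (@le_trans _ _ (\sum_(j < n) C1 * (s - u))).
    apply: ler_sum => j _.
    exact: (clip_increment_sqr hF hB K0 Dx0 ca cb aK' bK' hX DXt mXt XXt u0 us).
  by rewrite sumr_const card_ord -[leLHS]mulr_natl mulrA.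
have [Dr [W [si e h1 h2 h3]]] := clip_increment_euler hF hB K0 L0 Dx0 ca cb
  aK' bK' aS' bS' hX DXt mXt XXt u0 uv k C20 DY mY hC2.
have vu0 : 0 <= v - u by rewrite subr_ge0.
have kap : 2 * L * (C2 * (v - u) + mse) <= C3 * (v - u + mse).
  rewrite /C3 -[leRHS]mulrA ler_wpM2l ?mulr_ge0//.
  by have := mulr_ge0 C20 mse0; lra.
exists Dr, W; split=> //.
- apply: (le_trans h1).
  apply: (@le_trans _ _ ((v - u) ^+ 2 * (C3 * (v - u + mse)))).
    by rewrite ler_wpM2l ?sqr_ge0.
  have -> : (C3 + C4) * (v - u) ^+ 2 * (v - u + mse) =
    (v - u) ^+ 2 * (C3 * (v - u + mse)) + C4 * ((v - u) ^+ 2 * (v - u + mse)).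
    by ring.
  rewrite lerDl; apply: mulr_ge0 => //.
  by apply: mulr_ge0; [exact: sqr_ge0|exact: addr_ge0].
- apply: (le_trans h3).
  have -> : M%:R * M%:R * (4 * (2 * L * (C2 * (v - u) + mse)) * (v - u)) =
    4 * M%:R * M%:R * (v - u) * (2 * L * (C2 * (v - u) + mse)) :> R by ring.
  apply: (@le_trans _ _ (4 * M%:R * M%:R * (v - u) * (C3 * (v - u + mse)))).
    by rewrite ler_wpM2l//; apply: mulr_ge0 => //; apply: mulr_ge0.
  have -> : 4 * M%:R * M%:R * (v - u) * (C3 * (v - u + mse)) =
    C4 * (v - u) * (v - u + mse) by rewrite /C4; ring.
  have -> : (C3 + C4) * (v - u) * (v - u + mse) =
    C4 * (v - u) * (v - u + mse) + C3 * ((v - u) * (v - u + mse)) by ring.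
  rewrite lerDl; apply: mulr_ge0 => //.
  by apply: mulr_ge0 => //; exact: addr_ge0.
Qed.

End sde_euler.

(** * One step of the scheme *)

Section within_continuity.
Context {R : realType} {n : nat} (D : set 'rV[R]_n).
Implicit Types f g : 'rV[R]_n -> R.

Lemma within_continuous_add f g : {within D, continuous f} ->
  {within D, continuous g} -> {within D, continuous (fun x => f x + g x)}.
Proof. by move=> cf cg x; apply: (@cvgD _ R^o); [exact: cf|exact: cg]. Qed.

Lemma within_continuous_mul f g : {within D, continuous f} ->
  {within D, continuous g} -> {within D, continuous (fun x => f x * g x)}.
Proof. by move=> cf cg x; apply: (@cvgM R); [exact: cf|exact: cg]. Qed.

Lemma within_continuous_cst c : {within D, continuous (fun _ : 'rV[R]_n => c : R)}.
Proof. by apply: continuous_subspaceT; exact: cst_continuous. Qed.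

Lemma within_continuous_sum (I : Type) (s : seq I) (f : I -> 'rV[R]_n -> R) :
  (forall i, {within D, continuous (f i)}) ->
  {within D, continuous (fun x => \sum_(i <- s) f i x)}.
Proof.
move=> cf; elim: s => [|i s ih].
  by under eq_fun do rewrite big_nil; exact: within_continuous_cst.
by under eq_fun do rewrite big_cons; exact: within_continuous_add.
Qed.

End within_continuity.

Lemma measurable_wrt_within {T : pointedType} {R : realType} (n : nat)
    (G : set (set T)) (D : set 'rV[R]_n) (f : 'rV[R]_n -> R) (Y : T -> 'rV[R]_n) :
  sigma_algebra setT G -> {within D, continuous f} -> (forall w, D (Y w)) ->
  (forall k, measurable_wrt G (fun w => Y w 0 k)) ->
  measurable_wrt G (fun w => f (Y w)).
Proof.
move=> sG cf DY mY A mA.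
have GE : <<s G >> = G by exact: sigma_algebra_id.
have mY' k : measurable_fun setT ((fun w => Y w 0 k) : g_sigma_algebraType G -> R).
  move=> _ C mC; rewrite setTI.
  by change ((<<s G >>) ((fun w => Y w 0 k) @^-1` C)); rewrite GE; exact: mY.
have := @within_continuous_measurable _ (g_sigma_algebraType G) R n Y mY' D f cf DY
  measurableT A mA.
rewrite setTI.
by change ((<<s G >>) ((fun w => f (Y w)) @^-1` A) -> G ((fun w => f (Y w)) @^-1` A));
  rewrite GE.
Qed.

Section scheme_local.
Context {disp} {T : measurableType disp} {R : realType} (P : probability T R).
Context {d M : nat} {F : R -> set (set T)} {B : R -> T -> 'rV[R]_M}.
Hypothesis hF : filtration F.
Hypothesis hB : brownian_motion P F B.
Local Notation D := (cube R d).
Variables (g0 : 'rV[R]_d -> 'rV[R]_d) (g : 'I_M -> 'rV[R]_d -> 'rV[R]_d).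
Hypothesis hg0 : classC_field D 2 g0.
Hypothesis hg : forall m, classC_field D 3 (g m).
Variables (f0 : 'I_d -> 'I_d -> 'rV[R]_d -> R)
  (f : 'I_M -> 'I_d -> 'I_d -> 'rV[R]_d -> R).
Hypothesis hf0 : forall k l, is_factor g0 k l (f0 k l).
Hypothesis hf : forall m k l, is_factor (g m) k l (f m k l).
Variable Phi : R -> R -> R -> R.
Hypothesis range : forall s gamma y, 0 <= s -> -1 <= y <= 1 ->
  -1 <= Phi s gamma y <= 1.
Hypothesis Phi0 : forall y, -1 <= y <= 1 -> Phi 0 0 y = y.
Hypothesis Phi_gamma : forall y, -1 <= y <= 1 -> dPhi Phi 0 1 0 0 0 y = sigma y.
Hypothesis Phi_s : forall y, -1 <= y <= 1 ->
  dPhi Phi 1 0 0 0 0 y + 2^-1 * dPhi Phi 0 2 0 0 0 y = 0.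
Hypothesis Phi_C3 : classC (domPhi R) 3 (unc3 Phi).

Let sF t : 0 <= t -> sigma_algebra setT (F t).
Proof. by case: hF => + _ _; exact. Qed.

Let Fm t : 0 <= t -> F t `<=` measurable.
Proof. by case: hF => _ + _; exact. Qed.

Let Fle s t : 0 <= s -> s <= t -> F s `<=` F t.
Proof. by case: hF => _ _; exact. Qed.

Lemma gbar0_lipschitz k : lipschitz_on_cube (gbar0 g0 g k).
Proof.
rewrite /gbar0; apply: lipschitz_on_cubeD; first exact: classC_lipschitz (hg0 k).
apply: (lipschitz_on_cubeM (lipschitz_on_cube_cst _)).
apply: lipschitz_on_cube_sum => m; apply: lipschitz_on_cube_sum => l.
apply: lipschitz_on_cubeM.
  exact: (classC_lipschitz (classC_pderive l (hg m k))).
exact: classC_lipschitz (hg m l).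
Qed.

Lemma g_lipschitz m k : lipschitz_on_cube (fun x => g m x 0 k).
Proof. exact: classC_lipschitz (hg m k). Qed.

(** The factors f are given as continuous and no more. Continuity yields the measurability and the
    bound on the compact cube that the expansion uses; Lipschitz estimates are made on the products
    with sigma only. *)
Lemma fbar0_continuous k : {within D, continuous (fbar0 g f0 f k)}.
Proof.
rewrite /fbar0; apply: within_continuous_add; first by case: (hf0 k k).
apply: within_continuous_mul; first exact: within_continuous_cst.
apply: within_continuous_sum => m; apply: within_continuous_sum => l.
apply: within_continuous_mul; last by case: (hf m k l).
by case: (classC_pderive l (hg m k)).
Qed.

(** The Ito correction of component k involves all components g_l; this is why [f m k l] divides g_l
    by sigma (x_k) for every l. *)
Lemma sigma_fbar0 k x : D x -> sigma (x 0 k) * fbar0 g f0 f k x = gbar0 g0 g k x.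
Proof.
move=> Dx; rewrite /fbar0 /gbar0 mulrDr; have [_ <-//] := hf0 k k.
congr (_ + _); rewrite mulrCA; congr (_ * _).
rewrite mulr_sumr; apply: eq_bigr => m _; rewrite mulr_sumr.
by apply: eq_bigr => l _; rewrite mulrCA; have [_ <-] := hf m k l.
Qed.

Definition scheme_step k (tau : R) (x : 'rV[R]_d) (db : 'rV[R]_M) : R :=
  Phi (enorm (fvec f k x) ^+ 2 * tau)
      (dotp (fvec f k x) db + fbar0 g f0 f k x * tau) (x 0 k).

Let enormE k x : enorm (fvec f k x) ^+ 2 = \sum_m f m k k x ^+ 2.
Proof.
rewrite /enorm sqr_sqrtr.
  by rewrite /dotp; apply: eq_bigr => m _; rewrite mxE expr2.
by apply: sumr_ge0 => m _; rewrite -expr2 sqr_ge0.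
Qed.

Let dotpE k x u v w : dotp (fvec f k x) (B v w - B u w) =
  \sum_m f m k k x * (B v w 0 m - B u w 0 m).
Proof. by apply: eq_bigr => m _; rewrite !mxE. Qed.

Lemma scheme_step_range k tau x db : 0 <= tau -> D x ->
  -1 <= scheme_step k tau x db <= 1.
Proof.
move=> tau0 Dx; apply: range; last exact: Dx.
by rewrite mulr_ge0// sqr_ge0.
Qed.

(** The step is [unc3 Phi] composed with an F_v-measurable vector of [domPhi], so continuity within
    that domain suffices. *)
Lemma scheme_step_adapted k u v (Y : T -> 'rV[R]_d) : 0 <= u -> u <= v ->
  (forall w, D (Y w)) ->
  (forall j, measurable_wrt (F u) (fun w => Y w 0 j)) ->
  measurable_wrt (F v) (fun w => scheme_step k (v - u) (Y w) (B v w - B u w)).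
Proof.
move=> u0 uv DY mY; have v0 := le_trans u0 uv; have sFv := sF v0.
have mYv j : measurable_wrt (F v) (fun w => Y w 0 j).
  by apply: measurable_wrt_sub (mY j); exact: Fle.
have mB t m : 0 <= t -> t <= v -> measurable_wrt (F v) (fun w => B t w 0 m).
  move=> t0 tv; apply: (@measurable_wrt_sub _ _ R (F t)); first exact: Fle.
  by case: hB => _ + _ _; exact.
have mf m : measurable_wrt (F v) (fun w => f m k k (Y w)).
  by apply: (measurable_wrt_within sFv _ DY mYv); case: (hf m k k).
have msum (h : 'I_M -> T -> R) : (forall m, measurable_wrt (F v) (h m)) ->
    measurable_wrt (F v) (fun w => \sum_m h m w).
  move=> mh; apply/(measurable_wrtP _ sFv); apply: measurable_sum => m.
  exact/(measurable_wrtP _ sFv).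
pose Z w := pt3 (enorm (fvec f k (Y w)) ^+ 2 * (v - u))
  (dotp (fvec f k (Y w)) (B v w - B u w) + fbar0 g f0 f k (Y w) * (v - u))
  (Y w 0 k).
have -> : (fun w => scheme_step k (v - u) (Y w) (B v w - B u w)) =
    (fun w => unc3 Phi (Z w)).
  by apply/funext => w; rewrite /unc3 !mxE.
apply: (measurable_wrt_within sFv (domPhi_continuous Phi_C3)).
  move=> w; rewrite /domPhi/= !mxE/=; split; last exact: DY.
  by rewrite mulr_ge0 ?sqr_ge0// subr_ge0.
case=> [[|[|[|//]]] i]; under eq_fun do rewrite mxE/=.
- under eq_fun do rewrite enormE.
  apply: measurable_wrtM => //; last exact: measurable_wrt_cst.
  by apply: msum => m; apply: measurable_wrtM.
- under eq_fun do rewrite dotpE.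
  apply: measurable_wrtD => //.
    apply: msum => m; apply: measurable_wrtM => //.
    by apply: measurable_wrtB => //; exact: mB.
  apply: measurable_wrtM => //; last exact: measurable_wrt_cst.
  exact: (measurable_wrt_within sFv (@fbar0_continuous k) DY mYv).
- exact: mYv.
Qed.

(** The noise counts as tau^(1/2). The remainder [Rm] is bounded by a multiple of be^3 + tau be +
    tau^2, all of whose terms have mean square O(tau^3); this is where the sixth moment enters. [N]
    is quadratic in the noise, of mean square O(tau^2). *)
Lemma scheme_local (T0 : R) : 0 <= T0 -> exists2 C : R, 0 <= C &
  forall (u v : R) (Y : T -> 'rV[R]_d) (k : 'I_d),
  0 <= u -> u < v -> v - u <= T0 -> (forall w, D (Y w)) ->
  (forall j, measurable_wrt (F u) (fun w => Y w 0 j)) ->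
  exists Rm N : T -> R,
  [/\ sqint P Rm /\ sqint P N,
      forall w, scheme_step k (v - u) (Y w) (B v w - B u w) = Y w 0 k +
         gbar0 g0 g k (Y w) * (v - u) +
         \sum_m g m (Y w) 0 k * (B v w 0 m - B u w 0 m) + Rm w + N w,
      mean P (fun w => Rm w ^+ 2) <= C * (v - u) ^+ 3,
      forall Z, bounded_wrt (F u) Z -> mean P (fun w => Z w * N w) = 0 &
      mean P (fun w => N w ^+ 2) <= C * (v - u) ^+ 2].
Proof.
move=> T00.
have [K1 K10 fK1] : exists2 K : R, 0 <= K &
    forall (p : 'I_M * 'I_d) x, D x -> `|f p.1 p.2 p.2 x| <= K.
  apply: (@finite_bound R ('I_M * 'I_d)%type
    (fun p K => forall x, D x -> `|f p.1 p.2 p.2 x| <= K)).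
    by move=> i K K' KK' h x Dx; exact: le_trans (h x Dx) KK'.
  move=> p; have [cf _] := hf p.1 p.2 p.2.
  exact: (compact_within_bounded cf (@subset_refl _ _) (@cube_compact R d)).
have [K2 K20 fK2] : exists2 K : R, 0 <= K &
    forall k x, D x -> `|fbar0 g f0 f k x| <= K.
  apply: (@finite_bound R 'I_d
    (fun k K => forall x, D x -> `|fbar0 g f0 f k x| <= K)).
    by move=> i K K' KK' h x Dx; exact: le_trans (h x Dx) KK'.
  move=> k; exact: (compact_within_bounded (@fbar0_continuous k)
    (@subset_refl _ _) (@cube_compact R d)).
pose K := K1 + K2; have K0 : 0 <= K by exact: addr_ge0.
have fK m k x : D x -> `|f m k k x| <= K.
  by move=> Dx; rewrite (le_trans (fK1 (m, k) x Dx))// lerDl.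
have fbK k x : D x -> `|fbar0 g f0 f k x| <= K.
  by move=> Dx; rewrite (le_trans (fK2 k x Dx))// lerDr.
pose Mr : R := M%:R; have Mr0 : 0 <= Mr by [].
have S0 : 0 <= Mr * K ^+ 2 * T0 by rewrite !mulr_ge0 ?sqr_ge0.
have [C C0 [cC tay]] := Phi_taylor range Phi0 Phi_gamma Phi_s Phi_C3 S0.
(* The four terms of C1 come from [e1] to [e4] below. In C2 the 3 comes from the square of a sum of
   three terms, 768 from the sixth moment, and T0 from tau^4 <= T0 tau^3; in C3 the 64 comes from
   the fourth moment. *)
pose C1 := C * (4 * K ^+ 3 * (1 + T0) + Mr * K ^+ 3 + Mr ^+ 2 * K ^+ 4 + K ^+ 2).
have C10 : 0 <= C1.
  by rewrite mulr_ge0// !addr_ge0 ?mulr_ge0 ?exprn_ge0 ?addr_ge0.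
pose C2 := 3 * C1 ^+ 2 * (Mr ^+ 6 * (Mr * 768) + Mr ^+ 2 * Mr + T0).
pose C3 := C ^+ 2 * K ^+ 4 * (Mr ^+ 4 * (Mr * 64) + Mr ^+ 2).
have C20 : 0 <= C2.
  have h1 : 0 <= 3 * C1 ^+ 2 by apply: mulr_ge0; [exact: ler0n|exact: sqr_ge0].
  have h2 (c : R) : 0 <= c -> 0 <= Mr ^+ 6 * (Mr * c).
    by move=> c0; apply: mulr_ge0; [exact: exprn_ge0|exact: mulr_ge0].
  apply: (mulr_ge0 h1); apply: (addr_ge0 _ T00); apply: addr_ge0.
    by apply: h2; exact: ler0n.
  exact: (mulr_ge0 (exprn_ge0 2 Mr0) Mr0).
have C30 : 0 <= C3.
  have h1 : 0 <= C ^+ 2 * K ^+ 4.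
    by apply: mulr_ge0; [exact: sqr_ge0|exact: exprn_ge0].
  have h2 (c : R) : 0 <= c -> 0 <= Mr ^+ 4 * (Mr * c).
    by move=> c0; apply: mulr_ge0; [exact: exprn_ge0|exact: mulr_ge0].
  apply: (mulr_ge0 h1); apply: addr_ge0; last exact: sqr_ge0.
  by apply: h2; exact: ler0n.
exists (C2 + C3); first exact: addr_ge0.
move=> u v Y k u0 uv uvT DY mY.
have vu0 : 0 <= v - u by rewrite subr_ge0 ltW.
set tau := v - u in vu0 uvT *.
have Yk w : -1 <= Y w 0 k <= 1 by exact: DY.
pose c y := dPhi Phi 0 2 0 0 0 y.
pose q w := \sum_m f m k k (Y w) * (B v w 0 m - B u w 0 m).
pose r w := \sum_m f m k k (Y w) ^+ 2.
(* Built from q alone, without the drift part of gamma: q^2 - r tau is orthogonal to F_u, while (q +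
   fbar0 tau)^2 - r tau is not. *)
pose N w := 2^-1 * c (Y w 0 k) * (q w ^+ 2 - r w * tau).
pose lin w := Y w 0 k + gbar0 g0 g k (Y w) * tau +
  \sum_m g m (Y w) 0 k * (B v w 0 m - B u w 0 m).
pose Xk w := scheme_step k tau (Y w) (B v w - B u w).
pose Rm w := Xk w - lin w - N w.
pose be w := noise (B := B) u v w.
have be0 w : 0 <= be w by exact: noise_ge0.
have bf m : bounded_wrt (F u) (fun w => f m k k (Y w)).
  split; last by exists K => w; exact: fK.
  by apply: (measurable_wrt_within (sF u0) _ DY mY); case: (hf m k k).
have bc : bounded_wrt (F u) (fun w => 2^-1 * c (Y w 0 k)).
  split; last first.
    exists (2^-1 * C) => w; rewrite normrM gtr0_norm// ler_wpM2l//.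
    exact: cC.
  apply: measurable_wrtM; [exact: sF|exact: measurable_wrt_cst (sF u0)|].
  apply: (measurable_wrt_within (Y := fun w => pt3 0 0 (Y w 0 k)) (sF u0)
    (dPhi_gamma2_continuous Phi_C3)).
    by move=> w; rewrite /domPhi/= !mxE/=.
  case=> [[|[|[|//]]] i]; under eq_fun do rewrite mxE/=; try exact: measurable_wrt_cst (sF u0).
  exact: mY.
have mB m t : 0 <= t -> measurable_fun setT (fun w => B t w 0 m).
  exact: (bm_measurable hF hB).
have v0 : 0 <= v by rewrite (le_trans u0)// ltW.
have mq : measurable_fun setT q.
  apply: measurable_sum => m; apply: measurable_funM.
    exact: (measurable_wrt_fun (Fm u0) (bf m).1).
  by apply: measurable_funB; exact: mB.
have mr : measurable_fun setT r.
  apply: measurable_sum => m; apply: measurable_funX.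
  exact: (measurable_wrt_fun (Fm u0) (bf m).1).
have mN : measurable_fun setT N.
  apply: measurable_funM; first exact: (measurable_wrt_fun (Fm u0) bc.1).
  apply: measurable_funB; first exact: measurable_funX.
  exact: measurable_funM.
have mYk j : measurable_fun setT (fun w => Y w 0 j).
  exact: (measurable_wrt_fun (Fm u0) (mY j)).
have mlin : measurable_fun setT lin.
  apply: measurable_funD.
    apply: measurable_funD => //; apply: measurable_funM => //.
    have [cg _ _] := gbar0_lipschitz k.
    exact: (within_continuous_measurable mYk cg DY).
  apply: measurable_sum => m; apply: measurable_funM.
    have [cg _ _] := g_lipschitz m k.
    exact: (within_continuous_measurable mYk cg DY).
  by apply: measurable_funB; exact: mB.
have mXk : measurable_fun setT Xk.
  apply: (measurable_wrt_fun (Fm v0)).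
  exact: (scheme_step_adapted k u0 (ltW uv) DY mY).
have mRm : measurable_fun setT Rm.
  by apply: measurable_funB => //; exact: measurable_funB.
have qb w : `|q w| <= K * be w.
  by apply: noise_linear_le => // m; exact: fK.
have r0 w : 0 <= r w by apply: sumr_ge0 => m _; exact: sqr_ge0.
have rb w : r w <= Mr * K ^+ 2.
  apply: (@le_trans _ _ (\sum_(m < M) K ^+ 2)).
    apply: ler_sum => m _; rewrite -(real_normK (num_real (f m k k (Y w)))).
    by rewrite lerXn2r ?nnegrE// fK.
  by rewrite sumr_const card_ord -[leLHS]mulr_natl.
have Nb w : N w ^+ 2 <= C ^+ 2 * K ^+ 4 * be w ^+ 4 + C ^+ 2 * K ^+ 4 * (Mr ^+ 2 * tau ^+ 2).
  have h1 : `|N w| <= C * (K ^+ 2 * be w ^+ 2 + Mr * K ^+ 2 * tau) / 2.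
    rewrite /N normrM normrM gtr0_norm//.
    have -> : C * (K ^+ 2 * be w ^+ 2 + Mr * K ^+ 2 * tau) / 2 =
      2^-1 * C * ((K * be w) ^+ 2 + Mr * K ^+ 2 * tau) by ring.
    apply: ler_pM; rewrite ?mulr_ge0//.
      by rewrite ler_wpM2l//; exact: cC.
    rewrite (le_trans (ler_normB _ _))// lerD//.
      by rewrite normrX lerXn2r ?nnegrE// mulr_ge0.
    by rewrite ger0_norm ?mulr_ge0// ler_wpM2r.
  rewrite -(real_normK (num_real (N w))).
  have h2 : 0 <= C * (K ^+ 2 * be w ^+ 2 + Mr * K ^+ 2 * tau) / 2.
    by apply: le_trans h1.
  apply: (@le_trans _ _ ((C * (K ^+ 2 * be w ^+ 2 + Mr * K ^+ 2 * tau) / 2) ^+ 2)).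
    by rewrite lerXn2r ?nnegrE.
  have := sqr_ge0 (C * K ^+ 2 * be w ^+ 2 - C * (Mr * K ^+ 2 * tau)).
  have := sqr_ge0 (C * K ^+ 2 * be w ^+ 2); have := sqr_ge0 (C * (Mr * K ^+ 2 * tau)).
  lra.
have Rb w : `|Rm w| <= C1 * (be w ^+ 3 + tau * be w + tau ^+ 2).
  have sk : enorm (fvec f k (Y w)) ^+ 2 * tau = r w * tau by rewrite enormE.
  pose s := r w * tau; pose ga := q w + fbar0 g f0 f k (Y w) * tau.
  have XkE : Xk w = Phi s ga (Y w 0 k) by rewrite /Xk /scheme_step sk dotpE.
  have s0 : 0 <= s by rewrite mulr_ge0.
  have sb : s <= Mr * K ^+ 2 * tau by rewrite ler_wpM2r.
  have sS : 0 <= s <= Mr * K ^+ 2 * T0.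
    by rewrite s0 (le_trans sb)// ler_wpM2l// mulr_ge0 ?sqr_ge0.
  have gb : `|ga| <= K * (be w + tau).
    rewrite (mulrDr K); apply: (le_trans (ler_normD _ _)).
    apply: lerD; first exact: qb.
    by rewrite normrM (ger0_norm vu0) ler_wpM2r// fbK.
  have linE : sigma (Y w 0 k) * ga = lin w - Y w 0 k.
    rewrite /ga /lin mulrDr mulrA sigma_fbar0// /q mulr_sumr.
    have -> : \sum_m sigma (Y w 0 k) * (f m k k (Y w) * (B v w 0 m - B u w 0 m)) =
        \sum_m g m (Y w) 0 k * (B v w 0 m - B u w 0 m).
      by apply: eq_bigr => m _; rewrite mulrA; have [_ <-] := hf m k k.
    ring.
  (* The Taylor remainder, plus the second order terms containing the drift part of [ga], which were
     left out of [N]. *)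
  have -> : Rm w = (Phi s ga (Y w 0 k) - (Y w 0 k + sigma (Y w 0 k) * ga +
      2^-1 * c (Y w 0 k) * (ga ^+ 2 - s))) +
      2^-1 * c (Y w 0 k) * (2 * (q w * (fbar0 g f0 f k (Y w) * tau)) +
      (fbar0 g f0 f k (Y w) * tau) ^+ 2).
    by rewrite /Rm XkE linE /N /ga /s; ring.
  have t1 := tay s ga _ sS (Yk w).
  (* Uses (x + y)^3 <= 4 (x^3 + y^3) and tau^3 <= T0 tau^2. *)
  have e1 : `|ga| ^+ 3 <= 4 * K ^+ 3 * (1 + T0) * (be w ^+ 3 + tau ^+ 2).
    apply: (@le_trans _ _ ((K * (be w + tau)) ^+ 3)).
      apply: lerXn2r gb; rewrite nnegrE; first exact: normr_ge0.
      by apply: (mulr_ge0 K0); apply: addr_ge0.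
    rewrite exprMn.
    have h1 : (be w + tau) ^+ 3 <= 4 * (be w ^+ 3 + tau ^+ 3).
      have : 0 <= 3 * (be w + tau) * (be w - tau) ^+ 2.
        by rewrite mulr_ge0 ?sqr_ge0// mulr_ge0// addr_ge0.
      lra.
    have h2 : tau ^+ 3 <= T0 * tau ^+ 2.
      by rewrite exprS ler_wpM2r// sqr_ge0.
    have h3 : 0 <= T0 * be w ^+ 3 by rewrite mulr_ge0// exprn_ge0.
    have h4 : 0 <= tau ^+ 2 by exact: sqr_ge0.
    have -> : 4 * K ^+ 3 * (1 + T0) * (be w ^+ 3 + tau ^+ 2) =
      K ^+ 3 * (4 * (1 + T0) * (be w ^+ 3 + tau ^+ 2)) by ring.
    by rewrite ler_wpM2l ?exprn_ge0//; lra.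
  have e2 : s * `|ga| <= Mr * K ^+ 3 * (tau * be w + tau ^+ 2).
    have -> : Mr * K ^+ 3 * (tau * be w + tau ^+ 2) =
       (Mr * K ^+ 2 * tau) * (K * (be w + tau)) by ring.
    exact: ler_pM.
  have e3 : s ^+ 2 <= Mr ^+ 2 * K ^+ 4 * tau ^+ 2.
    have -> : Mr ^+ 2 * K ^+ 4 * tau ^+ 2 = (Mr * K ^+ 2 * tau) ^+ 2 by ring.
    by rewrite lerXn2r ?nnegrE// !mulr_ge0 ?sqr_ge0.
  have fb : `|fbar0 g f0 f k (Y w) * tau| <= K * tau.
    by rewrite normrM (ger0_norm vu0) ler_wpM2r// fbK.
  have e4 : `|2^-1 * c (Y w 0 k) * (2 * (q w * (fbar0 g f0 f k (Y w) * tau)) +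
      (fbar0 g f0 f k (Y w) * tau) ^+ 2)| <= C * K ^+ 2 * (tau * be w + tau ^+ 2).
    apply: (@le_trans _ _ (2^-1 * C * (2 * ((K * be w) * (K * tau)) + (K * tau) ^+ 2))).
      rewrite normrM; apply: ler_pM => //.
        by rewrite normrM gtr0_norm// ler_wpM2l//; exact: cC.
      rewrite (le_trans (ler_normD _ _))// lerD//.
        by rewrite normrM gtr0_norm// ler_wpM2l// normrM; apply: ler_pM.
      by rewrite normrX lerXn2r ?nnegrE// mulr_ge0.
    have : 0 <= C * (K ^+ 2 * tau ^+ 2) by rewrite !mulr_ge0 ?sqr_ge0.
    lra.
  rewrite (le_trans (ler_normD _ _))//.
  apply: (le_trans (lerD t1 e4)).
  have h0 : 0 <= be w ^+ 3 by rewrite exprn_ge0.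
  have h1 : 0 <= tau * be w by rewrite mulr_ge0.
  have h2 : 0 <= tau ^+ 2 by exact: sqr_ge0.
  set Q := be w ^+ 3 + tau * be w + tau ^+ 2.
  have w1 : 4 * K ^+ 3 * (1 + T0) * (be w ^+ 3 + tau ^+ 2) <= 4 * K ^+ 3 * (1 + T0) * Q.
    by rewrite ler_wpM2l ?mulr_ge0 ?exprn_ge0 ?addr_ge0// /Q; lra.
  have w2 : Mr * K ^+ 3 * (tau * be w + tau ^+ 2) <= Mr * K ^+ 3 * Q.
    by rewrite ler_wpM2l ?mulr_ge0 ?exprn_ge0// /Q; lra.
  have w3 : Mr ^+ 2 * K ^+ 4 * tau ^+ 2 <= Mr ^+ 2 * K ^+ 4 * Q.
    by rewrite ler_wpM2l ?mulr_ge0 ?exprn_ge0// /Q; lra.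
  have w4 : K ^+ 2 * (tau * be w + tau ^+ 2) <= K ^+ 2 * Q.
    by rewrite ler_wpM2l ?exprn_ge0// /Q; lra.
  have -> : C1 * Q = C * (4 * K ^+ 3 * (1 + T0) * Q + Mr * K ^+ 3 * Q +
      Mr ^+ 2 * K ^+ 4 * Q + K ^+ 2 * Q) by rewrite /C1; ring.
  rewrite -(mulrA C) -mulrDr; apply: (ler_wpM2l C0).
  apply: lerD w4; apply: lerD; last exact: le_trans w3.
  by apply: lerD; [exact: le_trans w1|exact: le_trans w2].
have [n2i n2] := noise_moment2 hF hB u0 uv.
have [n4i n4] := noise_moment4 hF hB u0 uv.
have [n6i n6] := noise_moment6 hF hB u0 uv.
rewrite -/tau in n2 n4 n6.
have Nbi : intg P (fun w => C ^+ 2 * K ^+ 4 * be w ^+ 4 + C ^+ 2 * K ^+ 4 * (Mr ^+ 2 * tau ^+ 2)).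
  by apply: intgD; [exact: intgZ|exact: intg_cst].
have Ni : sqint P N.
  split=> //; apply: (le_intg _ _ Nbi); first exact: measurable_funX.
  by move=> w; rewrite ger0_norm ?sqr_ge0.
have Rb2 w : Rm w ^+ 2 <= 3 * C1 ^+ 2 * (be w ^+ 6 + tau ^+ 2 * be w ^+ 2 + tau ^+ 4).
  rewrite -(real_normK (num_real (Rm w))).
  apply: (@le_trans _ _ ((C1 * (be w ^+ 3 + tau * be w + tau ^+ 2)) ^+ 2)).
    rewrite lerXn2r ?nnegrE//; exact: le_trans (Rb w).
  rewrite exprMn [3 * C1 ^+ 2]mulrC -(mulrA (C1 ^+ 2)) ler_wpM2l ?sqr_ge0//.
  set x := be w ^+ 3; set y := tau * be w; set z := tau ^+ 2.
  have -> : be w ^+ 6 = x ^+ 2 by rewrite /x; ring.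
  have -> : tau ^+ 2 * be w ^+ 2 = y ^+ 2 by rewrite /y; ring.
  have -> : tau ^+ 4 = z ^+ 2 by rewrite /z; ring.
  have := sqr_ge0 (x - y); have := sqr_ge0 (y - z); have := sqr_ge0 (x - z).
  lra.
have Rbi : intg P (fun w => 3 * C1 ^+ 2 * (be w ^+ 6 + tau ^+ 2 * be w ^+ 2 + tau ^+ 4)).
  apply: intgZ; apply: intgD; last exact: intg_cst.
  by apply: intgD => //; exact: intgZ.
have Ri : sqint P Rm.
  split=> //; apply: (le_intg _ _ Rbi); first exact: measurable_funX.
  by move=> w; rewrite ger0_norm ?sqr_ge0.
exists Rm, N; split=> //.
- by move=> w; rewrite -/(Xk w) /Rm /lin; ring.
- apply: (le_trans (mean_le (sqint_sqr Ri) Rbi Rb2)).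
  rewrite meanZ; last first.
    apply: intgD; last exact: intg_cst.
    by apply: intgD => //; exact: intgZ.
  rewrite meanD; last 2 first.
  - by apply: intgD => //; exact: intgZ.
  - exact: intg_cst.
  rewrite (meanD n6i (intgZ _ n2i)) meanZ// (mean_cst P).
  have h4 : tau ^+ 4 <= T0 * tau ^+ 3 by rewrite exprS ler_wpM2r// exprn_ge0.
  have h2 : tau ^+ 2 * mean P (fun w => be w ^+ 2) <= tau ^+ 2 * (Mr ^+ 2 * (Mr * tau)).
    by rewrite ler_wpM2l ?sqr_ge0.
  apply: (@le_trans _ _ (C2 * tau ^+ 3)); last first.
    by rewrite ler_wpM2r ?exprn_ge0// lerDl.
  have -> : C2 * tau ^+ 3 = 3 * C1 ^+ 2 * (Mr ^+ 6 * (Mr * (768 * tau ^+ 3)) +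
     tau ^+ 2 * (Mr ^+ 2 * (Mr * tau)) + T0 * tau ^+ 3) by rewrite /C2; ring.
  rewrite ler_wpM2l//; first by rewrite mulr_ge0 ?sqr_ge0.
  by rewrite lerD// lerD.
- move=> Z bZ.
  have bZ' : bounded_wrt (F u) (fun w => Z w * (2^-1 * c (Y w 0 k))).
    by apply: bounded_wrtM => //; exact: sF.
  rewrite -(noise_quadratic_ortho hF hB u0 uv bf bZ').
  by congr mean; apply/funext => w; rewrite /N mulrA.
- apply: (le_trans (mean_le (sqint_sqr Ni) Nbi Nb)).
  rewrite meanD; [|exact: intgZ|exact: intg_cst].
  rewrite meanZ// (mean_cst P).
  apply: (@le_trans _ _ (C3 * tau ^+ 2)); last first.
    by rewrite ler_wpM2r ?sqr_ge0// lerDr.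
  have -> : C3 * tau ^+ 2 = C ^+ 2 * K ^+ 4 * (Mr ^+ 4 * (Mr * (64 * tau ^+ 2))) +
      C ^+ 2 * K ^+ 4 * (Mr ^+ 2 * tau ^+ 2) by rewrite /C3; ring.
  by rewrite lerD2r ler_wpM2l// mulr_ge0 ?exprn_ge0.
Qed.

End scheme_local.

(** * Propagation of the error *)

Section one_step.
Context {d} {T : measurableType d} {R : realType} (P : probability T R).

(* The remainders of order tau^(3/2) cost one power of tau when paired with the
   error, whereas the remainders of order tau are orthogonal to it. *)
Lemma one_step_error (T0 C1 C2 tau mse : R) (e e' Rm N Dr W : T -> R) :
  0 < tau -> tau <= T0 -> 0 <= C1 -> 0 <= C2 -> 0 <= mse ->
  sqint P e -> measurable_fun setT e' ->
  sqint P Rm -> sqint P N -> sqint P Dr -> sqint P W ->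
  {ae P, forall w, e' w = e w + ((Rm w - Dr w) + (N w - W w))} ->
  mean P (fun w => e w * N w) = 0 -> mean P (fun w => e w * W w) = 0 ->
  mean P (fun w => Rm w ^+ 2) <= C1 * tau ^+ 3 ->
  mean P (fun w => N w ^+ 2) <= C1 * tau ^+ 2 ->
  mean P (fun w => Dr w ^+ 2) <= C2 * tau ^+ 2 * (tau + mse) ->
  mean P (fun w => W w ^+ 2) <= C2 * tau * (tau + mse) ->
  mean P (fun w => e' w ^+ 2) <= (1 + tau) * mean P (fun w => e w ^+ 2) +
    2 * (C1 + C2) * (3 + 2 * T0) * (tau ^+ 2 + tau * mse).
Proof.
move=> tau0 tauT C10 C20 mse0 ei me' Ri Ni Di Wi ee' eN eW bR bN bD bW.
have T00 : 0 <= T0 by exact: le_trans (ltW tau0) tauT.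
pose A w := Rm w - Dr w; pose H w := N w - W w.
have Ai : sqint P A by exact: sqintB.
have Hi : sqint P H by exact: sqintB.
have AHi : sqint P (fun w => A w + H w) by exact: sqintD.
have eHi := sqintD ei AHi.
have -> : mean P (fun w => e' w ^+ 2) = mean P (fun w => (e w + (A w + H w)) ^+ 2).
  apply: mean_ae; first exact: measurable_funX.
    by apply: measurable_funX; case: eHi.
  by apply: filterS ee' => w ->.
have eH0 : mean P (fun w => e w * H w) = 0.
  under [X in mean P X]eq_fun do rewrite mulrBr.
  by rewrite meanB ?eN ?eW ?subrr//; exact: sqintM.
have split : mean P (fun w => (e w + (A w + H w)) ^+ 2) =
    mean P (fun w => e w ^+ 2) + 2 * mean P (fun w => e w * A w) +
    mean P (fun w => (A w + H w) ^+ 2).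
  have -> : (fun w => (e w + (A w + H w)) ^+ 2) = (fun w => (e w ^+ 2 +
      2 * (e w * A w + e w * H w)) + (A w + H w) ^+ 2).
    by apply/funext => w; ring.
  have eA := sqintM ei Ai; have eH := sqintM ei Hi.
  have eAH := intgZ 2 (intgD eA eH).
  rewrite meanD; [|exact: intgD (sqint_sqr ei) eAH|exact: sqint_sqr].
  rewrite (meanD (sqint_sqr ei) eAH) (meanZ _ (intgD eA eH)) (meanD eA eH) eH0.
  by rewrite addr0.
have yA := mean_young tau0 ei Ai.
have sAH := mean_sqrD Ai Hi.
have subsq f g : sqint P f -> sqint P g -> mean P (fun w => (f w - g w) ^+ 2) <=
    2 * mean P (fun w => f w ^+ 2) + 2 * mean P (fun w => g w ^+ 2).
  move=> fi gi; have := mean_sqrD fi (sqintZ (-1) gi).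
  under [X in mean P X <= _]eq_fun do rewrite mulN1r.
  by under [X in _ <= _ + 2 * mean P X]eq_fun do rewrite mulN1r sqrrN.
have bA := subsq _ _ Ri Di; have bH := subsq _ _ Ni Wi.
have K0 : 0 <= 2 * (C1 + C2) * (tau ^+ 2 + tau * mse).
  by rewrite mulr_ge0 ?mulr_ge0 ?addr_ge0 ?sqr_ge0 ?mulr_ge0// ltW.
have c1 : 0 <= C1 * (tau * mse) by rewrite mulr_ge0// mulr_ge0// ltW.
have bH' : mean P (fun w => H w ^+ 2) <= 2 * (C1 + C2) * (tau ^+ 2 + tau * mse).
  by apply: (le_trans bH); lra.
have bA' : tau^-1 * mean P (fun w => A w ^+ 2) <=
    2 * (C1 + C2) * (tau ^+ 2 + tau * mse).
  rewrite mulrC ler_pdivrMr//; apply: (le_trans bA).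
  have : 0 <= C1 * (tau * mse) * tau by rewrite mulr_ge0// ltW.
  by lra.
have bA2 : mean P (fun w => A w ^+ 2) <=
    T0 * (2 * (C1 + C2) * (tau ^+ 2 + tau * mse)).
  apply: (@le_trans _ _ (tau * (2 * (C1 + C2) * (tau ^+ 2 + tau * mse)))).
    by rewrite -[leLHS](mulVKf (lt0r_neq0 tau0)) ler_wpM2l// ltW.
  by rewrite ler_wpM2r.
rewrite split.
have := ler_norm (mean P (fun w => e w * A w)).
set K := 2 * (C1 + C2) * (tau ^+ 2 + tau * mse) in K0 bH' bA' bA2 *.
(* One K comes from the Young term tau^-1 E A^2; splitting (A + H)^2 gives 2 K from H and 2 T0 K
   from A. *)
have -> : 2 * (C1 + C2) * (3 + 2 * T0) * (tau ^+ 2 + tau * mse) =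
  3 * K + 2 * (T0 * K) by rewrite /K; ring.
by lra.
Qed.

End one_step.

Section strong_error.
Context {disp} {Omega : measurableType disp} {R : realType}.
Context (P : probability Omega R) {d M : nat}.
Context {F : R -> set (set Omega)} {B : R -> Omega -> 'rV[R]_M}.
Hypothesis hF : filtration F.
Hypothesis hB : brownian_motion P F B.
Local Notation D := (cube R d).
Variables (g0 : 'rV[R]_d -> 'rV[R]_d) (g : 'I_M -> 'rV[R]_d -> 'rV[R]_d).
Hypothesis hg0 : classC_field D 2 g0.
Hypothesis hg : forall m, classC_field D 3 (g m).
Variables (f0 : 'I_d -> 'I_d -> 'rV[R]_d -> R)
  (f : 'I_M -> 'I_d -> 'I_d -> 'rV[R]_d -> R).
Hypothesis hf0 : forall k l, is_factor g0 k l (f0 k l).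
Hypothesis hf : forall m k l, is_factor (g m) k l (f m k l).
Variables (x0 : 'rV[R]_d) (X : R -> Omega -> 'rV[R]_d).
Hypothesis Dx0 : D x0.
Hypothesis hX : stratonovich_solution P F B g0 g x0 X.
Variable Phi : R -> R -> R -> R.
Hypothesis range : forall s gamma y, 0 <= s -> -1 <= y <= 1 ->
  -1 <= Phi s gamma y <= 1.
Hypothesis Phi0 : forall y, -1 <= y <= 1 -> Phi 0 0 y = y.
Hypothesis Phi_gamma : forall y, -1 <= y <= 1 -> dPhi Phi 0 1 0 0 0 y = sigma y.
Hypothesis Phi_s : forall y, -1 <= y <= 1 ->
  dPhi Phi 1 0 0 0 0 y + 2^-1 * dPhi Phi 0 2 0 0 0 y = 0.
Hypothesis Phi_C3 : classC (domPhi R) 3 (unc3 Phi).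

Let S := scheme Phi g f0 f B x0.

Lemma scheme_succ tau n w k : S tau n.+1 w 0 k =
  scheme_step g f0 f Phi k tau (S tau n w)
    (B (n.+1%:R * tau) w - B (n%:R * tau) w).
Proof. by rewrite /S /= mxE. Qed.

Lemma scheme_cube tau n w : 0 <= tau -> D (S tau n w).
Proof.
move=> tau0; elim: n => [|n ih]; first exact: Dx0.
by move=> k; rewrite scheme_succ; exact: scheme_step_range.
Qed.

Let succ_tau (tau : R) n : n.+1%:R * tau - n%:R * tau = tau.
Proof. by rewrite -mulrBl -natrB// subSnn mul1r. Qed.

Lemma scheme_adapted tau n k : 0 <= tau ->
  measurable_wrt (F (n%:R * tau)) (fun w => S tau n w 0 k).
Proof.
move=> tau0; elim: n k => [|n ih] k.
  by apply: measurable_wrt_cst; case: hF => + _ _; apply; rewrite mulr_ge0.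
under eq_fun do rewrite scheme_succ -[X in scheme_step _ _ _ _ _ X](succ_tau tau n).
apply: (scheme_step_adapted hF hB hg hf0 hf Phi_C3) => //.
- by rewrite mulr_ge0.
- by rewrite ler_wpM2r// ler_nat.
- by move=> w; exact: scheme_cube.
Qed.

(** The bound for component k contains the error of the whole vector, as the coefficients depend on
    all components; the recursion closes only after summing over k, which puts the factor d into K
    and gives e_(q+1) <= (1 + (1 + K) tau) e_q + K tau^2. *)
Lemma scheme_mean_square (T : R) : 0 < T -> exists2 C : R, 0 <= C &
  forall N n : nat, (0 < N)%N -> (n <= N)%N ->
    mean P (fun w => sqdist (clip x0 X (n%:R * (T / N%:R)) w) (S (T / N%:R) n w))
      <= C * (T / N%:R).
Proof.
move=> T_gt0; have T0 := ltW T_gt0.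
have [C2 C20 sde] := sde_euler_local hF hB Dx0 (@gbar0_lipschitz _ _ _ _ _ hg0 hg)
  (@g_lipschitz _ _ _ _ hg) hX T0.
have [C1 C10 sch] := scheme_local hF hB hg0 hg hf0 hf range Phi0 Phi_gamma Phi_s
  Phi_C3 T0.
pose K := d%:R * (2 * (C1 + C2) * (3 + 2 * T)).
have K0 : 0 <= K by rewrite !mulr_ge0 ?addr_ge0 ?mulr_ge0.
exists (T * K * expR ((1 + K) * T)).
  by apply: mulr_ge0; [exact: mulr_ge0|exact: expR_ge0].
move=> N n N0 nN; set tau := T / N%:R.
have tau0 : 0 < tau by rewrite divr_gt0// ltr0n.
have tau0' := ltW tau0.
have tauT : tau <= T by rewrite ler_pdivrMr ?ltr0n// ler_peMr// ler1n.
pose e q := mean P (fun w => sqdist (clip x0 X (q%:R * tau) w) (S tau q w)).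
apply: (@discrete_gronwall R e N (1 + K) K tau T _ _ _ _ _ _ n nN) => //.
- by rewrite addr_ge0.
- by rewrite mulrC divfK ?pnatr_eq0 -?lt0n.
- have Cm k : sqint P (fun w => clip x0 X 0 w 0 k - x0 0 k).
    apply: (sqint_bounded (K := 2) P).
      apply: measurable_funB => //; case: hF => _ Fm _.
      exact: (measurable_wrt_fun (Fm 0 (lexx 0)) (clip_adapted hF hX k (lexx 0))).
    move=> w; have := clip_cube X Dx0 0 w k; have := Dx0 k.
    by rewrite ler_norml => /andP[? ?] /andP[? ?]; apply/andP; split; lra.
  rewrite /e /sqdist mul0r /S/= mean_sum; last by move=> k; exact: sqint_sqr.
  by apply: big1 => k _; exact: (clip_initial hF hB hX).
move=> q qN.
set u := q%:R * tau; set v := q.+1%:R * tau.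
have u0 : 0 <= u by rewrite mulr_ge0.
have vuE : v - u = tau by exact: succ_tau.
have uv : u < v by rewrite -subr_gt0 vuE.
have v0 : 0 <= v by exact: le_trans (ltW uv).
have vuT : v - u <= T by rewrite vuE.
have DS r w : D (S tau r w) by exact: scheme_cube.
have mS j : measurable_wrt (F u) (fun w => S tau q w 0 j) by exact: scheme_adapted.
have err r k : bounded_wrt (F (r%:R * tau))
    (fun w => S tau r w 0 k - clip x0 X (r%:R * tau) w 0 k).
  have rt : 0 <= r%:R * tau by rewrite mulr_ge0.
  split.
    apply: measurable_wrtB; first by case: hF => + _ _; exact.
      exact: scheme_adapted.
    exact: (clip_adapted hF hX k rt).
  exists 2 => w; have := clip_cube X Dx0 (r%:R * tau) w k; have := DS r w k.
  by rewrite ler_norml => /andP[? ?] /andP[? ?]; apply/andP; split; lra.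
have erri r k : sqint P (fun w => S tau r w 0 k - clip x0 X (r%:R * tau) w 0 k).
  apply: (bounded_wrt_sqint P _ (err r k)).
  by case: hF => _ + _; apply; rewrite mulr_ge0.
have eE r : e r = \sum_k mean P (fun w =>
    (S tau r w 0 k - clip x0 X (r%:R * tau) w 0 k) ^+ 2).
  rewrite /e -mean_sum; last by move=> k; exact: sqint_sqr.
  congr mean; apply/funext => w; apply: eq_bigr => k _.
  by rewrite -sqrrN opprB.
have e0 r : 0 <= e r by apply: mean_ge0 => w; exact: sqdist_ge0.
have step k : mean P (fun w => (S tau q.+1 w 0 k - clip x0 X v w 0 k) ^+ 2) <=
    (1 + tau) * mean P (fun w => (S tau q w 0 k - clip x0 X u w 0 k) ^+ 2) +
    2 * (C1 + C2) * (3 + 2 * T) * (tau ^+ 2 + tau * e q).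
  have [Dr [W [[Di Wi] cE bD oW bW]]] := sde u v (S tau q) k u0 (ltW uv) vuT (DS q) mS.
  have [Rm [N' [[Ri Ni] sE bR oN bN]]] := sch u v (S tau q) k u0 uv vuT (DS q) mS.
  rewrite -/(e q) in bD bW; rewrite vuE in bD bW bR bN cE sE.
  apply: (one_step_error tau0 tauT C10 C20 (e0 q) (erri q k) _ Ri Ni Di Wi) => //.
  - by case: (erri q.+1 k).
  (* Both expansions are at the scheme value, so the Euler terms cancel and only the four remainders
     are left. *)
  - apply: filterS cE => w cE.
    have -> : clip x0 X v w 0 k = clip x0 X u w 0 k +
      (clip x0 X v w 0 k - clip x0 X u w 0 k) by rewrite addrC subrK.
    by rewrite cE scheme_succ sE; ring.
  - exact: oN (err q k).
  - exact: oW (err q k).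
rewrite [leLHS]eE; apply: (le_trans (ler_sum _ (fun k _ => step k))).
rewrite big_split/= -mulr_sumr -eE sumr_const card_ord -[_ *+ d]mulr_natl.
by rewrite le_eqVlt; apply/orP; left; apply/eqP; rewrite /K; ring.
Qed.

End strong_error.

(** * From the mean square bound to the stated estimate *)

Lemma expectation_ae {d} {T : measurableType d} {R : realType}
    (P : probability T R) (f g : T -> R) :
  measurable_fun setT f -> measurable_fun setT g ->
  {ae P, forall w, f w = g w} -> ('E_P[f] = 'E_P[g])%E.
Proof.
move=> mf mg fg; rewrite unlock; apply: ae_eq_integral => //.
- exact/measurable_EFinP.
- exact/measurable_EFinP.
by apply: filterS fg => w /= -> _.
Qed.

Lemma enorm_sqdist {R : realType} (n : nat) (x y : 'rV[R]_n) :
  enorm (x - y) ^+ 2 = sqdist y x.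
Proof.
have E : dotp (x - y) (x - y) = sqdist y x.
  by apply: eq_bigr => k _; rewrite !mxE -expr2 -sqrrN opprB.
by rewrite /enorm sqr_sqrtr E// sqdist_ge0.
Qed.

Theorem corollary12 (R : realType)
    (disp : measure_display) (Omega : measurableType disp)
    (P : probability Omega R)
    (d M : nat) (hd : (0 < d)%N) (hM : (0 < M)%N)
    (F : R -> set (set Omega)) (hF : filtration F)
    (B : R -> Omega -> 'rV[R]_M) (hB : brownian_motion P F B)
    (g0 : 'rV[R]_d -> 'rV[R]_d) (g : 'I_M -> 'rV[R]_d -> 'rV[R]_d)
    (hg0 : classC_field (cube R d) 2 g0)
    (hg : forall m, classC_field (cube R d) 3 (g m))
    (hg0_bd : forall x, boundary (cube R d) x -> g0 x = 0)
    (hg_bd : forall m x, boundary (cube R d) x -> g m x = 0)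
    (f0 : 'I_d -> 'I_d -> 'rV[R]_d -> R)
    (f : 'I_M -> 'I_d -> 'I_d -> 'rV[R]_d -> R)
    (hf0 : forall k l, is_factor g0 k l (f0 k l))
    (hf : forall m k l, is_factor (g m) k l (f m k l))
    (x0 : 'rV[R]_d) (hx0 : cube R d x0)
    (X : R -> Omega -> 'rV[R]_d)
    (hX : stratonovich_solution P F B g0 g x0 X)
    (Phi : R -> R -> R -> R)
    (hPhi_range : forall s gamma y, 0 <= s -> -1 <= y <= 1 ->
       -1 <= Phi s gamma y <= 1)
    (hPhi0 : forall y, -1 <= y <= 1 -> Phi 0 0 y = y)
    (hPhi_gamma : forall y, -1 <= y <= 1 -> dPhi Phi 0 1 0 0 0 y = sigma y)
    (hPhi_s : forall y, -1 <= y <= 1 ->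
       dPhi Phi 1 0 0 0 0 y + 2^-1 * dPhi Phi 0 2 0 0 0 y = 0)
    (hPhiC3 : classC (domPhi R) 3 (unc3 Phi))
    (beta : R) (hbeta : 0 < beta)
    (hPhi_norm : (norm_pbeta 3 beta Phi < +oo)%E) :
  forall T : R, 0 < T ->
  exists2 C : R, 0 < C &
    forall N : nat, (0 < N)%N ->
      let tau := T / N%:R in
      (ereal_sup
         [set 'E_P[fun w => (enorm (scheme Phi g f0 f B x0 tau n w
                                    - X (n%:R * tau)%R w) ^+ 2)%R] `^ 2^-1
         | n in [set n : nat | (n <= N)%N]]
       <= (C * (tau `^ 2^-1)%R)%:E)%E.
Proof.
move=> T T0.
have [C0 C00 err] := scheme_mean_square hF hB hg0 hg hf0 hf hx0 hX hPhi_range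
  hPhi0 hPhi_gamma hPhi_s hPhiC3 T0.
(* C0 may be 0 while the constant has to be positive; hence the added 1. *)
exists (C0 `^ 2^-1 + 1); first by rewrite ltr_wpDl ?powR_ge0.
move=> N N0; lazy zeta; set tau := T / N%:R; apply: ge_ereal_sup => _ [n /= nN <-].
have tau0 : 0 <= tau by rewrite divr_ge0// ltW.
have t0 : 0 <= n%:R * tau by rewrite mulr_ge0.
have [sF Fm _] := hF.
have mX k : measurable_fun setT (fun w => X (n%:R * tau) w 0 k).
  have [adX _ _ _] := hX; apply: (measurable_wrt_fun (Fm _ t0)); exact: adX.
have mC k : measurable_fun setT (fun w => clip x0 X (n%:R * tau) w 0 k).
  exact: (measurable_wrt_fun (Fm _ t0) (clip_adapted hF hX k t0)).
have mS k : measurable_fun setT (fun w => scheme Phi g f0 f B x0 tau n w 0 k).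
  apply: (measurable_wrt_fun (Fm _ t0)).
  exact: (scheme_adapted hF hB hg hf0 hf hx0 hPhi_range hPhiC3).
have DS w : cube R d (scheme Phi g f0 f B x0 tau n w).
  exact: scheme_cube.
pose h w := sqdist (clip x0 X (n%:R * tau) w) (scheme Phi g f0 f B x0 tau n w).
have msq (Z : Omega -> 'rV[R]_d) : (forall k, measurable_fun setT (fun w => Z w 0 k)) ->
    measurable_fun setT (fun w => sqdist (Z w) (scheme Phi g f0 f B x0 tau n w)).
  move=> mZ; apply: measurable_sum => k; apply: measurable_funX.
  exact: measurable_funB.
(* X is exchanged for [clip], which equals it almost surely and is bounded everywhere: the
   expectation is then a real number. *)
have -> : ('E_P[fun w => (enorm (scheme Phi g f0 f B x0 tau n w
    - X (n%:R * tau)%R w) ^+ 2)%R] = (mean P h)%:E)%E.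
  rewrite -meanE.
    under eq_fun do rewrite enorm_sqdist.
    apply: expectation_ae; [exact: msq|exact: msq|].
    by apply: filterS (clip_ae hX) => w Xw; rewrite Xw.
  apply: (intg_bounded P (K := d%:R * 4)); first exact: msq.
  move=> w; rewrite ger0_norm ?sqdist_ge0// /h /sqdist.
  apply: (@le_trans _ _ (\sum_(k < d) 4)); last first.
    by rewrite sumr_const card_ord -[leLHS]mulr_natl.
  apply: ler_sum => k _; have := DS w k; have := clip_cube X hx0 (n%:R * tau) w k.
  by move=> /andP[? ?] /andP[? ?]; nra.
rewrite poweR_EFin lee_fin mulrDl mul1r.
apply: (@le_trans _ _ ((C0 * tau) `^ 2^-1)).
  apply: ge0_ler_powR; [|rewrite nnegrE|rewrite nnegrE|].
  - by rewrite invr_ge0.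
  - by apply: mean_ge0 => w; exact: sqdist_ge0.
  - exact: (mulr_ge0 C00 tau0).
  - exact: err.
by rewrite powRM// lerDl powR_ge0.
Qed.
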